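(* Let $n\ge2$, $1<q<2$, and let $u$ be a nodal solution of $$u''+\frac{n-1}{r}u'+u-|u|^{q-2}u=0,\qquad u(0)=\alpha>0,\quad u'(0)=0.$$ Let $k\ge1$, and suppose that $u$ has exactly $k$ zeros before $z_u$ if $u$ is a bound state, and has exactly $k+1$ zeros before $z_u=+\infty$ if $u$ is not a bound state. Then $$Q(c_1)>0,\qquad M(c_1)>0,\qquad T_2(c_1)>0.$$ Furthermore, the following statements hold. (i) If $i\in\{2,\dots,k\}$ and $Q(c_{i-1})>0$, $M(c_{i-1})>0$, $T_2(c_{i-1})>0$, then $v$ has a unique zero $\tau_i$ in $[c_{i-1},c_i]$, with $\tau_i\in(c_{i-1},r_i)$, and $Q(c_i)>0$, $M(c_i)>0$, $T_2(c_i)>0$. (ii) If $u$ is not a bound state and $Q(c_k)>0$, $M(c_k)>0$, $T_2(c_k)>0$, then $v$ has a unique zero $\tau_{k+1}$ in $[c_k,z_{k+1}]$, with $\tau_{k+1}\in(c_k,r_{k+1})$. (iii) If $u$ is a bound state and $Q(c_k)>0$, $M(c_k)>0$, $T_2(c_k)>0$, then $v$ has a unique zero $\tau_{k+1}$ in $[c_k,z_u)$, with $\tau_{k+1}\in(c_k,r_{k+1})$. Moreover, $v$ is eventually monotone as $r\uparrow z_u$, and $\lim_{r\uparrow z_u}|v(r)|=\infty$.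
   Context: Let $f(u)=u-|u|^{q-2}u$, $F(u)=\frac12u^2-\frac1q|u|^q$, and $\alpha_*=(2/q)^{1/(2-q)}$, the positive zero of $F$. $z_u\in(0,+\infty]$ is the first double zero of $u$, i.e. the first $r$ with $u=u'=0$ ($+\infty$ if none); zeros ''before $z_u$'' are zeros in $(0,z_u)$, and they are all simple. A nodal solution is one that changes sign in $(0,z_u)$; a bound state is a solution that changes sign with $u(r)\to0$ as $r\to\infty$ (then $z_u<\infty$). $v=\partial_\alpha u$ is the derivative of $u(r,\alpha)$ with respect to the initial value; it is $C^1$ on $[0,z_u)$ and satisfies $v''+\frac{n-1}rv'+f'(u)v=0$ off the zeros of $u$, $v(0)=1$, $v'(0)=0$. Labels. Let $z_1<z_2<\cdots$ be the zeros of $u$ in $(0,z_u)$; if $u$ is a bound state with $k$ zeros put $z_{k+1}:=z_u$. The critical points of $u$ in $[0,z_{k+1})$ are exactly $0=c_0<c_1<\cdots<c_k$ with $c_i\in(z_i,z_{i+1})$ for $1\le i\le k$, and $|u(c_i)|>\alpha_*$. For $1\le i\le k+1$, $r_i$ is the unique point of $(c_{i-1},z_i)$ with $|u(r_i)|=1$. Auxiliary functions: $$Q(r)=r^n[u'v'+f(u)v]+(n-2)r^{n-1}u'v,\qquad M(r)=r^{n-1}(u'v-uv'),$$ $$T_2(r)=Q(r)-g_2(u(r))M(r),\qquad g_2(u)=\frac{2F(u)}{uf(u)-2F(u)}=\frac{q|u|^{2-q}-2}{2-q}.$$ *)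

(* Defs.v *)
From Stdlib Require Import Reals Lra.
From Coquelicot Require Import Coquelicot.
Open Scope R_scope.

(** [|x|^p], with value [0] at [x = 0] ([Rpower 0 p] is [1]). *)
Definition powabs (x p : R) : R :=
  if Req_EM_T x 0 then 0 else Rpower (Rabs x) p.

Definition f (q u : R) : R := u - powabs u (q - 2) * u.
Definition F (q u : R) : R := / 2 * u ^ 2 - / q * powabs u q.

(** The closed form is used because, unlike the quotient in [g2E], it is also
    meaningful at [u = 0]. *)
Definition g2 (q u : R) : R := (q * powabs u (2 - q) - 2) / (2 - q).

Lemma g2E (q u : R) : 1 < q < 2 -> u <> 0 ->
  g2 q u = 2 * F q u / (u * f q u - 2 * F q u).
Proof.
intros Hq Hu; unfold g2, F, f, powabs.
destruct (Req_EM_T u 0) as [e|_]; [now case Hu|].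
assert (Ha : 0 < Rabs u) by now apply Rabs_pos_lt.
set (A := Rpower (Rabs u) q).
assert (HA : 0 < A) by apply exp_pos.
assert (H2 : Rpower (Rabs u) 2 = u ^ 2).
{ change 2 with (INR 2) at 1; rewrite (Rpower_pow 2 _ Ha).
  now rewrite pow2_abs. }
assert (E1 : Rpower (Rabs u) (q - 2) = A / u ^ 2).
{ unfold Rminus; rewrite Rpower_plus, Rpower_Ropp, H2; reflexivity. }
assert (E2 : Rpower (Rabs u) (2 - q) = u ^ 2 / A).
{ unfold Rminus; rewrite Rpower_plus, Rpower_Ropp, H2; reflexivity. }
rewrite E1, E2.
replace (u * (u - A / u ^ 2 * u) - 2 * (/ 2 * u ^ 2 - / q * A))
  with ((2 - q) / q * A) by (field; lra).
field; lra.
Qed.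

(** [w] is C^1 on [[0, b)] with [w(0) = w0] and [w'(0) = w1]. The derivative at
    [0] is one-sided, hence stated apart: [Derive w 0] is never meaningful,
    since the values of [w] on the negative axis are unconstrained. *)
Record C1_init (w : R -> R) (b : Rbar) (w0 w1 : R) : Prop := {
  C1_value : w 0 = w0;
  C1_slope : filterlim (fun r => (w r - w 0) / r) (at_right 0) (locally w1);
  C1_cont0 : filterlim (Derive w) (at_right 0) (locally w1);
  C1_deriv : forall r, 0 < r -> Rbar_lt r b -> ex_derive w r;
  C1_cont : forall r, 0 < r -> Rbar_lt r b -> continuous (Derive w) r
}.

Record solution (n : nat) (q a : R) (u : R -> R) : Prop := {
  sol_C1 : C1_init u p_infty a 0;
  sol_C2 : forall r, 0 < r -> ex_derive (Derive u) r;
  sol_ode : forall r, 0 < r ->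
    Derive (Derive u) r + (INR n - 1) / r * Derive u r + f q (u r) = 0
}.

Definition double_zero (u : R -> R) (r : R) : Prop :=
  0 < r /\ u r = 0 /\ Derive u r = 0.

(** A solution is positive at [0], so only [r > 0] has to be considered. *)
Definition first_double_zero (u : R -> R) (zu : Rbar) : Prop :=
  match zu with
  | Finite z => double_zero u z /\ forall r, r < z -> ~ double_zero u r
  | p_infty => forall r, ~ double_zero u r
  | m_infty => False
  end.

Definition changes_sign (u : R -> R) (b : Rbar) : Prop :=
  exists s t, (0 < s /\ Rbar_lt s b) /\ (0 < t /\ Rbar_lt t b) /\
    0 < u s /\ u t < 0.

Definition bound_state (u : R -> R) : Prop :=
  changes_sign u p_infty /\ is_lim u p_infty 0.

(** [z 1 < ... < z m] is the list of all the zeros of [u] in [(0, zu)]; in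
    particular there are exactly [m] of them. *)
Definition zeros_before (u : R -> R) (zu : Rbar) (m : nat) (z : nat -> R)
  : Prop :=
  (forall i j, (1 <= i)%nat -> (i < j)%nat -> (j <= m)%nat -> z i < z j) /\
  (forall r, (0 < r /\ Rbar_lt r zu /\ u r = 0) <->
             exists i, (1 <= i <= m)%nat /\ r = z i).

(** [v] is the derivative at [a = alpha] of the family [U a] of solutions, where
    [U a] has initial value [a]. Solutions may fail to be unique after a double
    zero, but on [[0, zu)] the derivative does not depend on the choice of the
    family. *)
Record variation (n : nat) (q alpha : R) (U : R -> R -> R) (zu : Rbar)
    (v : R -> R) : Prop := {
  var_derive : forall r, 0 <= r -> Rbar_lt r zu ->
    is_derive (fun a => U a r) alpha (v r);
  var_C1 : C1_init v zu 1 0;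
  var_C2 : forall r, 0 < r -> Rbar_lt r zu -> U alpha r <> 0 ->
    ex_derive (Derive v) r;
  var_ode : forall r, 0 < r -> Rbar_lt r zu -> U alpha r <> 0 ->
    Derive (Derive v) r + (INR n - 1) / r * Derive v r
      + Derive (f q) (U alpha r) * v r = 0
}.

(** For a solution these conditions determine [c i] and [rr i] uniquely, and
    [c 0, ..., c k] are then all the critical points of [u] before [z (k+1)]. *)
Record labels (u : R -> R) (k : nat) (z c rr : nat -> R) : Prop := {
  lab_c0 : c 0%nat = 0;
  lab_c : forall i, (1 <= i <= k)%nat ->
    z i < c i < z (i + 1)%nat /\ Derive u (c i) = 0;
  lab_r : forall i, (1 <= i <= k + 1)%nat ->
    c (i - 1)%nat < rr i < z i /\ Rabs (u (rr i)) = 1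
}.

Definition Qf (n : nat) (q : R) (u v : R -> R) (r : R) : R :=
  r ^ n * (Derive u r * Derive v r + f q (u r) * v r)
  + (INR n - 2) * r ^ (n - 1) * Derive u r * v r.

Definition Mf (n : nat) (u v : R -> R) (r : R) : R :=
  r ^ (n - 1) * (Derive u r * v r - u r * Derive v r).

Definition T2 (n : nat) (q : R) (u v : R -> R) (r : R) : R :=
  Qf n q u v r - g2 q (u r) * Mf n u v r.

Definition QMT_pos (n : nat) (q : R) (u v : R -> R) (r : R) : Prop :=
  0 < Qf n q u v r /\ 0 < Mf n u v r /\ 0 < T2 n q u v r.

Definition eventually_monotone_left (w : R -> R) (b : R) : Prop :=
  exists a, a < b /\
    ((forall s t, a < s -> s <= t -> t < b -> w s <= w t) \/
     (forall s t, a < s -> s <= t -> t < b -> w t <= w s)).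

(* Main.v *)
From Stdlib Require Import Reals.
From Coquelicot Require Import Coquelicot.
From Stdlib Require Import Lra Lia Psatz Classical ClassicalEpsilon FunctionalExtensionality.
(* Last, since [f] is also a field of [Reals]' record [family]. *)
Require Import Defs.
Open Scope R_scope.

(* Up to sign, [u] is positive and decreasing on the descent [(c_(i-1), z_i)], and
   positive and increasing on the ascent [(z_i, c_i)].

   On a descent [v > 0] at first; the Wronskian of [v] and [u - 1] forces a zero
   [tau] of [v] before [r_i], because [f] is convex to the right of its zero [1].
   Up to [tau] both [M] and [T_2] increase. After [tau], as long as [F (u) >= 0],
   [M] and [T_2] keep each other positive, by the identity
   [v A = r u' M + u Q] with [A > 0] (Pohozaev); hence [v < 0] and [Q > 0]. Where
   [F (u) < 0], the same role is played by [theta = v / u'] and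
   [X = r^n J - 2 E r^(n-1) theta], with [J = u'^2 theta'] and [E] the energy,
   because [X' = - 2 F (u) r^(n-1) (theta' + (n-1) theta / r)]; moreover [X = Q] where
   [F (u) = 0]. So [v] has no second zero before [c_i], and [Q (c_i), M (c_i) > 0].

   For [T_2 (c_i)] set [b = |u (c_i)|]. Then [Q - g_2 (b) M] is positive at [z_i]: if
   [a] is the amplitude with [F (a) = E], then [Q - g_2 (a) M] is positive up to
   [tau] (a barrier argument resting on the log-concavity of [|u|] and on Bernoulli's
   inequality), while [F (b) < E]; beyond [tau], and on the ascent, the derivative of
   [Q - g_2 (b) M] is [d/dr (weight_int b u)] times the nondecreasing function
   [r^(n-1) theta], and [weight_int b] vanishes at [0] and [b], so Chebyshev's
   integral inequality applies.

   At a double zero [J] stays bounded below whereas [u''] tends to [0]; comparing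
   [theta] with a large multiple of [1 / |u'|] gives [|v| -> oo]. *)

(** * One-sided continuity and monotonicity *)

(** The obstacle is that [f] is not differentiable at [0]: [f' (u)] tends to minus infinity there,
    so [v'] is only continuous at the zeros of [u], and [v] is not controlled at a double zero.
    Derivatives are therefore taken on open intervals, and one-sided continuity carries the
    inequalities to the ends.

    One computation yields the derivatives of the functionals of [v]. With
    [L w = w'' + (n-1)/r w' + f' (u) w], the Wronskian [r^(n-1) (w v' - w' v)] has derivative
    [- r^(n-1) v (L w)]. It equals [Q] for [w = r u'], [- M] for [w = u], and [r^(n-1) J] for
    [w = u']. For [w = r u' + g_2 (b) u] it equals [Q - g_2 (b) M], and
    [L w = - u (2 - q |u|^(q-2) / |b|^(q-2))]. Freezing the level [b] thus gives a derivative
    proportional to [v], whereas the moving level [b = u] of [T_2] adds a term in [M], singular at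
    [u = 0]. Hence [T_2] is used at some distance from the zeros of [u], and zeros are crossed with
    a frozen level.

    Where [F (u) < 0], [g_2 (u)] is negative, and positive [M] and [T_2] no longer give [Q > 0];
    this is what forces the change to [X]. *)

Ltac pos :=
  first
  [ assumption
  | lazymatch goal with
    | |- 0 < _ * _ => apply Rmult_lt_0_compat
    | |- 0 < _ / _ => apply Rdiv_lt_0_compat
    | |- 0 < / _ => apply Rinv_0_lt_compat
    | |- 0 < _ ^ _ => apply pow_lt
    end; pos
  | lra ].

Lemma pos_factor a b : 0 < a -> 0 < a * b -> 0 < b.
Proof. intros Ha Hab; apply (Rmult_lt_reg_l a); [trivial|now rewrite Rmult_0_r]. Qed.

(** The filter is a parameter so that one set of rules serves two-sided continuity inside an
    interval and one-sided continuity at its ends. *)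
Definition continuous_along (G : (R -> Prop) -> Prop) (g : R -> R) (c : R) : Prop :=
  filterlim g G (locally (g c)).

Lemma continuous_along_const G (HG : Filter G) (a c : R) :
  continuous_along G (fun _ => a) c.
Proof. apply filterlim_const. Qed.

Lemma continuous_along_plus G (HG : Filter G) g h c :
  continuous_along G g c -> continuous_along G h c ->
  continuous_along G (fun r => g r + h r) c.
Proof.
intros Hg Hh.
apply (filterlim_comp_2 (H := locally (h c)) (G := locally (g c)) g h Rplus Hg Hh).
apply (filterlim_plus (g c) (h c)).
Qed.

Lemma continuous_along_mult G (HG : Filter G) g h c :
  continuous_along G g c -> continuous_along G h c ->
  continuous_along G (fun r => g r * h r) c.
Proof.
intros Hg Hh.
apply (filterlim_comp_2 (H := locally (h c)) (G := locally (g c)) g h Rmult Hg Hh).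
apply (filterlim_mult (g c) (h c)).
Qed.

Lemma continuous_along_comp G (HG : Filter G) g (h : R -> R) c :
  continuous_along G g c -> continuous h (g c) ->
  continuous_along G (fun r => h (g r)) c.
Proof. intros Hg Hh. exact (filterlim_comp _ _ _ _ _ _ _ _ Hg Hh). Qed.

Lemma continuous_along_opp G (HG : Filter G) g c :
  continuous_along G g c -> continuous_along G (fun r => - g r) c.
Proof.
intros Hg. apply (continuous_along_comp G HG g Ropp c Hg).
apply (continuous_opp (V := R_NormedModule) (fun x => x)). apply continuous_id.
Qed.

Lemma continuous_along_minus G (HG : Filter G) g h c :
  continuous_along G g c -> continuous_along G h c ->
  continuous_along G (fun r => g r - h r) c.
Proof.
intros Hg Hh. apply continuous_along_plus; trivial.
now apply continuous_along_opp.
Qed.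

Lemma continuous_along_inv G (HG : Filter G) g c :
  continuous_along G g c -> g c <> 0 -> continuous_along G (fun r => / g r) c.
Proof.
intros Hg Hc. apply (continuous_along_comp G HG g Rinv c Hg).
apply (ex_derive_continuous (V := R_NormedModule)).
auto_derive; trivial.
Qed.

Lemma continuous_along_div G (HG : Filter G) g h c :
  continuous_along G g c -> continuous_along G h c -> h c <> 0 ->
  continuous_along G (fun r => g r / h r) c.
Proof.
intros Hg Hh Hc. apply continuous_along_mult; trivial.
now apply continuous_along_inv.
Qed.

Lemma continuous_along_pow G (HG : Filter G) g m c :
  continuous_along G g c -> continuous_along G (fun r => g r ^ m) c.
Proof.
intros Hg; induction m as [|m IH]; simpl.
- now apply continuous_along_const.
- now apply continuous_along_mult.
Qed.

Lemma continuous_along_id_right c : continuous_along (at_right c) (fun r => r) c.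
Proof.
intros P [e He]; exists e; intros y Hy _; now apply He.
Qed.

Lemma continuous_right (g : R -> R) (c : R) : continuous g c -> continuous_along (at_right c) g c.
Proof.
intros H P HP. destruct (H P HP) as [e He]; exists e; intros y Hy _; now apply He.
Qed.

Lemma continuous_left (g : R -> R) (c : R) : continuous g c -> continuous_along (at_left c) g c.
Proof.
intros H P HP. destruct (H P HP) as [e He]; exists e; intros y Hy _; now apply He.
Qed.

Lemma is_derive_continuous (g : R -> R) (r l : R) : is_derive g r l -> continuous g r.
Proof.
intros H; apply (ex_derive_continuous (V := R_NormedModule)); now exists l.
Qed.

Lemma continuous_along_pos G (HG : Filter G) g c :
  continuous_along G g c -> 0 < g c -> G (fun r => 0 < g r).
Proof.
intros Hg Hc. apply Hg. exists (mkposreal _ Hc). intros y Hy.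
change (Rabs (y - g c) < g c) in Hy. apply Rabs_def2 in Hy. lra.
Qed.

Lemma at_right_ex c (P : R -> Prop) : at_right c P ->
  exists d, 0 < d /\ forall r, c < r < c + d -> P r.
Proof.
intros [e He]; exists e; split; [apply cond_pos|].
intros r Hr; apply He; [|lra].
change (Rabs (r - c) < e). apply Rabs_def1; lra.
Qed.

Lemma at_left_ex c (P : R -> Prop) : at_left c P ->
  exists d, 0 < d /\ forall r, c - d < r < c -> P r.
Proof.
intros [e He]; exists e; split; [apply cond_pos|].
intros r Hr; apply He; [|lra].
change (Rabs (r - c) < e). apply Rabs_def1; lra.
Qed.

Lemma locally_ex c (P : R -> Prop) : locally c P ->
  exists d, 0 < d /\ forall r, c - d < r < c + d -> P r.
Proof.
intros [e He]; exists e; split; [apply cond_pos|].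
intros r Hr; apply He.
change (Rabs (r - c) < e). apply Rabs_def1; lra.
Qed.

Lemma ex_at_right c (P : R -> Prop) d : 0 < d ->
  (forall r, c < r < c + d -> P r) -> at_right c P.
Proof.
intros Hd H; exists (mkposreal d Hd); intros y Hy Hc.
change (Rabs (y - c) < d) in Hy. apply Rabs_def2 in Hy. apply H; lra.
Qed.

Lemma ex_at_left c (P : R -> Prop) d : 0 < d ->
  (forall r, c - d < r < c -> P r) -> at_left c P.
Proof.
intros Hd H; exists (mkposreal d Hd); intros y Hy Hc.
change (Rabs (y - c) < d) in Hy. apply Rabs_def2 in Hy. apply H; lra.
Qed.

Lemma right_limit_le g c b y : c < b -> continuous_along (at_right c) g c ->
  (forall r, c < r < b -> g r <= y) -> g c <= y.
Proof.
intros Hb Hg H. apply Rnot_lt_le; intros Hy.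
assert (Hp : at_right c (fun r => 0 < g r - y)).
{ apply (continuous_along_pos _ _ (fun r => g r - y) c); [|lra].
  apply continuous_along_minus; trivial; try apply _.
  apply continuous_along_const; apply _. }
destruct (at_right_ex _ _ Hp) as [d [Hd Hr]].
set (r := c + Rmin (d / 2) ((b - c) / 2)).
assert (Rmin (d / 2) ((b - c) / 2) <= d / 2) by apply Rmin_l.
assert (Rmin (d / 2) ((b - c) / 2) <= (b - c) / 2) by apply Rmin_r.
assert (0 < Rmin (d / 2) ((b - c) / 2)) by (apply Rmin_pos; lra).
assert (H3 : 0 < g r - y) by (apply Hr; unfold r; lra).
assert (H4 : g r <= y) by (apply H; unfold r; lra). lra.
Qed.

Lemma left_limit_le g b c y : b < c -> continuous_along (at_left c) g c ->
  (forall r, b < r < c -> g r <= y) -> g c <= y.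
Proof.
intros Hb Hg H. apply Rnot_lt_le; intros Hy.
assert (Hp : at_left c (fun r => 0 < g r - y)).
{ apply (continuous_along_pos _ _ (fun r => g r - y) c); [|lra].
  apply continuous_along_minus; trivial; try apply _.
  apply continuous_along_const; apply _. }
destruct (at_left_ex _ _ Hp) as [d [Hd Hr]].
set (r := c - Rmin (d / 2) ((c - b) / 2)).
assert (Rmin (d / 2) ((c - b) / 2) <= d / 2) by apply Rmin_l.
assert (Rmin (d / 2) ((c - b) / 2) <= (c - b) / 2) by apply Rmin_r.
assert (0 < Rmin (d / 2) ((c - b) / 2)) by (apply Rmin_pos; lra).
assert (H3 : 0 < g r - y) by (apply Hr; unfold r; lra).
assert (H4 : g r <= y) by (apply H; unfold r; lra). lra.
Qed.

Lemma left_limit_ge g b c y : b < c -> continuous_along (at_left c) g c ->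
  (forall r, b < r < c -> y <= g r) -> y <= g c.
Proof.
intros Hb Hg H.
cut (- g c <= - y); [lra|].
apply (left_limit_le (fun r => - g r) b); trivial.
- apply continuous_along_opp; trivial; apply _.
- intros r Hr; specialize (H r Hr); lra.
Qed.

(** * Monotonicity from the sign of a derivative, and first-zero arguments *)

Lemma derive_nonneg_le (g dg : R -> R) a b : a <= b ->
  (forall r, a <= r <= b -> is_derive g r (dg r)) ->
  (forall r, a <= r <= b -> 0 <= dg r) -> g a <= g b.
Proof.
intros Hab Hd Hp.
destruct (MVT_gen g a b dg) as [x [Hx E]];
  rewrite ?Rmin_left, ?Rmax_right in *; try lra.
- intros; apply Hd; lra.
- intros x Hx; apply continuity_pt_filterlim.
  exact (is_derive_continuous _ _ _ (Hd x Hx)).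
- assert (0 <= dg x * (b - a)) by (apply Rmult_le_pos; [apply Hp|]; lra). lra.
Qed.

Lemma derive_pos_lt (g dg : R -> R) a b : a < b ->
  (forall r, a <= r <= b -> is_derive g r (dg r)) ->
  (forall r, a <= r <= b -> 0 < dg r) -> g a < g b.
Proof.
intros Hab Hd Hp.
destruct (MVT_gen g a b dg) as [x [Hx E]];
  rewrite ?Rmin_left, ?Rmax_right in *; try lra.
- intros; apply Hd; lra.
- intros x Hx; apply continuity_pt_filterlim.
  exact (is_derive_continuous _ _ _ (Hd x Hx)).
- assert (0 < dg x * (b - a)) by (apply Rmult_lt_0_compat; [apply Hp|]; lra). lra.
Qed.

(** Derivatives are asked for on the open interval only: an end may be a zero of [u], where [v']
    need not be differentiable, or the origin. *)
Lemma nondecreasing_closed (g dg : R -> R) a b : a < b ->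
  continuous_along (at_right a) g a -> continuous_along (at_left b) g b ->
  (forall r, a < r < b -> is_derive g r (dg r)) ->
  (forall r, a < r < b -> 0 <= dg r) -> g a <= g b.
Proof.
intros Hab Ha Hb Hd Hp.
apply (left_limit_ge g a b); trivial; intros r Hr.
apply (right_limit_le g a r); trivial; [lra|]; intros s Hs.
apply (derive_nonneg_le g dg); [lra| |]; intros; [apply Hd|apply Hp]; lra.
Qed.

Lemma increasing_closed (g dg : R -> R) a b : a < b ->
  continuous_along (at_right a) g a -> continuous_along (at_left b) g b ->
  (forall r, a < r < b -> is_derive g r (dg r)) ->
  (forall r, a < r < b -> 0 < dg r) -> g a < g b.
Proof.
intros Hab Ha Hb Hd Hp.
set (s := a + (b - a) / 3). set (t := a + 2 * (b - a) / 3).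
assert (g a <= g s).
{ apply (right_limit_le g a s); trivial; [unfold s; lra|]; intros r Hr.
  apply (derive_nonneg_le g dg); [lra| |]; unfold s in *; intros; [apply Hd; lra|].
  left; apply Hp; lra. }
assert (g t <= g b).
{ apply (left_limit_ge g t b); trivial; [unfold t; lra|]; intros r Hr.
  apply (derive_nonneg_le g dg); [lra| |]; unfold t in *; intros; [apply Hd; lra|].
  left; apply Hp; lra. }
assert (g s < g t).
{ apply (derive_pos_lt g dg); unfold s, t in *; [lra| |]; intros; [apply Hd|apply Hp]; lra. }
lra.
Qed.

(* Continuous induction: the supremum of the good initial segments is neither
   interior nor bad. *)
Lemma continuous_induction (P : R -> Prop) a b :
  at_right a P ->
  (forall r, a < r < b -> (forall s, a < s < r -> P s) -> P r) ->
  (forall r, a < r < b -> P r -> locally r P) ->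
  forall r, a < r < b -> P r.
Proof.
intros H0 Hstep Hopen x Hx.
destruct (at_right_ex _ _ H0) as [d [Hd Hnear]].
set (S := fun y => a < y <= x /\ forall s, a < s < y -> P s).
assert (HS0 : S (Rmin x (a + d))).
{ split.
  - split; [apply Rmin_glb_lt; lra|apply Rmin_l].
  - intros s Hs; apply Hnear.
    assert (Rmin x (a + d) <= a + d) by apply Rmin_r. lra. }
destruct (completeness S) as [m [Hub Hlub]].
- exists x; intros y [Hy _]; lra.
- eexists; exact HS0.
- assert (Hm : a < m) by (apply Rlt_le_trans with (Rmin x (a + d)); [apply HS0|now apply Hub]).
  assert (Hmx : m <= x) by (apply Hlub; intros y [Hy _]; lra).
  assert (Hall : forall s, a < s < m -> P s).
  { intros s Hs. apply NNPP; intros Hn.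
    assert (m <= s); [|lra].
    apply Hlub; intros y [Hy Hys]. apply Rnot_lt_le; intros Hsy.
    apply Hn, Hys; lra. }
  assert (Pm : P m) by (apply Hstep; [lra|exact Hall]).
  destruct (Rle_lt_or_eq_dec _ _ Hmx) as [Hlt|E]; [|now rewrite <- E].
  destruct (locally_ex _ _ (Hopen m ltac:(lra) Pm)) as [e [He Hloc]].
  assert (HS : S (Rmin x (m + e / 2))).
  { split.
    - split; [apply Rmin_glb_lt; lra|apply Rmin_l].
    - intros s Hs.
      assert (Rmin x (m + e / 2) <= m + e / 2) by apply Rmin_r.
      destruct (Rlt_or_le s m); [apply Hall; lra|apply Hloc; lra]. }
  assert (Hle := Hub _ HS).
  assert (m < Rmin x (m + e / 2)) by (apply Rmin_glb_lt; lra). lra.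
Qed.

Lemma derive_pos_left_neg (g : R -> R) (r l : R) : is_derive g r l -> 0 < l -> g r = 0 ->
  at_left r (fun s => g s < 0).
Proof.
intros Hg Hl E. destruct Hg as [_ Hg].
assert (He : 0 < l / 2) by lra.
specialize (Hg r (fun P H => H) (mkposreal _ He)).
destruct (locally_ex _ _ Hg) as [d [Hd H]].
apply (ex_at_left r _ d Hd); intros s Hs. specialize (H s ltac:(lra)).
unfold norm, minus, plus, opp, scal in H; simpl in H.
unfold abs, mult in H; simpl in H. rewrite E in H.
apply Rabs_le_between in H. rewrite (Rabs_left (s + - r)) in H by lra.
destruct H as [_ H]. nra.
Qed.

Lemma derive_pos_right_pos (g : R -> R) (r l : R) : is_derive g r l -> 0 < l -> g r = 0 ->
  at_right r (fun s => 0 < g s).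
Proof.
intros Hg Hl E. destruct Hg as [_ Hg].
assert (He : 0 < l / 2) by lra.
specialize (Hg r (fun P H => H) (mkposreal _ He)).
destruct (locally_ex _ _ Hg) as [d [Hd H]].
apply (ex_at_right r _ d Hd); intros s Hs. specialize (H s ltac:(lra)).
unfold norm, minus, plus, opp, scal in H; simpl in H.
unfold abs, mult in H; simpl in H. rewrite E in H.
apply Rabs_le_between in H. rewrite (Rabs_right (s + - r)) in H by lra.
destruct H as [H _]. nra.
Qed.

Lemma left_neg_derive_nonneg (g : R -> R) (a r l : R) : a < r ->
  (forall s, a < s < r -> g s < 0) -> g r = 0 -> is_derive g r l -> 0 <= l.
Proof.
intros Har Hneg E Hd. apply Rnot_lt_le; intros Hl.
assert (Hd' : is_derive (fun s => - g s) r (- l)) by now apply (is_derive_opp g).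
destruct (at_left_ex _ _ (derive_pos_left_neg _ _ _ Hd' ltac:(lra) ltac:(lra))) as [d [Hd0 Hn]].
set (s := r - Rmin (d / 2) ((r - a) / 2)).
assert (Rmin (d / 2) ((r - a) / 2) <= d / 2) by apply Rmin_l.
assert (Rmin (d / 2) ((r - a) / 2) <= (r - a) / 2) by apply Rmin_r.
assert (0 < Rmin (d / 2) ((r - a) / 2)) by (apply Rmin_pos; lra).
assert (- g s < 0) by (apply Hn; unfold s; lra).
assert (g s < 0) by (apply Hneg; unfold s; lra). lra.
Qed.

Lemma continuous_pos (g : R -> R) (r : R) : continuous g r -> 0 < g r -> locally r (fun s => 0 < g s).
Proof. intros; now apply (continuous_along_pos (locally r) _ g r). Qed.

(** At a first zero of [g] the derivative cannot be positive. Its sign is asked for only there, so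
    that both [g r = 0] and the positivity before [r] are available when proving it. *)
Lemma positive_barrier (g dg : R -> R) a b :
  at_right a (fun r => 0 < g r) ->
  (forall r, a < r < b -> continuous g r) ->
  (forall r, a < r < b -> (forall s, a < s < r -> 0 < g s) -> g r = 0 ->
     is_derive g r (dg r) /\ 0 < dg r) ->
  forall r, a < r < b -> 0 < g r.
Proof.
intros H0 Hc Hz.
apply continuous_induction; trivial.
- intros r Hr Hs.
  assert (Hge : 0 <= g r).
  { apply (left_limit_ge g a r); [lra| |].
    - apply continuous_left, Hc; lra.
    - intros; left; now apply Hs. }
  destruct (Rle_lt_or_eq_dec _ _ Hge) as [|E]; trivial. exfalso.
  destruct (Hz r Hr Hs (eq_sym E)) as [Hd Hp].
  destruct (at_left_ex _ _ (derive_pos_left_neg _ _ _ Hd Hp (eq_sym E))) as [d [Hd0 Hn]].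
  set (s := r - Rmin (d / 2) ((r - a) / 2)).
  assert (Rmin (d / 2) ((r - a) / 2) <= d / 2) by apply Rmin_l.
  assert (Rmin (d / 2) ((r - a) / 2) <= (r - a) / 2) by apply Rmin_r.
  assert (0 < Rmin (d / 2) ((r - a) / 2)) by (apply Rmin_pos; lra).
  assert (g s < 0) by (apply Hn; unfold s; lra).
  assert (0 < g s) by (apply Hs; unfold s; lra). lra.
- intros r Hr Hp. now apply continuous_pos; [apply Hc|].
Qed.

(* Two quantities keep each other positive: [y] grows as long as both are
   positive, and [x] cannot vanish first. *)
Lemma cooperative_pos (x y dx dy : R -> R) a b :
  at_right a (fun r => 0 < x r /\ 0 < y r) ->
  (forall r, a < r < b -> is_derive x r (dx r)) ->
  (forall r, a < r < b -> is_derive y r (dy r)) ->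
  (forall r, a < r < b -> 0 < x r -> 0 < y r -> 0 <= dy r) ->
  (forall r, a < r < b -> x r = 0 -> 0 < y r -> 0 < dx r) ->
  forall r, a < r < b -> 0 < x r /\ 0 < y r.
Proof.
intros H0 Hx Hy Hdy Hdx.
apply continuous_induction; trivial.
- intros r Hr Hs.
  assert (Yr : 0 < y r).
  { set (m := (a + r) / 2).
    apply Rlt_le_trans with (y m); [apply Hs; unfold m; lra|].
    apply (left_limit_ge y m r); [unfold m; lra| |].
    - apply continuous_left; exact (is_derive_continuous _ _ _ (Hy r Hr)).
    - intros t Ht; apply (derive_nonneg_le y dy); [lra| |]; intros s Hst;
        unfold m in *; [apply Hy; lra|].
      destruct (Hs s ltac:(lra)); apply Hdy; trivial; lra. }
  split; trivial.
  assert (Hge : 0 <= x r).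
  { apply (left_limit_ge x a r); [lra| |].
    - apply continuous_left; exact (is_derive_continuous _ _ _ (Hx r Hr)).
    - intros s Hs'; left; now apply Hs. }
  destruct (Rle_lt_or_eq_dec _ _ Hge) as [|E]; trivial. exfalso.
  assert (Hp := Hdx r Hr (eq_sym E) Yr).
  destruct (at_left_ex _ _ (derive_pos_left_neg _ _ _ (Hx r Hr) Hp (eq_sym E))) as [d [Hd0 Hn]].
  set (s := r - Rmin (d / 2) ((r - a) / 2)).
  assert (Rmin (d / 2) ((r - a) / 2) <= d / 2) by apply Rmin_l.
  assert (Rmin (d / 2) ((r - a) / 2) <= (r - a) / 2) by apply Rmin_r.
  assert (0 < Rmin (d / 2) ((r - a) / 2)) by (apply Rmin_pos; lra).
  assert (x s < 0) by (apply Hn; unfold s; lra).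
  assert (0 < x s) by (apply Hs; unfold s; lra). lra.
- intros r Hr [Px Py].
  apply filter_and; apply continuous_pos; trivial.
  + exact (is_derive_continuous _ _ _ (Hx r Hr)).
  + exact (is_derive_continuous _ _ _ (Hy r Hr)).
Qed.

Lemma first_zero (g : R -> R) a b : a < b ->
  at_right a (fun r => 0 < g r) ->
  (forall r, a < r <= b -> continuous g r) -> g b <= 0 ->
  exists t, a < t <= b /\ g t = 0 /\ forall r, a < r < t -> 0 < g r.
Proof.
intros Hab H0 Hc Hb.
destruct (classic (exists t, a < t <= b /\ g t <= 0 /\ forall r, a < r < t -> 0 < g r))
  as [[t [Ht [Hle Hpos]]]|Hn].
- exists t; repeat split; try lra; trivial.
  apply Rle_antisym; trivial.
  apply (left_limit_ge g a t); [lra| |].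
  + apply continuous_left, Hc; lra.
  + intros; left; now apply Hpos.
- exfalso. apply Hn; exists b; repeat split; try lra.
  apply continuous_induction; trivial.
  + intros r Hr Hs. apply Rnot_le_lt; intros Hle.
    apply Hn; exists r; repeat split; trivial; lra.
  + intros r Hr Hp; apply continuous_pos; trivial; apply Hc; lra.
Qed.

Lemma IVT_decreasing (g : R -> R) a b y : a < b ->
  continuous_along (at_right a) g a -> continuous_along (at_left b) g b ->
  (forall r, a < r < b -> continuous g r) -> g b < y < g a ->
  exists x, a < x < b /\ g x = y.
Proof.
intros Hab Ha Hb Hc Hy.
assert (Hl : at_left b (fun r => 0 < y - g r)).
{ apply (continuous_along_pos _ _ (fun r => y - g r) b); [|lra].
  apply continuous_along_minus; trivial; try apply _.
  apply continuous_along_const; apply _. }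
destruct (at_left_ex _ _ Hl) as [d [Hd Hr]].
assert (H1 := Rmin_l (d / 2) ((b - a) / 2)).
assert (H2 := Rmin_r (d / 2) ((b - a) / 2)).
assert (H3 : 0 < Rmin (d / 2) ((b - a) / 2)) by (apply Rmin_pos; lra).
(* [first_zero] asks for two-sided continuity at its right end, so [b] is replaced by a nearby
   interior point where [g < y] still holds. *)
set (b' := b - Rmin (d / 2) ((b - a) / 2)) in *.
assert (Hb' : 0 < y - g b') by (apply Hr; unfold b'; lra).
destruct (first_zero (fun r => g r - y) a b') as [t [Ht [E _]]].
- unfold b'; lra.
- apply (continuous_along_pos _ _ (fun r => g r - y) a); [|lra].
  apply continuous_along_minus; trivial; try apply _.
  apply continuous_along_const; apply _.
- intros r Hr'; apply (continuous_along_minus (locally r)); try apply _.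
  + apply Hc; unfold b' in *; lra.
  + apply continuous_along_const; apply _.
- lra.
- exists t; split; [unfold b' in *; lra|lra].
Qed.

(** * The nonlinearity *)

Lemma powabs_pos x p : x <> 0 -> 0 < powabs x p.
Proof. intros H; unfold powabs; destruct (Req_EM_T x 0); [easy|apply exp_pos]. Qed.

Lemma powabs_opp x p : powabs (- x) p = powabs x p.
Proof.
unfold powabs; destruct (Req_EM_T (- x) 0), (Req_EM_T x 0); try lra.
now rewrite Rabs_Ropp.
Qed.

Lemma powabs_Rpower x p : 0 < x -> powabs x p = Rpower x p.
Proof.
intros H; unfold powabs; destruct (Req_EM_T x 0); [lra|].
now rewrite Rabs_right by lra.
Qed.

Lemma powabs_q q x : x <> 0 -> powabs x q = powabs x (q - 2) * x ^ 2.
Proof.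
intros H; unfold powabs; destruct (Req_EM_T x 0); [easy|].
assert (Ha : 0 < Rabs x) by now apply Rabs_pos_lt.
rewrite <- (pow2_abs x), <- (Rpower_pow 2 _ Ha), <- Rpower_plus.
f_equal; simpl; ring.
Qed.

Lemma powabs_2q q x : x <> 0 -> powabs x (2 - q) = / powabs x (q - 2).
Proof.
intros H; unfold powabs; destruct (Req_EM_T x 0); [easy|].
rewrite <- Rpower_Ropp; f_equal; ring.
Qed.

Lemma powabs_1 p : powabs 1 p = 1.
Proof. rewrite powabs_Rpower by lra. unfold Rpower; now rewrite ln_1, Rmult_0_r, exp_0. Qed.

Lemma is_derive_powabs_pos p x : 0 < x ->
  is_derive (fun y : R => powabs y p) x (p * powabs x p / x).
Proof.
intros Hx.
apply (is_derive_ext_loc (fun y => exp (p * ln y))).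
- exists (mkposreal x Hx); intros y Hy.
  change (Rabs (y - x) < x) in Hy; apply Rabs_def2 in Hy.
  now rewrite powabs_Rpower by lra.
- rewrite powabs_Rpower by trivial; unfold Rpower.
  auto_derive; trivial. field; lra.
Qed.

Lemma is_derive_powabs p x : x <> 0 ->
  is_derive (fun y : R => powabs y p) x (p * powabs x p / x).
Proof.
intros Hx; destruct (Rlt_or_le 0 x) as [H|H]; [now apply is_derive_powabs_pos|].
assert (Hn : 0 < - x) by lra.
apply (is_derive_ext (fun y => powabs (- y) p)); [intros; apply powabs_opp|].
assert (D := is_derive_powabs_pos p _ Hn).
replace (p * powabs x p / x) with (scal (-1) (p * powabs (- x) p / - x)).
- apply (is_derive_comp (fun y => powabs y p) Ropp); [exact D|].
  auto_derive; trivial; ring.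
- rewrite powabs_opp. unfold scal; simpl; unfold mult; simpl. field; lra.
Qed.

Lemma powabs_decr q x y : q < 2 -> 0 < x < y -> powabs y (q - 2) < powabs x (q - 2).
Proof.
intros Hq H; rewrite !powabs_Rpower by lra; unfold Rpower.
apply exp_increasing. assert (ln x < ln y) by (apply ln_increasing; lra). nra.
Qed.

Lemma powabs_level q y : q < 2 -> 0 < y -> exists l, 0 < l /\ powabs l (q - 2) = y.
Proof.
intros Hq Hy. assert (Hl : 0 < Rpower y (/ (q - 2))) by apply exp_pos.
exists (Rpower y (/ (q - 2))); split; trivial.
rewrite powabs_Rpower by trivial. rewrite Rpower_mult.
replace (/ (q - 2) * (q - 2)) with 1 by (field; lra).
now apply Rpower_1.
Qed.

Lemma powabs_small q e : 1 < q -> 0 < e ->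
  exists d, 0 < d /\ forall x, Rabs x < d -> powabs x (q - 1) < e.
Proof.
intros Hq He. exists (Rpower e (/ (q - 1))); split; [apply exp_pos|].
intros x Hx; unfold powabs; destruct (Req_EM_T x 0); trivial.
assert (Ha : 0 < Rabs x) by now apply Rabs_pos_lt.
replace e with (Rpower (Rpower e (/ (q - 1))) (q - 1)).
- unfold Rpower at 1 2. apply exp_increasing.
  apply Rmult_lt_compat_l; [lra|]. now apply ln_increasing.
- rewrite Rpower_mult. replace (/ (q - 1) * (q - 1)) with 1 by (field; lra).
  now apply Rpower_1.
Qed.

Lemma powabs_mult q x : Rabs (powabs x (q - 2) * x) = powabs x (q - 1).
Proof.
unfold powabs; destruct (Req_EM_T x 0) as [E|E]; [rewrite Rmult_0_l; apply Rabs_R0|].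
assert (Ha : 0 < Rabs x) by now apply Rabs_pos_lt.
rewrite Rabs_mult, (Rabs_right (Rpower _ _)) by (left; apply exp_pos).
rewrite <- (Rpower_1 (Rabs x)) at 2 by trivial.
rewrite <- Rpower_plus; f_equal; ring.
Qed.

Lemma f_0 q : f q 0 = 0.
Proof. unfold f; ring. Qed.

Lemma F_0 q : F q 0 = 0.
Proof. unfold F, powabs; destruct (Req_EM_T 0 0); [ring|easy]. Qed.

Lemma f_opp q x : f q (- x) = - f q x.
Proof. unfold f; rewrite powabs_opp; ring. Qed.

Lemma F_opp q x : F q (- x) = F q x.
Proof. unfold F; rewrite powabs_opp; ring. Qed.

Lemma g2_opp q x : g2 q (- x) = g2 q x.
Proof. unfold g2; now rewrite powabs_opp. Qed.

Lemma F_eq q x : q <> 0 -> x <> 0 ->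
  F q x = x ^ 2 / 2 - powabs x (q - 2) * x ^ 2 / q.
Proof. intros; unfold F; rewrite powabs_q by trivial; field; trivial. Qed.

Lemma g2_eq q x : x <> 0 -> g2 q x = (q / powabs x (q - 2) - 2) / (2 - q).
Proof. intros; unfold g2; rewrite powabs_2q by trivial; reflexivity. Qed.

Lemma is_derive_f q x : x <> 0 -> is_derive (f q) x (1 - (q - 1) * powabs x (q - 2)).
Proof.
intros Hx; unfold f.
assert (D := is_derive_powabs (q - 2) x Hx).
auto_derive.
- eexists; exact D.
- rewrite (is_derive_unique _ _ _ D). field; trivial.
Qed.

Lemma continuous_f q x : 1 < q -> continuous (f q) x.
Proof.
intros Hq. destruct (Req_dec x 0) as [->|Hx].
2: now apply (is_derive_continuous _ _ _ (is_derive_f q x Hx)).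
unfold f. apply (continuous_along_minus (locally 0)); [apply _|apply continuous_id|].
intros P [e He]. destruct (powabs_small q e Hq (cond_pos e)) as [d [Hd Hs]].
exists (mkposreal d Hd); intros y Hy. apply He.
change (Rabs (y - 0) < d) in Hy. rewrite Rminus_0_r in Hy.
change (Rabs (powabs y (q - 2) * y - powabs 0 (q - 2) * 0) < e).
rewrite Rmult_0_r, Rminus_0_r, powabs_mult. now apply Hs.
Qed.

Lemma is_derive_F q x : 1 < q -> is_derive (F q) x (f q x).
Proof.
intros Hq. destruct (Req_dec x 0) as [->|Hx].
- rewrite f_0. split.
  { exact (is_linear_scal_l (K := R_AbsRing) (V := R_NormedModule) 0). }
  intros y Hy.
  assert (Ey : y = 0) by (symmetry; now apply is_filter_lim_locally_unique).
  subst y. intros e.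
  (* [F x] is [x] times the difference of [x / 2] and [|x|^(q-2) x / q]; each of these two terms
     gets half of [Rmin e 1]. *)
  destruct (powabs_small q (Rmin e 1 / 2) Hq) as [d [Hd Hs]].
  { assert (0 < Rmin e 1) by (apply Rmin_pos; [apply cond_pos|lra]); lra. }
  assert (Hm1 := Rmin_l e 1).
  assert (Hm0 : 0 < Rmin e 1) by (apply Rmin_pos; [apply cond_pos|lra]).
  assert (Hd' : 0 < Rmin d (Rmin e 1)) by (now apply Rmin_pos).
  exists (mkposreal _ Hd'); intros x Hx.
  change (Rabs (x - 0) < Rmin d (Rmin e 1)) in Hx.
  unfold norm, minus, plus, opp, scal; simpl. unfold abs, mult; simpl.
  rewrite F_0.
  replace (F q x + - 0 + - ((x + - 0) * 0)) with (F q x) by ring.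
  rewrite Ropp_0, Rplus_0_r. rewrite Rminus_0_r in Hx.
  assert (Hx1 : Rabs x < d) by (eapply Rlt_le_trans; [exact Hx|apply Rmin_l]).
  assert (Hx2 : Rabs x < Rmin e 1) by (eapply Rlt_le_trans; [exact Hx|apply Rmin_r]).
  destruct (Req_dec x 0) as [->|H0].
  { rewrite F_0, Rabs_R0; lra. }
  rewrite F_eq by lra.
  specialize (Hs x Hx1). rewrite <- powabs_mult in Hs.
  replace (x ^ 2 / 2 - powabs x (q - 2) * x ^ 2 / q)
    with (x * (x / 2 - powabs x (q - 2) * x / q)) by (field; lra).
  rewrite Rabs_mult, Rmult_comm. apply Rmult_le_compat_r; [apply Rabs_pos|].
  eapply Rle_trans; [apply Rabs_triang|].
  rewrite Rabs_Ropp. unfold Rdiv. rewrite !(Rabs_mult _ (/ _)).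
  rewrite (Rabs_right (/ 2)), (Rabs_right (/ q)) by
    (apply Rle_ge; left; apply Rinv_0_lt_compat; lra).
  assert (0 < / q < 1).
  { split; [apply Rinv_0_lt_compat; lra|]. rewrite <- Rinv_1. apply Rinv_lt_contravar; lra. }
  assert (Hp := Rabs_pos (powabs x (q - 2) * x)). nra.
- unfold F. assert (D := is_derive_powabs q x Hx).
  auto_derive.
  + eexists; exact D.
  + rewrite (is_derive_unique _ _ _ D). unfold f.
    rewrite (powabs_q q x Hx). field; split; trivial; lra.
Qed.

Lemma continuous_F q x : 1 < q -> continuous (F q) x.
Proof. intros; eapply is_derive_continuous; now apply is_derive_F. Qed.

Lemma Derive_f q x : x <> 0 -> Derive (f q) x = 1 - (q - 1) * powabs x (q - 2).
Proof. intros; now apply is_derive_unique, is_derive_f. Qed.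

Lemma F_nonneg_iff q x : 1 < q -> x <> 0 ->
  (0 <= F q x <-> powabs x (q - 2) <= q / 2).
Proof.
intros Hq Hx. rewrite F_eq by lra.
assert (0 < x ^ 2) by now apply pow2_gt_0.
replace (x ^ 2 / 2 - powabs x (q - 2) * x ^ 2 / q)
  with (x ^ 2 / q * (q / 2 - powabs x (q - 2))) by (field; lra).
assert (0 < x ^ 2 / q) by (apply Rdiv_lt_0_compat; lra).
split; intros H1; nra.
Qed.

Lemma F_pos_iff q x : 1 < q -> x <> 0 ->
  (0 < F q x <-> powabs x (q - 2) < q / 2).
Proof.
intros Hq Hx. rewrite F_eq by lra.
assert (0 < x ^ 2) by now apply pow2_gt_0.
replace (x ^ 2 / 2 - powabs x (q - 2) * x ^ 2 / q)
  with (x ^ 2 / q * (q / 2 - powabs x (q - 2))) by (field; lra).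
assert (0 < x ^ 2 / q) by (apply Rdiv_lt_0_compat; lra).
split; intros H1; nra.
Qed.

(* Strict convexity of [f] on the positive axis, between [1] and [u]. *)
Lemma f_convex q u : 1 < q < 2 -> 1 < u ->
  0 < (u - 1) * (1 - (q - 1) * powabs u (q - 2)) - f q u.
Proof.
intros Hq Hu. unfold f. rewrite powabs_Rpower by lra.
assert (Hl : 0 < ln u) by (rewrite <- ln_1; apply ln_increasing; lra).
(* After expansion the claim is [1 < (q-1) u^(q-2) + (2-q) u^(q-1)]. The two tangent-line bounds,
   weighted by [q - 1] and [2 - q], add up to it because the logarithms cancel. *)
assert (H1 : 1 + (q - 2) * ln u < Rpower u (q - 2)) by (apply exp_ineq1; nra).
assert (H2 : 1 + (q - 1) * ln u < Rpower u (q - 1)) by (apply exp_ineq1; nra).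
assert (H3 : Rpower u (q - 1) = Rpower u (q - 2) * u).
{ rewrite <- (Rpower_1 u) at 3 by lra. rewrite <- Rpower_plus; f_equal; ring. }
rewrite H3 in H2. set (k := Rpower u (q - 2)) in *. nra.
Qed.

(** Bernoulli's inequality [(1 + x)^p >= 1 + p x] with [1 + x = exp s]. *)
Lemma exp_bernoulli p s : 1 <= p -> 0 <= s -> 1 + p * (exp s - 1) <= exp (p * s).
Proof.
intros Hp Hs.
set (g := fun t => exp (p * t) - (1 + p * (exp t - 1))).
cut (g 0 <= g s).
{ unfold g; rewrite Rmult_0_r, exp_0; lra. }
apply (derive_nonneg_le g (fun t => p * exp (p * t) - p * exp t)); trivial.
- intros r Hr; unfold g; auto_derive; trivial; ring.
- intros r Hr. assert (exp r <= exp (p * r)); [|nra].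
  destruct (Rle_lt_or_eq_dec r (p * r) ltac:(nra)) as [H|H].
  + left; now apply exp_increasing.
  + rewrite <- H; lra.
Qed.

(** Bernoulli with exponent [q / (2 - q)] for [(a / u)^(2-q)], which is the ratio of the powers
    [|.|^(q-2)] at [u] and [a]; raised to that exponent it becomes [(a / u)^q]. *)
Lemma power_bernoulli q u a : 1 < q < 2 -> 0 < u <= a ->
  powabs u (q - 2) * u ^ 2
    * (1 + q / (2 - q) * (powabs u (q - 2) / powabs a (q - 2) - 1))
  <= powabs a (q - 2) * a ^ 2.
Proof.
intros Hq Ha. rewrite <- !powabs_q by lra. rewrite !powabs_Rpower by lra.
assert (Hl : ln u <= ln a).
{ destruct (proj2 Ha) as [H|H]; [left; apply ln_increasing; lra|rewrite H; lra]. }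
set (s := (2 - q) * (ln a - ln u)).
assert (Hs : 0 <= s) by (unfold s; nra).
assert (Hp : 1 <= q / (2 - q)) by (apply Rle_div_r; lra).
assert (B := exp_bernoulli _ _ Hp Hs).
assert (E1 : exp (q / (2 - q) * s) * Rpower u q = Rpower a q).
{ unfold Rpower; rewrite <- exp_plus; f_equal; unfold s; field; lra. }
assert (E2 : Rpower u (q - 2) / Rpower a (q - 2) = exp s).
{ unfold Rpower, Rdiv; rewrite <- exp_Ropp, <- exp_plus; f_equal; unfold s; ring. }
rewrite E2, <- E1. assert (0 < Rpower u q) by apply exp_pos. nra.
Qed.

(** * A solution and its variation, with their first derivatives *)

(** The derivatives are components of their own, not [Derive], so that they can take their right
    limits at the origin and so that a change of sign acts componentwise. *)
Record jet : Type := Jet { ju : R -> R; ju1 : R -> R; jv : R -> R; jv1 : R -> R }.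

Definition jopp (p : jet) : jet :=
  Jet (fun r => - ju p r) (fun r => - ju1 p r) (fun r => - jv p r) (fun r => - jv1 p r).

Record solves_u (n : nat) (q : R) (p : jet) (r : R) : Prop := {
  su_pos : 0 < r;
  su_u : is_derive (ju p) r (ju1 p r);
  su_u1 : is_derive (ju1 p) r (- (INR n - 1) / r * ju1 p r - f q (ju p r))
}.

(** The equation for [v] is required off the zeros of [u] only, since its coefficient [f' (u)] is
    infinite at them; continuity of [v'] is what links the two sides. *)
Record solves (n : nat) (q : R) (p : jet) (r : R) : Prop := {
  s_u : solves_u n q p r;
  s_v : is_derive (jv p) r (jv1 p r);
  s_v1c : continuous (jv1 p) r;
  s_v1 : ju p r <> 0 ->
    is_derive (jv1 p) r (- (INR n - 1) / r * jv1 p r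
                         - (1 - (q - 1) * powabs (ju p r) (q - 2)) * jv p r)
}.

Definition wt (n : nat) (r : R) : R := r ^ (n - 1).
(** Levels of [|u|] are compared through this decreasing function of [|u|]: it is [q / 2] at the
    positive zero of [F], [1] at the positive zero of [f], and [1 / (q - 1)] at the positive zero of
    [f']. *)
Definition kk (q : R) (p : jet) (r : R) : R := powabs (ju p r) (q - 2).
Definition jE (q : R) (p : jet) (r : R) : R := ju1 p r ^ 2 / 2 + F q (ju p r).
Definition jQ (n : nat) (q : R) (p : jet) (r : R) : R :=
  r * wt n r * (ju1 p r * jv1 p r + f q (ju p r) * jv p r)
  + (INR n - 2) * wt n r * ju1 p r * jv p r.
Definition jM (n : nat) (p : jet) (r : R) : R :=
  wt n r * (ju1 p r * jv p r - ju p r * jv1 p r).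
Definition jT (n : nat) (q : R) (p : jet) (r : R) : R :=
  jQ n q p r - g2 q (ju p r) * jM n p r.
(* The Pohozaev functional. *)
Definition jP (n : nat) (q : R) (p : jet) (r : R) : R :=
  r * wt n r * (ju1 p r ^ 2 + 2 * F q (ju p r))
  + (INR n - 2) * wt n r * ju p r * ju1 p r.
(* [wt n r * jJ n q p r] is the Wronskian of [v] and [u']. *)
Definition jJ (n : nat) (q : R) (p : jet) (r : R) : R :=
  ju1 p r * jv1 p r + f q (ju p r) * jv p r + (INR n - 1) / r * (ju1 p r * jv p r).
(* [jL] is [wt n] times [u'^2 - u u''], whose positivity means that [|u|] is
   log-concave. *)
Definition jL (n : nat) (q : R) (p : jet) (r : R) : R :=
  wt n r * (ju1 p r ^ 2 + ju p r * f q (ju p r))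
  + (INR n - 1) * r ^ (n - 2) * (ju p r * ju1 p r).
Definition jth (p : jet) (r : R) : R := jv p r / ju1 p r.
(** For [u' <> 0] this is [Q - 2 F (u) r^(n-1) theta]. Since [Q' = 2 r^(n-1) f (u) v = 2 (F (u))'
    r^(n-1) theta], the correction leaves only [- 2 F (u) (r^(n-1) theta)'] in the derivative, which
    has a good sign where [F (u) < 0]. *)
Definition jX (n : nat) (q : R) (p : jet) (r : R) : R :=
  r * wt n r * jJ n q p r - 2 * jE q p r * (wt n r * jth p r).
Definition jN (n : nat) (p : jet) (r : R) : R :=
  wt n r * (ju1 p r * jv p r - (ju p r - 1) * jv1 p r).
(* The functional [Q] of the pair [(u, u)]. *)
Definition jA (n : nat) (q : R) (p : jet) (r : R) : R :=
  r * wt n r * (ju1 p r ^ 2 + ju p r * f q (ju p r))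
  + (INR n - 2) * wt n r * ju p r * ju1 p r.

(** The weight is generalised so that only its recorded derivative is used; the remaining [Derive]
    terms are matched with the hypotheses up to conversion. *)
Ltac derive_by_rules :=
  repeat match goal with H : is_derive (wt ?n) _ _ |- _ =>
    revert H; generalize (wt n); intros ? H end;
  auto_derive;
  [ repeat split; try (eexists; eassumption); trivial
  | repeat match goal with
    | H : is_derive ?g ?r _ |- context [Derive ?h ?r] =>
        replace (Derive h r) with (Derive g r) by reflexivity;
        rewrite (is_derive_unique g r _ H)
    end ].

(** * Derivatives of the functionals, and identities between them *)

Lemma wt_pos n r : 0 < r -> 0 < wt n r.
Proof. intros; now apply pow_lt. Qed.

Lemma pow_wt n r : (2 <= n)%nat -> r ^ n = r * wt n r.
Proof. intros; unfold wt; destruct n; [lia|]; simpl; now rewrite Nat.sub_0_r. Qed.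

Lemma pow_wt2 n r : (2 <= n)%nat -> wt n r = r * r ^ (n - 2).
Proof.
intros; unfold wt. replace (n - 1)%nat with (S (n - 2)) by lia. reflexivity.
Qed.

Lemma INR_ge2 n : (2 <= n)%nat -> 2 <= INR n.
Proof. intros H; change 2 with (INR 2); now apply le_INR. Qed.

Lemma is_derive_pow_ratio m r : 0 < r -> is_derive (fun x : R => x ^ m) r (INR m / r * r ^ m).
Proof.
intros Hr; auto_derive; trivial. destruct m as [|m].
- simpl; field; lra.
- rewrite S_INR; simpl; field; lra.
Qed.

Lemma is_derive_wt n r : (2 <= n)%nat -> 0 < r ->
  is_derive (wt n) r ((INR n - 1) / r * wt n r).
Proof.
intros Hn Hr. assert (D := is_derive_pow_ratio (n - 1) r Hr).
rewrite minus_INR in D by lia. exact D.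
Qed.

Lemma is_derive_g2 q x : q < 2 -> x <> 0 ->
  is_derive (g2 q) x (q / (powabs x (q - 2) * x)).
Proof.
intros Hq Hx. assert (Hk := powabs_pos x (q - 2) Hx).
assert (Dp := is_derive_powabs (2 - q) _ Hx).
unfold g2. auto_derive; [eexists; exact Dp|].
rewrite (is_derive_unique _ _ _ Dp), powabs_2q by trivial.
field; repeat split; trivial; lra.
Qed.

Lemma is_derive_jE n q p r : 1 < q -> solves_u n q p r ->
  is_derive (jE q p) r (- (INR n - 1) / r * ju1 p r ^ 2).
Proof.
intros Hq [Hr Hu Hu1]. assert (HF := is_derive_F q (ju p r) Hq).
unfold jE. derive_by_rules. field; lra.
Qed.

Lemma energy_nonincreasing n q p s t : (2 <= n)%nat -> 1 < q -> s <= t ->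
  (forall r, s <= r <= t -> solves_u n q p r) -> jE q p t <= jE q p s.
Proof.
intros Hn Hq Hst S. assert (HN := INR_ge2 n Hn).
cut (- jE q p s <= - jE q p t); [lra|].
apply (derive_nonneg_le (fun r => - jE q p r)
  (fun r => - (- (INR n - 1) / r * ju1 p r ^ 2))); trivial.
- intros r Hr; apply (is_derive_opp (jE q p)), is_derive_jE; trivial. now apply S.
- intros r Hr. assert (Hr0 := su_pos _ _ _ _ (S r Hr)).
  replace (- (- (INR n - 1) / r * ju1 p r ^ 2)) with ((INR n - 1) / r * ju1 p r ^ 2)
    by (field; lra).
  apply Rmult_le_pos; [left; pos|apply pow2_ge_0].
Qed.

Lemma is_derive_jP n q p r : 1 < q -> (2 <= n)%nat -> solves_u n q p r ->
  is_derive (jP n q p) r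
    (wt n r * (2 * INR n * F q (ju p r) - (INR n - 2) * (ju p r * f q (ju p r)))).
Proof.
intros Hq Hn [Hr Hu Hu1]. assert (HF := is_derive_F q (ju p r) Hq).
assert (Hw := is_derive_wt n r Hn Hr).
unfold jP. derive_by_rules. field; lra.
Qed.

Lemma is_derive_jQ n q p r : (2 <= n)%nat -> ju p r <> 0 -> solves n q p r ->
  is_derive (jQ n q p) r (2 * wt n r * f q (ju p r) * jv p r).
Proof.
intros Hn H0 [[Hr Hu Hu1] Hv _ Hv1]. specialize (Hv1 H0).
assert (Hf := is_derive_f q (ju p r) H0).
assert (Hw := is_derive_wt n r Hn Hr).
unfold jQ. derive_by_rules. unfold kk; field; lra.
Qed.

Lemma is_derive_jM n q p r : (2 <= n)%nat -> ju p r <> 0 -> solves n q p r ->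
  is_derive (jM n p) r ((2 - q) * wt n r * kk q p r * ju p r * jv p r).
Proof.
intros Hn H0 [[Hr Hu Hu1] Hv _ Hv1]. specialize (Hv1 H0).
assert (Hw := is_derive_wt n r Hn Hr).
unfold jM. derive_by_rules. unfold kk, f; field; lra.
Qed.

Lemma is_derive_jT n q p r : (2 <= n)%nat -> q < 2 -> ju p r <> 0 -> solves n q p r ->
  is_derive (jT n q p) r
    ((2 - q) * wt n r * ju p r * jv p r
     - q * ju1 p r / (kk q p r * ju p r) * jM n p r).
Proof.
intros Hn Hq H0 S. assert (DQ := is_derive_jQ n q p r Hn H0 S).
assert (DM := is_derive_jM n q p r Hn H0 S).
assert (Dg := is_derive_g2 q (ju p r) Hq H0).
assert (Hu := su_u _ _ _ _ (s_u _ _ _ _ S)).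
assert (Hk : 0 < kk q p r) by now apply powabs_pos.
unfold jT. derive_by_rules.
rewrite g2_eq by trivial. fold (kk q p r).
unfold f; fold (kk q p r). field. repeat split; lra.
Qed.

Lemma is_derive_jL n q p r : (2 <= n)%nat -> ju p r <> 0 -> solves_u n q p r ->
  is_derive (jL n q p) r
    (- (wt n r / r ^ 2 * (ju p r * ju1 p r)
        * (INR n - 1 - (2 - q) * r ^ 2 * kk q p r))).
Proof.
intros Hn H0 [Hr Hu Hu1].
assert (Hf := is_derive_f q (ju p r) H0).
assert (Hw2 := is_derive_pow_ratio (n - 2) r Hr).
rewrite minus_INR in Hw2 by lia. change (INR 2) with 2 in Hw2.
apply (is_derive_ext (fun x => x * x ^ (n - 2) * (ju1 p x ^ 2 + ju p x * f q (ju p x))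
  + (INR n - 1) * x ^ (n - 2) * (ju p x * ju1 p x))).
{ intros x; unfold jL; now rewrite (pow_wt2 n x Hn). }
rewrite (pow_wt2 n r Hn).
change (r ^ (n - 2)) with ((fun x : R => x ^ (n - 2)) r) in Hw2 |- *.
revert Hw2. set (w2 := fun x : R => x ^ (n - 2)).
change (is_derive w2 r ((INR n - 2) / r * w2 r) ->
  is_derive (fun x => x * w2 x * (ju1 p x ^ 2 + ju p x * f q (ju p x))
  + (INR n - 1) * w2 x * (ju p x * ju1 p x)) r
  (- (r * w2 r / r ^ 2 * (ju p r * ju1 p r)
        * (INR n - 1 - (2 - q) * r ^ 2 * kk q p r)))).
clearbody w2; intros Hw2.
derive_by_rules. unfold f; fold (kk q p r). field; lra.
Qed.

Lemma is_derive_jN n q p r : (2 <= n)%nat -> ju p r <> 0 -> solves n q p r ->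
  is_derive (jN n p) r
    (wt n r * jv p r * ((ju p r - 1) * (1 - (q - 1) * kk q p r) - f q (ju p r))).
Proof.
intros Hn H0 [[Hr Hu Hu1] Hv _ Hv1]. specialize (Hv1 H0).
assert (Hw := is_derive_wt n r Hn Hr).
unfold jN. derive_by_rules. unfold kk, f; field; lra.
Qed.

Lemma is_derive_jth n q p r : ju1 p r <> 0 -> solves n q p r ->
  is_derive (jth p) r (jJ n q p r / ju1 p r ^ 2).
Proof.
intros H1 [[Hr Hu Hu1] Hv _ _].
unfold jth, jJ. derive_by_rules. field; split; trivial; lra.
Qed.

Lemma is_derive_jJ n q p r : ju p r <> 0 -> solves n q p r ->
  is_derive (jJ n q p) r
    (- (INR n - 1) / r * (jJ n q p r + ju1 p r * jv p r / r)).
Proof.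
intros H0 [[Hr Hu Hu1] Hv _ Hv1]. specialize (Hv1 H0).
assert (Hf := is_derive_f q (ju p r) H0).
unfold jJ. derive_by_rules; [lra|]. unfold kk; field; lra.
Qed.

Lemma is_derive_jX n q p r : 1 < q -> (2 <= n)%nat -> ju p r <> 0 -> ju1 p r <> 0 ->
  solves n q p r ->
  is_derive (jX n q p) r
    (- 2 * F q (ju p r) * wt n r
     * (jJ n q p r / ju1 p r ^ 2 + (INR n - 1) / r * jth p r)).
Proof.
intros Hq Hn H0 H1 S.
assert (Dt := is_derive_jth n q p r H1 S).
assert (DJ := is_derive_jJ n q p r H0 S).
assert (DE := is_derive_jE n q p r Hq (s_u _ _ _ _ S)).
destruct S as [[Hr Hu Hu1] Hv _ _].
assert (Hw := is_derive_wt n r Hn Hr).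
unfold jX.
derive_by_rules.
unfold jE, jth. field; split; trivial; lra.
Qed.

Lemma jQ_jJ n q p r : 0 < r -> jQ n q p r = r * wt n r * jJ n q p r - wt n r * (ju1 p r * jv p r).
Proof. intros; unfold jQ, jJ; field; lra. Qed.

(** Elimination of [v'] between [M] and [Q]. *)
Lemma jA_v n q p r :
  jv p r * jA n q p r = r * ju1 p r * jM n p r + ju p r * jQ n q p r.
Proof. unfold jA, jM, jQ; ring. Qed.

Lemma jA_jP n q p r : 1 < q -> ju p r <> 0 ->
  jA n q p r = jP n q p r + r * wt n r * ((2 - q) / q * kk q p r * ju p r ^ 2).
Proof.
intros Hq H0; unfold jA, jP. rewrite F_eq by lra. unfold f; fold (kk q p r).
field; lra.
Qed.

Lemma jA_jL n q p r : (2 <= n)%nat ->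
  (INR n - 1) * jA n q p r =
  r * wt n r * (ju1 p r ^ 2 + ju p r * f q (ju p r)) + (INR n - 2) * (r * jL n q p r).
Proof. intros Hn; unfold jA, jL. rewrite (pow_wt2 n r Hn); ring. Qed.

(** * Symmetry under the change of sign of [(u, v)] *)

Lemma solves_u_opp n q p r : solves_u n q p r -> solves_u n q (jopp p) r.
Proof.
intros [Hr Hu Hu1]; split; simpl; trivial.
- now apply (is_derive_opp (ju p)).
- rewrite f_opp.
  replace (- (INR n - 1) / r * - ju1 p r - - f q (ju p r))
    with (opp (- (INR n - 1) / r * ju1 p r - f q (ju p r)))
    by (unfold opp; simpl; lra).
  now apply (is_derive_opp (ju1 p)).
Qed.

Lemma solves_opp n q p r : solves n q p r -> solves n q (jopp p) r.
Proof.
intros [Su Hv Hc Hv1]; split; simpl.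
- now apply solves_u_opp.
- now apply (is_derive_opp (jv p)).
- now apply (continuous_opp (V := R_NormedModule) (jv1 p)).
- intros H0. rewrite powabs_opp.
  assert (H0' : ju p r <> 0) by lra. specialize (Hv1 H0').
  replace (- (INR n - 1) / r * - jv1 p r - (1 - (q - 1) * powabs (ju p r) (q - 2)) * - jv p r)
    with (opp (- (INR n - 1) / r * jv1 p r - (1 - (q - 1) * powabs (ju p r) (q - 2)) * jv p r))
    by (unfold opp; simpl; lra).
  now apply (is_derive_opp (jv1 p)).
Qed.

Lemma jQ_opp n q p r : jQ n q (jopp p) r = jQ n q p r.
Proof. unfold jQ; simpl; rewrite f_opp; ring. Qed.

Lemma jM_opp n p r : jM n (jopp p) r = jM n p r.
Proof. unfold jM; simpl; ring. Qed.

Lemma jT_opp n q p r : jT n q (jopp p) r = jT n q p r.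
Proof. unfold jT; rewrite jQ_opp, jM_opp; simpl; now rewrite g2_opp. Qed.

Lemma jE_opp q p r : jE q (jopp p) r = jE q p r.
Proof. unfold jE; simpl; rewrite F_opp; field. Qed.

Lemma jX_opp n q p r : jX n q (jopp p) r = jX n q p r.
Proof.
unfold jX; rewrite jE_opp. unfold jJ, jth; simpl; rewrite f_opp.
replace (- jv p r / - ju1 p r) with (jv p r / ju1 p r).
- ring.
(* For [u' = 0] both quotients vanish, because [/ 0] is [0]. *)
- destruct (Req_dec (ju1 p r) 0) as [E|E]; [|now field].
  rewrite E, Ropp_0; unfold Rdiv; rewrite Rinv_0; ring.
Qed.

(** * Continuity of the functionals *)

Ltac continuous_along_tac :=
  lazymatch goal with
  | HG : Filter ?G |- continuous_along ?G ?g ?c =>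
    lazymatch g with
    | fun _ => ?a => exact (continuous_along_const G HG a c)
    | fun r => @?a r + @?b r =>
        apply (continuous_along_plus G HG a b c); continuous_along_tac
    | fun r => @?a r - @?b r =>
        apply (continuous_along_minus G HG a b c); continuous_along_tac
    | fun r => @?a r * @?b r =>
        apply (continuous_along_mult G HG a b c); continuous_along_tac
    | fun r => - @?a r => apply (continuous_along_opp G HG a c); continuous_along_tac
    | fun r => @?a r ^ ?m => apply (continuous_along_pow G HG a m c); continuous_along_tac
    | _ => assumption
    end
  end.

Lemma continuous_along_f G (HG : Filter G) q g c : 1 < q ->
  continuous_along G g c -> continuous_along G (fun r => f q (g r)) c.
Proof. intros; now apply (continuous_along_comp G HG g (f q)), continuous_f. Qed.

Lemma continuous_along_F G (HG : Filter G) q g c : 1 < q ->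
  continuous_along G g c -> continuous_along G (fun r => F q (g r)) c.
Proof. intros; now apply (continuous_along_comp G HG g (F q)), continuous_F. Qed.

(** The part on [u] stands alone because the last interval may end at a double zero, where [u] and
    [u'] are continuous but [v] is unbounded. *)
Record jet_continuous_u (G : (R -> Prop) -> Prop) (p : jet) (c : R) : Prop := {
  jc_filter : Filter G;
  jc_id : continuous_along G (fun r => r) c;
  jc_u : continuous_along G (ju p) c;
  jc_u1 : continuous_along G (ju1 p) c
}.

Record jet_continuous (G : (R -> Prop) -> Prop) (p : jet) (c : R) : Prop := {
  jc_uu : jet_continuous_u G p c;
  jc_v : continuous_along G (jv p) c;
  jc_v1 : continuous_along G (jv1 p) c
}.

Lemma solves_u_continuous n q p r : solves_u n q p r -> jet_continuous_u (locally r) p r.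
Proof.
intros [Hr Hu Hu1]; split; [apply _|apply continuous_id| |];
  eapply is_derive_continuous; eassumption.
Qed.

Lemma solves_continuous n q p r : solves n q p r -> jet_continuous (locally r) p r.
Proof.
intros [Hu Hv Hc _]; split; trivial.
- exact (solves_u_continuous n q p r Hu).
- eapply is_derive_continuous; eassumption.
Qed.

Lemma jet_continuous_u_right p r : jet_continuous_u (locally r) p r ->
  jet_continuous_u (at_right r) p r.
Proof. intros [? ? ? ?]; split; [apply _| | |]; now apply continuous_right. Qed.

Lemma jet_continuous_u_left p r : jet_continuous_u (locally r) p r ->
  jet_continuous_u (at_left r) p r.
Proof. intros [? ? ? ?]; split; [apply _| | |]; now apply continuous_left. Qed.

Lemma jet_continuous_right p r : jet_continuous (locally r) p r ->
  jet_continuous (at_right r) p r.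
Proof.
intros [? ? ?]; split; [now apply jet_continuous_u_right| |]; now apply continuous_right.
Qed.

Lemma jet_continuous_left p r : jet_continuous (locally r) p r ->
  jet_continuous (at_left r) p r.
Proof.
intros [? ? ?]; split; [now apply jet_continuous_u_left| |]; now apply continuous_left.
Qed.

Lemma jet_continuous_u_opp G p c : jet_continuous_u G p c -> jet_continuous_u G (jopp p) c.
Proof. intros [? ? ? ?]; split; simpl; trivial; now apply continuous_along_opp. Qed.

Lemma jet_continuous_opp G p c : jet_continuous G p c -> jet_continuous G (jopp p) c.
Proof.
intros [H ? ?]; destruct (jc_filter _ _ _ H).
split; simpl; [now apply jet_continuous_u_opp| |];
  (apply continuous_along_opp; [now split|trivial]).
Qed.

Lemma jE_continuous G q p c : 1 < q -> jet_continuous_u G p c -> continuous_along G (jE q p) c.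
Proof.
intros Hq [HG Hi Hu Hu1]. assert (HF := continuous_along_F G HG q _ c Hq Hu).
unfold jE, Rdiv. continuous_along_tac.
Qed.

Lemma wt_continuous G n p c : jet_continuous_u G p c -> continuous_along G (wt n) c.
Proof. intros [HG Hi Hu Hu1]. now apply (continuous_along_pow G HG (fun r => r)). Qed.

Lemma jP_continuous G n q p c : 1 < q -> jet_continuous_u G p c ->
  continuous_along G (jP n q p) c.
Proof.
intros Hq H; assert (Hw := wt_continuous G n p c H); destruct H as [HG Hi Hu Hu1].
assert (HF := continuous_along_F G HG q _ c Hq Hu).
unfold jP. continuous_along_tac.
Qed.

Lemma jL_continuous G n q p c : 1 < q -> jet_continuous_u G p c ->
  continuous_along G (jL n q p) c.
Proof.
intros Hq H; assert (Hw := wt_continuous G n p c H); destruct H as [HG Hi Hu Hu1].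
assert (HF := continuous_along_f G HG q _ c Hq Hu).
unfold jL. continuous_along_tac.
Qed.

Lemma jM_continuous G n p c : jet_continuous G p c -> continuous_along G (jM n p) c.
Proof.
intros [H Hv Hv1]; assert (Hw := wt_continuous G n p c H); destruct H as [HG Hi Hu Hu1].
unfold jM. continuous_along_tac.
Qed.

Lemma jN_continuous G n p c : jet_continuous G p c -> continuous_along G (jN n p) c.
Proof.
intros [H Hv Hv1]; assert (Hw := wt_continuous G n p c H); destruct H as [HG Hi Hu Hu1].
unfold jN. continuous_along_tac.
Qed.

Lemma jQ_continuous G n q p c : 1 < q -> jet_continuous G p c ->
  continuous_along G (jQ n q p) c.
Proof.
intros Hq [H Hv Hv1]; assert (Hw := wt_continuous G n p c H); destruct H as [HG Hi Hu Hu1].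
assert (HF := continuous_along_f G HG q _ c Hq Hu).
unfold jQ. continuous_along_tac.
Qed.

Lemma jT_continuous G n q p c : 1 < q < 2 -> ju p c <> 0 -> jet_continuous G p c ->
  continuous_along G (jT n q p) c.
Proof.
intros Hq H0 H; assert (HQ := jQ_continuous G n q p c (proj1 Hq) H).
assert (HM := jM_continuous G n p c H). destruct H as [[HG Hi Hu Hu1] _ _].
assert (Hg : continuous_along G (fun r => g2 q (ju p r)) c).
{ apply (continuous_along_comp G HG (ju p) (g2 q)); trivial.
  eapply is_derive_continuous, is_derive_g2; trivial; lra. }
unfold jT. continuous_along_tac.
Qed.

Lemma jX_continuous G n q p c : 1 < q -> 0 < c -> ju1 p c <> 0 -> jet_continuous G p c ->
  continuous_along G (jX n q p) c.
Proof.
intros Hq Hc H1 H; assert (HE := jE_continuous G q p c Hq (jc_uu _ _ _ H)).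
destruct H as [H Hv Hv1]; assert (Hw := wt_continuous G n p c H); destruct H as [HG Hi Hu Hu1].
assert (HF := continuous_along_f G HG q _ c Hq Hu).
assert (Ht : continuous_along G (jth p) c) by (now apply continuous_along_div).
assert (Hri : continuous_along G (fun r => / r) c) by (apply continuous_along_inv; trivial; lra).
unfold jX, jJ, Rdiv. continuous_along_tac.
Qed.

(** * From a critical point to the next zero *)

(** The inequalities for [M] and [T_2] at [c] are not strict because the first descent starts at
    [c = 0], where the weight [r^(n-1)] makes both vanish. At [z] only [u] and [u'] are continuous,
    which admits a double zero. *)
Record descent (n : nat) (q : R) (p : jet) (c z : R) : Prop := {
  d_n : (2 <= n)%nat;
  d_q : 1 < q < 2;
  d_c : 0 <= c;
  d_cz : c < z;
  d_sol : forall r, c < r < z -> solves n q p r;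
  d_u : forall r, c < r < z -> 0 < ju p r;
  d_u1 : forall r, c < r < z -> ju1 p r < 0;
  d_E : forall r, c < r < z -> 0 < jE q p r;
  d_right : jet_continuous (at_right c) p c;
  d_left : jet_continuous_u (at_left z) p z;
  d_u1c : ju1 p c = 0;
  d_uz : ju p z = 0;
  d_vc : 0 < jv p c;
  d_Mc : 0 <= jM n p c;
  d_Tc : 0 <= jT n q p c
}.

Section Descent.
Context {n : nat} {q : R} {p : jet} {c z : R} (D : descent n q p c z).

Let Hn : (2 <= n)%nat := d_n _ _ _ _ _ D.
Let Hq : 1 < q < 2 := d_q _ _ _ _ _ D.
Let Hc : 0 <= c := d_c _ _ _ _ _ D.
Let Hcz : c < z := d_cz _ _ _ _ _ D.

Lemma d_continuous_right s : c <= s < z -> jet_continuous (at_right s) p s.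
Proof.
intros Hs; destruct (Req_dec s c) as [->|H]; [exact (d_right _ _ _ _ _ D)|].
apply jet_continuous_right, (solves_continuous n q), (d_sol _ _ _ _ _ D); lra.
Qed.

Lemma d_continuous_left s : c < s < z -> jet_continuous (at_left s) p s.
Proof.
intros Hs; apply jet_continuous_left, (solves_continuous n q), (d_sol _ _ _ _ _ D); lra.
Qed.

Lemma d_continuous_u_left s : c < s <= z -> jet_continuous_u (at_left s) p s.
Proof.
intros Hs; destruct (Req_dec s z) as [->|H]; [exact (d_left _ _ _ _ _ D)|].
apply d_continuous_left; lra.
Qed.

Lemma d_u_decreasing s t : c <= s -> s < t -> t <= z -> ju p t < ju p s.
Proof.
intros Hs Hst Ht.
cut (- ju p s < - ju p t); [lra|].
apply (increasing_closed (fun r => - ju p r) (fun r => - ju1 p r)); trivial.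
- apply continuous_along_opp; [apply _|]; apply d_continuous_right; lra.
- apply continuous_along_opp; [apply _|]; apply d_continuous_u_left; lra.
- intros r Hr; apply (is_derive_opp (ju p)).
  exact (su_u _ _ _ _ (s_u _ _ _ _ (d_sol _ _ _ _ _ D r ltac:(lra)))).
- intros r Hr. assert (H := d_u1 _ _ _ _ _ D r ltac:(lra)); lra.
Qed.

Lemma d_u_pos r : c <= r < z -> 0 < ju p r.
Proof.
intros Hr; rewrite <- (d_uz _ _ _ _ _ D); apply d_u_decreasing; lra.
Qed.

Lemma d_kk_increasing s t : c <= s -> s < t -> t < z -> kk q p s < kk q p t.
Proof.
intros Hs Hst Ht; apply powabs_decr; [lra|].
split; [apply d_u_pos; lra|apply d_u_decreasing; lra].
Qed.

Lemma d_kk_pos r : c <= r < z -> 0 < kk q p r.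
Proof. intros Hr; apply powabs_pos. assert (H := d_u_pos r Hr); lra. Qed.

Lemma d_E_decreasing s t : c <= s -> s < t -> t <= z -> jE q p t < jE q p s.
Proof.
intros Hs Hst Ht.
cut (- jE q p s < - jE q p t); [lra|].
apply (increasing_closed (fun r => - jE q p r)
  (fun r => - (- (INR n - 1) / r * ju1 p r ^ 2))); trivial.
- apply continuous_along_opp; [apply _|]; apply jE_continuous; [lra|].
  apply d_continuous_right; lra.
- apply continuous_along_opp; [apply _|]; apply jE_continuous; [lra|].
  apply d_continuous_u_left; lra.
- intros r Hr; apply (is_derive_opp (jE q p)); apply is_derive_jE; [lra|].
  apply (d_sol _ _ _ _ _ D); lra.
- intros r Hr. assert (H := d_u1 _ _ _ _ _ D r ltac:(lra)).
  assert (HN := INR_ge2 n Hn). assert (0 < ju1 p r ^ 2) by nra.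
  replace (- (- (INR n - 1) / r * ju1 p r ^ 2)) with ((INR n - 1) / r * ju1 p r ^ 2)
    by (field; lra).
  apply Rmult_lt_0_compat; trivial. apply Rdiv_lt_0_compat; lra.
Qed.

Lemma d_Fc : 0 < F q (ju p c).
Proof.
set (m := (c + z) / 2).
assert (H1 : jE q p m < jE q p c) by (apply d_E_decreasing; unfold m; lra).
assert (H2 : 0 < jE q p m) by (apply (d_E _ _ _ _ _ D); unfold m; lra).
unfold jE in H1 at 2. rewrite (d_u1c _ _ _ _ _ D) in H1. lra.
Qed.

Lemma d_kkc : kk q p c < q / 2.
Proof.
apply F_pos_iff; [lra| |exact d_Fc]. assert (H := d_u_pos c ltac:(lra)); lra.
Qed.

Lemma d_uc : 1 < ju p c.
Proof.
apply Rnot_le_lt; intros H. assert (H1 := d_kkc). assert (H0 := d_u_pos c ltac:(lra)).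
assert (1 <= kk q p c); [|lra].
destruct H as [H|H].
- rewrite <- (powabs_1 (q - 2)). left; apply powabs_decr; lra.
- unfold kk; rewrite H, powabs_1; lra.
Qed.

Lemma d_kk_level y b : 0 < y -> c <= b < z -> kk q p b < y ->
  exists s, b < s < z /\ kk q p s = y.
Proof.
intros Hy Hb Hk. destruct (powabs_level q y ltac:(lra) Hy) as [l [Hl El]].
assert (Hu0 := d_u_pos b Hb).
assert (Hlb : l < ju p b).
{ apply Rnot_le_lt; intros [H|H].
  - assert (H' := powabs_decr q _ _ ltac:(lra) (conj Hu0 H)). unfold kk in Hk; lra.
  - unfold kk in Hk; rewrite H in Hk; lra. }
destruct (IVT_decreasing (ju p) b z l) as [s [Hs E]]; try lra.
- apply d_continuous_right; lra.
- apply d_continuous_u_left; lra.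
- intros r Hr; apply (solves_continuous n q), (d_sol _ _ _ _ _ D); lra.
- rewrite (d_uz _ _ _ _ _ D); lra.
- exists s; split; trivial. unfold kk; rewrite E; trivial.
Qed.

(** [P' = r^(n-1) u^2 (2 - m k)] with [k = |u|^(q-2)] increasing, so [P] rises and then falls; it is
    nonnegative at both ends, being [2 c^n F (u (c))] at [c] and [z^n u'(z)^2] at [z]. *)
Lemma d_P_pos r : c < r < z -> 0 < jP n q p r.
Proof.
intros Hr. assert (HN := INR_ge2 n Hn).
(* From [2 n F (u) - (n-2) u f (u) = u^2 (2 - m k)]. *)
set (m := 2 * INR n / q - (INR n - 2)).
assert (Hd : forall s, c < s < z ->
  is_derive (jP n q p) s (wt n s * ju p s ^ 2 * (2 - m * kk q p s))).
{ intros s Hs. assert (Hu := d_u _ _ _ _ _ D s Hs).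
  replace (wt n s * ju p s ^ 2 * (2 - m * kk q p s)) with
    (wt n s * (2 * INR n * F q (ju p s) - (INR n - 2) * (ju p s * f q (ju p s)))).
  - apply is_derive_jP; [lra|trivial|apply (d_sol _ _ _ _ _ D); lra].
  - rewrite F_eq by lra. unfold f; fold (kk q p s). unfold m; field; lra. }
assert (Hw : forall s, c < s < z -> 0 < wt n s * ju p s ^ 2).
{ intros s Hs. assert (Hu := d_u _ _ _ _ _ D s Hs).
  apply Rmult_lt_0_compat; [apply wt_pos; lra|nra]. }
assert (Hm : 0 < m).
{ unfold m. assert (INR n < 2 * INR n / q); [|lra]. apply (proj1 (Rlt_div_r _ _ q ltac:(lra))); nra. }
destruct (Rle_or_lt (m * kk q p r) 2) as [H|H].
- apply Rle_lt_trans with (jP n q p c).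
  + unfold jP; rewrite (d_u1c _ _ _ _ _ D).
    replace (c * wt n c * (0 ^ 2 + 2 * F q (ju p c)) + (INR n - 2) * wt n c * ju p c * 0)
      with (2 * (c * wt n c) * F q (ju p c)) by ring.
    assert (0 <= wt n c) by now apply pow_le.
    apply Rmult_le_pos; [|left; exact d_Fc]. nra.
  + eapply increasing_closed with (dg := fun s => wt n s * ju p s ^ 2 * (2 - m * kk q p s)).
    * lra.
    * apply jP_continuous; [lra|]; apply d_continuous_right; lra.
    * apply jP_continuous; [lra|]; apply d_continuous_u_left; lra.
    * intros s Hs; apply Hd; lra.
    * intros s Hs. assert (kk q p s < kk q p r) by (apply d_kk_increasing; lra).
      assert (m * kk q p s < m * kk q p r) by (apply Rmult_lt_compat_l; lra).
      apply Rmult_lt_0_compat; [apply Hw; lra|lra].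
- assert (Hz : 0 <= jP n q p z).
  { unfold jP; rewrite (d_uz _ _ _ _ _ D), F_0.
    replace (z * wt n z * (ju1 p z ^ 2 + 2 * 0) + (INR n - 2) * wt n z * 0 * ju1 p z)
      with (z * wt n z * ju1 p z ^ 2) by ring.
    assert (0 < wt n z) by (apply wt_pos; lra).
    apply Rmult_le_pos; [nra|apply pow2_ge_0]. }
  apply Rle_lt_trans with (jP n q p z); trivial.
  cut (- jP n q p r < - jP n q p z); [lra|].
  eapply increasing_closed with (g := fun s => - jP n q p s)
    (dg := fun s => - (wt n s * ju p s ^ 2 * (2 - m * kk q p s))).
  + lra.
  + apply continuous_along_opp; [apply _|];
      apply jP_continuous; [lra|]; apply d_continuous_right; lra.
  + apply continuous_along_opp; [apply _|];
      apply jP_continuous; [lra|]; apply d_continuous_u_left; lra.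
  + intros s Hs; apply (is_derive_opp (jP n q p)), Hd; lra.
  + intros s Hs. assert (kk q p r < kk q p s) by (apply d_kk_increasing; lra).
    assert (m * kk q p r < m * kk q p s) by (apply Rmult_lt_compat_l; lra).
    rewrite Ropp_mult_distr_r. apply Rmult_lt_0_compat; [apply Hw; lra|lra].
Qed.

Lemma d_A_pos r : c < r < z -> 0 < jA n q p r.
Proof.
intros Hr. assert (Hu := d_u _ _ _ _ _ D r Hr). assert (HP := d_P_pos r Hr).
rewrite jA_jP by lra. assert (0 < wt n r) by (apply wt_pos; lra).
assert (0 < kk q p r) by (apply d_kk_pos; lra).
assert (0 < (2 - q) / q) by (apply Rdiv_lt_0_compat; lra).
apply Rplus_lt_0_compat; trivial.
pos.
Qed.

(** [N] increases by [f_convex] as long as [v > 0]. It starts nonnegative: [u'(c) = 0] turns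
    [M (c) >= 0] into [c^(n-1) v'(c) <= 0], and [u (c) > 1]. *)
Lemma d_N_pos r1 : c < r1 < z -> ju p r1 = 1 ->
  (forall r, c < r < r1 -> 0 < jv p r) -> 0 < jN n p r1.
Proof.
intros Hr1 E Hv.
apply Rle_lt_trans with (jN n p c).
- assert (HM := d_Mc _ _ _ _ _ D). assert (Hu := d_uc).
  unfold jN, jM in *; rewrite (d_u1c _ _ _ _ _ D) in *.
  assert (wt n c * jv1 p c <= 0); nra.
- eapply increasing_closed with (dg := fun r =>
    wt n r * jv p r * ((ju p r - 1) * (1 - (q - 1) * kk q p r) - f q (ju p r))).
  + lra.
  + apply jN_continuous, d_continuous_right; lra.
  + apply jN_continuous, d_continuous_left; lra.
  + intros r Hr. apply (is_derive_jN n q p r Hn); [|apply (d_sol _ _ _ _ _ D); lra].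
    assert (H := d_u_pos r ltac:(lra)); lra.
  + intros r Hr. apply Rmult_lt_0_compat.
    * apply Rmult_lt_0_compat; [apply wt_pos; lra|apply Hv; lra].
    * apply f_convex; trivial. rewrite <- E; apply d_u_decreasing; lra.
Qed.

(* Sturm comparison of [v] with [u - 1]. *)
Lemma d_tau r1 : c < r1 < z -> ju p r1 = 1 ->
  exists tau, c < tau < r1 /\ jv p tau = 0 /\ forall r, c <= r < tau -> 0 < jv p r.
Proof.
intros Hr1 E.
assert (Hnear : at_right c (fun r => 0 < jv p r)).
{ apply (continuous_along_pos _ _ (jv p) c); [|exact (d_vc _ _ _ _ _ D)].
  apply d_continuous_right; lra. }
destruct (classic (exists x, c < x < r1 /\ jv p x <= 0)) as [[x [Hx Hvx]]|H].
- destruct (first_zero (jv p) c x) as [t [Ht [Et Hpos]]]; trivial; [lra| |].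
  + intros r Hr; apply (solves_continuous n q), (d_sol _ _ _ _ _ D); lra.
  + exists t; split; [lra|split; trivial]. intros r Hr.
    destruct (Req_dec r c) as [->|]; [exact (d_vc _ _ _ _ _ D)|apply Hpos; lra].
- exfalso.
  assert (Hv : forall r, c < r < r1 -> 0 < jv p r).
  { intros r Hr; apply Rnot_le_lt; intros Hv; apply H; now exists r. }
  assert (HN := d_N_pos r1 Hr1 E Hv).
  assert (Hv1 : 0 <= jv p r1).
  { apply (left_limit_ge (jv p) c r1); [lra| |].
    - apply d_continuous_left; lra.
    - intros r Hr; left; now apply Hv. }
  (* At [u = 1] only [r^(n-1) u' v] is left of [N], and it is not positive when [v >= 0]. *)
  unfold jN in HN; rewrite E in HN.
  assert (Hu1 := d_u1 _ _ _ _ _ D r1 Hr1).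
  assert (Hw := wt_pos n r1 ltac:(lra)). assert (ju1 p r1 * jv p r1 <= 0) by nra. nra.
Qed.

Lemma d_M_increasing s t : c <= s -> s < t -> t < z ->
  (forall r, s < r < t -> 0 < jv p r) -> jM n p s < jM n p t.
Proof.
intros Hs Hst Ht Hv.
eapply increasing_closed with (dg := fun r => (2 - q) * wt n r * kk q p r * ju p r * jv p r).
- lra.
- apply jM_continuous, d_continuous_right; lra.
- apply jM_continuous, d_continuous_left; lra.
- intros r Hr. apply (is_derive_jM n q p r Hn); [|apply (d_sol _ _ _ _ _ D); lra].
  assert (H := d_u_pos r ltac:(lra)); lra.
- intros r Hr. assert (0 < wt n r) by (apply wt_pos; lra).
  assert (0 < kk q p r) by (apply d_kk_pos; lra).
  assert (0 < ju p r) by (apply d_u_pos; lra). assert (0 < jv p r) by (apply Hv; lra).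
  pos.
Qed.

Definition dT (r : R) : R :=
  (2 - q) * wt n r * ju p r * jv p r - q * ju1 p r / (kk q p r * ju p r) * jM n p r.

Lemma is_derive_dT r : c < r < z -> is_derive (jT n q p) r (dT r).
Proof.
intros Hr. apply is_derive_jT; trivial; [lra| |apply (d_sol _ _ _ _ _ D); lra].
assert (H := d_u_pos r ltac:(lra)); lra.
Qed.

Lemma d_T_increasing s t : c <= s -> s < t -> t < z ->
  (forall r, s < r < t -> 0 < jv p r /\ 0 < jM n p r) -> jT n q p s < jT n q p t.
Proof.
intros Hs Hst Ht Hv.
eapply increasing_closed with (dg := dT).
- lra.
- apply jT_continuous; trivial; [|apply d_continuous_right; lra].
  assert (H := d_u_pos s ltac:(lra)); lra.
- apply jT_continuous; trivial; [|apply d_continuous_left; lra].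
  assert (H := d_u_pos t ltac:(lra)); lra.
- intros r Hr; apply is_derive_dT; lra.
- intros r Hr. destruct (Hv r Hr) as [Hv' HM]. unfold dT.
  assert (0 < wt n r) by (apply wt_pos; lra).
  assert (0 < kk q p r) by (apply d_kk_pos; lra).
  assert (0 < ju p r) by (apply d_u_pos; lra).
  assert (Hu1 := d_u1 _ _ _ _ _ D r ltac:(lra)).
  assert (0 < (2 - q) * wt n r * ju p r * jv p r) by (pos).
  assert (0 < q * - ju1 p r / (kk q p r * ju p r) * jM n p r).
  { apply Rmult_lt_0_compat; trivial. apply Rdiv_lt_0_compat; nra. }
  unfold Rdiv in *. nra.
Qed.

(** Multiplying [T_2'] by [A] and replacing [v A] by means of [jA_v] expresses it through [M] and
    [T_2] alone. The term [r u' M] of [jA_v] cancels against the excess of [A] over [P], so that the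
    coefficient of [M] involves [P] and [g_2 (u)]; both are nonnegative where [F (u) >= 0]. *)
Lemma jA_dT r : c < r < z ->
  jA n q p r * dT r =
  (2 - q) * wt n r * ju p r ^ 2 * jT n q p r
  + jM n p r * ((2 - q) * wt n r * ju p r ^ 2 * g2 q (ju p r)
                - q * ju1 p r * jP n q p r / (kk q p r * ju p r)).
Proof.
intros Hr. assert (Hu := d_u_pos r ltac:(lra)). assert (Hk := d_kk_pos r ltac:(lra)).
unfold dT.
replace (jA n q p r * ((2 - q) * wt n r * ju p r * jv p r
     - q * ju1 p r / (kk q p r * ju p r) * jM n p r))
  with ((2 - q) * wt n r * ju p r * (jv p r * jA n q p r)
     - q * ju1 p r / (kk q p r * ju p r) * jM n p r * jA n q p r) by (field; lra).
rewrite jA_v, (jA_jP n q p r) by lra.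
unfold jT. field; lra.
Qed.

Lemma d_dT_nonneg r : c < r < z -> kk q p r <= q / 2 ->
  0 < jM n p r -> 0 < jT n q p r -> 0 <= dT r.
Proof.
intros Hr Hkr HMr HTr.
assert (HA := d_A_pos r ltac:(lra)). assert (HP := d_P_pos r ltac:(lra)).
assert (Hw : 0 < wt n r) by (apply wt_pos; lra).
assert (Hk : 0 < kk q p r) by (apply d_kk_pos; lra).
assert (Hu : 0 < ju p r) by (apply d_u_pos; lra).
assert (Hu1 := d_u1 _ _ _ _ _ D r ltac:(lra)).
assert (Hg : 0 <= g2 q (ju p r)).
{ rewrite g2_eq by lra. fold (kk q p r).
  apply Rdiv_le_0_compat; [|lra].
  assert (2 <= q / kk q p r); [|lra]. apply Rle_div_r; lra. }
apply (Rmult_le_reg_l _ _ _ HA). rewrite Rmult_0_r, (jA_dT r) by lra.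
assert (0 < q * - ju1 p r * jP n q p r / (kk q p r * ju p r)).
{ apply Rdiv_lt_0_compat; [|nra]. pos. }
assert (0 < (2 - q) * wt n r * ju p r ^ 2).
{ pos. }
assert (0 < (2 - q) * wt n r * ju p r ^ 2 * jT n q p r) by nra.
replace (q * ju1 p r * jP n q p r / (kk q p r * ju p r))
  with (- (q * - ju1 p r * jP n q p r / (kk q p r * ju p r))) by (field; lra).
assert (0 <= (2 - q) * wt n r * ju p r ^ 2 * g2 q (ju p r)) by nra. nra.
Qed.

Lemma d_MT_cooperative tau s : c < tau -> tau < s -> s < z -> kk q p s <= q / 2 ->
  0 < jM n p tau -> 0 < jT n q p tau ->
  forall r, tau < r < s -> 0 < jM n p r /\ 0 < jT n q p r.
Proof.
intros Htau Hts Hs Hks HM HT.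
apply (cooperative_pos (jM n p) (jT n q p)
  (fun r => (2 - q) * wt n r * kk q p r * ju p r * jv p r) dT).
- apply filter_and.
  + apply (continuous_along_pos _ _ (jM n p) tau); trivial.
    apply jM_continuous, d_continuous_right; lra.
  + apply (continuous_along_pos _ _ (jT n q p) tau); trivial.
    apply jT_continuous; trivial; [|apply d_continuous_right; lra].
    assert (H := d_u_pos tau ltac:(lra)); lra.
- intros r Hr. apply (is_derive_jM n q p r Hn); [|apply (d_sol _ _ _ _ _ D); lra].
  assert (H := d_u_pos r ltac:(lra)); lra.
- intros r Hr; apply is_derive_dT; lra.
- intros r Hr HMr HTr. apply d_dT_nonneg; trivial; [lra|].
  apply Rlt_le, Rlt_le_trans with (kk q p s); trivial. apply d_kk_increasing; lra.
(* Where [M = 0], [T_2] equals [Q] and [jA_v] reads [v A = u Q]; hence [v > 0] and [M' > 0]. *)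
- intros r Hr HMr HTr.
  assert (HA := d_A_pos r ltac:(lra)).
  assert (Hw : 0 < wt n r) by (apply wt_pos; lra).
  assert (Hk : 0 < kk q p r) by (apply d_kk_pos; lra).
  assert (Hu : 0 < ju p r) by (apply d_u_pos; lra).
  assert (HQ : 0 < jQ n q p r) by (unfold jT in HTr; rewrite HMr in HTr; lra).
  assert (Hv : 0 < jv p r).
  { assert (E := jA_v n q p r). rewrite HMr in E. nra. }
  pos.
Qed.

End Descent.

(** * The variation after its first zero *)

(** [r^n J = X + 2 E r^(n-1) theta] with [E > 0], so [J], and with it [theta'], is positive while
    [theta > 0] and [X >= 0]; at a zero of [X] this makes [X'] positive. Both descents and ascents
    rely on it. *)
Lemma X_cooperative n q p a b : (2 <= n)%nat -> 1 < q ->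
  (forall r, a < r < b -> solves n q p r) ->
  (forall r, a < r < b -> ju p r <> 0 /\ ju1 p r <> 0 /\ F q (ju p r) < 0 /\ 0 < jE q p r) ->
  at_right a (fun r => 0 < jX n q p r /\ 0 < jth p r) ->
  forall r, a < r < b -> 0 < jX n q p r /\ 0 < jth p r.
Proof.
intros Hn Hq Hs Hu H0. assert (HN := INR_ge2 n Hn).
apply (cooperative_pos (jX n q p) (jth p)
  (fun r => - 2 * F q (ju p r) * wt n r
     * (jJ n q p r / ju1 p r ^ 2 + (INR n - 1) / r * jth p r))
  (fun r => jJ n q p r / ju1 p r ^ 2)); trivial.
- intros r Hr; destruct (Hu r Hr) as (U & U1 & _); now apply is_derive_jX; [| | | |apply Hs].
- intros r Hr; destruct (Hu r Hr) as (U & U1 & _); now apply is_derive_jth; [|apply Hs].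
- intros r Hr HX Ht; destruct (Hu r Hr) as (U & U1 & HF & HE).
  destruct (Hs r Hr) as [[Hr0 _ _] _ _ _].
  assert (Hw := wt_pos n r Hr0). unfold jX in HX.
  assert (0 < 2 * jE q p r * (wt n r * jth p r)) by pos.
  assert (0 < r * wt n r) by pos.
  apply Rdiv_le_0_compat; [nra|now apply pow2_gt_0].
- intros r Hr HX Ht; destruct (Hu r Hr) as (U & U1 & HF & HE).
  destruct (Hs r Hr) as [[Hr0 _ _] _ _ _].
  assert (Hw := wt_pos n r Hr0). unfold jX in HX.
  assert (0 < 2 * jE q p r * (wt n r * jth p r)) by pos.
  assert (0 < r * wt n r) by pos.
  assert (0 < jJ n q p r) by nra.
  assert (0 < ju1 p r ^ 2) by now apply pow2_gt_0.
  replace (- 2 * F q (ju p r) * wt n r) with (2 * - F q (ju p r) * wt n r) by ring.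
  apply Rmult_lt_0_compat; [pos|].
  apply Rplus_lt_0_compat; pos.
Qed.

Lemma J_of_Q n q p r : 0 < r -> 0 <= ju1 p r * jv p r -> 0 < jQ n q p r -> 0 < jJ n q p r.
Proof.
intros Hr Hv HQ. rewrite jQ_jJ in HQ by trivial.
assert (Hw : 0 < wt n r) by now apply wt_pos.
apply (pos_factor (r * wt n r)); [pos|].
assert (0 <= wt n r * (ju1 p r * jv p r)) by (apply Rmult_le_pos; lra). lra.
Qed.

Lemma J_of_X n q p r : 0 < r -> 0 < jX n q p r -> 0 <= jth p r -> 0 <= jE q p r ->
  0 < jJ n q p r.
Proof.
intros Hr HX Ht HE. assert (Hw := wt_pos n r Hr). unfold jX in HX.
assert (0 <= 2 * jE q p r * (wt n r * jth p r)).
{ apply Rmult_le_pos; [lra|]. apply Rmult_le_pos; lra. }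
assert (0 < r * wt n r) by pos. nra.
Qed.

Lemma X_nondecreasing n q p a b : (2 <= n)%nat -> 1 < q -> a < b ->
  (forall r, a < r < b -> solves n q p r) ->
  (forall r, a < r < b -> ju p r <> 0 /\ ju1 p r <> 0 /\ F q (ju p r) < 0 /\ 0 < jE q p r) ->
  (forall r, a < r < b -> 0 < jX n q p r /\ 0 < jth p r) ->
  continuous_along (at_right a) (jX n q p) a ->
  continuous_along (at_left b) (jX n q p) b ->
  jX n q p a <= jX n q p b.
Proof.
intros Hn Hq Hab Hs Hu HXt Ha Hb. assert (HN := INR_ge2 n Hn).
apply (nondecreasing_closed (jX n q p)
  (fun r => - 2 * F q (ju p r) * wt n r
     * (jJ n q p r / ju1 p r ^ 2 + (INR n - 1) / r * jth p r))); trivial.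
- intros r Hr; destruct (Hu r Hr) as (U & U1 & _); now apply is_derive_jX; [| | | |apply Hs].
- intros r Hr; destruct (Hu r Hr) as (U & U1 & HF & HE). destruct (HXt r Hr) as [HX Ht].
  destruct (Hs r Hr) as [[Hr0 _ _] _ _ _].
  assert (Hw := wt_pos n r Hr0).
  assert (HJ := J_of_X n q p r Hr0 HX ltac:(lra) ltac:(lra)).
  assert (0 < ju1 p r ^ 2) by now apply pow2_gt_0.
  replace (- 2 * F q (ju p r) * wt n r) with (2 * - F q (ju p r) * wt n r) by ring.
  left; apply Rmult_lt_0_compat; [pos|].
  apply Rplus_lt_0_compat; pos.
Qed.

Lemma F_half q x : x <> 0 -> 0 < q -> powabs x (q - 2) = q / 2 -> F q x = 0.
Proof. intros Hx Hq E. rewrite F_eq, E by lra. field; lra. Qed.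

Lemma jX_half n q p r : 0 < r -> ju1 p r <> 0 -> F q (ju p r) = 0 -> jX n q p r = jQ n q p r.
Proof.
intros Hr H1 E. rewrite jQ_jJ by trivial. unfold jX, jE, jth. rewrite E. field; trivial.
Qed.

(** [kk < 1] at [tau] encodes [|u (tau)| > 1], that is, [tau] lies before [r_i]. *)
Definition first_v_zero (q : R) (p : jet) (c z tau : R) : Prop :=
  c < tau < z /\ jv p tau = 0 /\ kk q p tau < 1 /\ forall r, c <= r < tau -> 0 < jv p r.

Section DescentVariation.
Context {n : nat} {q : R} {p : jet} {c z : R} (D : descent n q p c z).

Let Hn : (2 <= n)%nat := d_n _ _ _ _ _ D.
Let Hq : 1 < q < 2 := d_q _ _ _ _ _ D.
Let Hc : 0 <= c := d_c _ _ _ _ _ D.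
Let Hcz : c < z := d_cz _ _ _ _ _ D.

Lemma d_M_pos tau : first_v_zero q p c z tau -> forall r, c < r <= tau -> 0 < jM n p r.
Proof.
intros (Ht & _ & _ & Hv) r Hr. apply Rle_lt_trans with (jM n p c).
- exact (d_Mc _ _ _ _ _ D).
- apply (d_M_increasing D); try lra. intros; apply Hv; lra.
Qed.

Lemma d_T_pos tau : first_v_zero q p c z tau -> forall r, c < r <= tau -> 0 < jT n q p r.
Proof.
intros H r Hr. assert (HM := d_M_pos tau H). destruct H as (Ht & _ & _ & Hv).
apply Rle_lt_trans with (jT n q p c).
- exact (d_Tc _ _ _ _ _ D).
- apply (d_T_increasing D); try lra. intros s Hs; split; [apply Hv|apply HM]; lra.
Qed.

Lemma d_v1_tau tau : first_v_zero q p c z tau -> jv1 p tau < 0.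
Proof.
intros H. assert (HM := d_M_pos tau H tau ltac:(unfold first_v_zero in H; lra)).
destruct H as (Ht & Ev & _ & Hv). unfold jM in HM; rewrite Ev in HM.
assert (Hw := wt_pos n tau ltac:(lra)). assert (Hu := d_u_pos D tau ltac:(lra)).
cut (0 < - jv1 p tau); [lra|]. apply (pos_factor (wt n tau * ju p tau)); [pos|].
replace (wt n tau * ju p tau * - jv1 p tau)
  with (wt n tau * (ju1 p tau * 0 - ju p tau * jv1 p tau)) by ring. trivial.
Qed.

Lemma d_v_neg_right tau : first_v_zero q p c z tau -> at_right tau (fun r => jv p r < 0).
Proof.
intros H. assert (H1 := d_v1_tau tau H). destruct H as (Ht & Ev & _ & Hv).
assert (Hd : is_derive (fun r => - jv p r) tau (- jv1 p tau)).
{ apply (is_derive_opp (jv p)). apply (d_sol _ _ _ _ _ D); lra. }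
generalize (derive_pos_right_pos _ _ _ Hd ltac:(lra) ltac:(lra)).
apply filter_imp; intros; lra.
Qed.

Lemma d_th_pos r : c < r < z -> jv p r < 0 -> 0 < jth p r.
Proof.
intros Hr Hv. assert (H := d_u1 _ _ _ _ _ D r Hr). unfold jth.
replace (jv p r / ju1 p r) with (- jv p r / - ju1 p r) by (field; lra).
apply Rdiv_lt_0_compat; lra.
Qed.

Lemma d_v_of_th r : c < r < z -> 0 < jth p r -> jv p r < 0.
Proof.
intros Hr Ht. assert (H := d_u1 _ _ _ _ _ D r Hr).
replace (jv p r) with (jth p r * ju1 p r) by (unfold jth; field; lra). nra.
Qed.

(* Where [F (u) >= 0], the positivity of [M] prevents [v] from returning to zero. *)
Lemma d_outer tau s : first_v_zero q p c z tau -> tau < s < z -> kk q p s <= q / 2 ->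
  (forall r, tau < r <= s -> jv p r < 0 /\ 0 < jT n q p r) /\ 0 < jQ n q p s /\
  (forall r, tau < r <= s -> 0 < jJ n q p r).
Proof.
intros H Hs Hks.
assert (HMT := d_MT_cooperative D tau s ltac:(unfold first_v_zero in H; lra)
  ltac:(lra) ltac:(lra) Hks
  (d_M_pos tau H tau ltac:(unfold first_v_zero in H; lra))
  (d_T_pos tau H tau ltac:(unfold first_v_zero in H; lra))).
assert (Hnear := d_v_neg_right tau H). assert (Hu1s := d_u1 _ _ _ _ _ D).
destruct H as (Ht & Ev & _ & Hv).
assert (HTs : 0 < jT n q p s).
{ set (m := (tau + s) / 2).
  apply Rlt_le_trans with (jT n q p m); [apply HMT; unfold m; lra|].
  apply (nondecreasing_closed (jT n q p) (@dT n q p)); [unfold m; lra| | | |].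
  - apply jT_continuous; trivial; [|apply (d_continuous_right D); unfold m; lra].
    assert (H := d_u_pos D m ltac:(unfold m; lra)); lra.
  - apply jT_continuous; trivial; [|apply (d_continuous_left D); lra].
    assert (H := d_u_pos D s ltac:(lra)); lra.
  - intros r Hr; apply (is_derive_dT D); unfold m in *; lra.
  - intros r Hr. assert (Hr' : tau < r < s) by (unfold m in *; lra).
    destruct (HMT r Hr') as [HM HT]. apply (d_dT_nonneg D r); trivial; [lra|].
    apply Rlt_le, Rlt_le_trans with (kk q p s); trivial. apply (d_kk_increasing D); lra. }
assert (Hg : forall r, tau < r <= s -> 0 <= g2 q (ju p r)).
{ intros r Hr. assert (Hu := d_u_pos D r ltac:(lra)). rewrite g2_eq by lra. fold (kk q p r).
  assert (Hk := d_kk_pos D r ltac:(lra)).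
  assert (kk q p r <= q / 2).
  { destruct (Req_dec r s) as [->|]; trivial.
    apply Rlt_le, Rlt_le_trans with (kk q p s); trivial. apply (d_kk_increasing D); lra. }
  apply Rdiv_le_0_compat; [|lra].
  assert (2 <= q / kk q p r); [|lra]. apply Rle_div_r; lra. }
assert (Hneg : forall r, tau < r < s -> jv p r < 0).
{ intros r Hr. cut (0 < - jv p r); [lra|]. revert r Hr.
  apply (positive_barrier (fun r => - jv p r) (fun r => - jv1 p r)).
  - revert Hnear; apply filter_imp; intros; lra.
  - intros r Hr. apply continuous_along_opp; [apply _|].
    apply (solves_continuous n q), (d_sol _ _ _ _ _ D); lra.
  - intros r Hr _ E. split.
    + apply (is_derive_opp (jv p)). apply (d_sol _ _ _ _ _ D); lra.
    + destruct (HMT r Hr) as [HM _]. unfold jM in HM.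
      assert (Ev' : jv p r = 0) by lra. rewrite Ev' in HM.
      assert (Hw := wt_pos n r ltac:(lra)). assert (Hu := d_u_pos D r ltac:(lra)).
      apply (pos_factor (wt n r * ju p r)); [pos|].
      replace (wt n r * ju p r * - jv1 p r)
        with (wt n r * (ju1 p r * 0 - ju p r * jv1 p r)) by ring. trivial. }
assert (HMs : 0 <= jM n p s).
{ apply (left_limit_ge (jM n p) tau s); [lra| |].
  - apply jM_continuous, (d_continuous_left D); lra.
  - intros r Hr; left; now apply HMT. }
assert (HQ : forall r, tau < r <= s -> 0 < jQ n q p r).
{ intros r Hr. assert (Hgr := Hg r Hr).
  assert (HMT' : 0 <= jM n p r /\ 0 < jT n q p r).
  { destruct (Req_dec r s) as [->|]; [now split|]. destruct (HMT r ltac:(lra)); lra. }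
  destruct HMT' as [HM HT]. unfold jT in HT. nra. }
(* At the endpoint [M] is only known to be nonnegative, so [Q] is used instead: [v (s) = 0] would
   force [v'(s) >= 0] and [Q (s) = s^n u' v' <= 0]. *)
assert (Hvs : jv p s < 0).
{ assert (Hle : jv p s <= 0).
  { apply (left_limit_le (jv p) tau s); [lra| |].
    - apply (d_continuous_left D); lra.
    - intros r Hr; left; now apply Hneg. }
  destruct Hle as [|E]; trivial. exfalso.
  assert (HQs := HQ s ltac:(lra)).
  assert (H1 : 0 <= jv1 p s).
  { apply (left_neg_derive_nonneg (jv p) tau s); trivial; [lra|].
    apply (d_sol _ _ _ _ _ D); lra. }
  unfold jQ in HQs; rewrite E in *.
  assert (Hw := wt_pos n s ltac:(lra)).
  assert (Hu1 := Hu1s s ltac:(lra)).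
  assert (0 < s * wt n s) by (apply Rmult_lt_0_compat; lra).
  assert (ju1 p s * jv1 p s <= 0) by nra. nra. }
assert (Hall : forall r, tau < r <= s -> jv p r < 0).
{ intros r Hr; destruct (Req_dec r s) as [->|]; [trivial|apply Hneg; lra]. }
repeat split.
- now apply Hall.
- destruct (Req_dec r s) as [->|]; [trivial|apply HMT; lra].
- apply HQ; lra.
- intros r Hr. apply J_of_Q; [lra| |now apply HQ].
  assert (H1 := Hall r Hr). assert (H2 := Hu1s r ltac:(lra)). nra.
Qed.

Lemma d_inner b : c < b < z -> q / 2 <= kk q p b -> 0 < jX n q p b ->
  at_right b (fun r => jv p r < 0) ->
  (forall r, b < r < z -> 0 < jX n q p r /\ 0 < jth p r) /\
  (forall r, b <= r < z -> jX n q p b <= jX n q p r) /\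
  (forall r, b < r < z -> ju p r <> 0 /\ ju1 p r <> 0 /\ F q (ju p r) < 0 /\ 0 < jE q p r).
Proof.
intros Hb Hk HX Hnear.
assert (Hu : forall r, b < r < z ->
  ju p r <> 0 /\ ju1 p r <> 0 /\ F q (ju p r) < 0 /\ 0 < jE q p r).
{ intros r Hr. assert (U := d_u_pos D r ltac:(lra)).
  assert (U1 := d_u1 _ _ _ _ _ D r ltac:(lra)).
  repeat split; try lra; [|apply (d_E _ _ _ _ _ D); lra].
  apply Rnot_le_lt; intros HF. apply F_nonneg_iff in HF; [|lra|lra].
  assert (kk q p b < kk q p r) by (apply (d_kk_increasing D); lra).
  unfold kk in *; lra. }
assert (Hs : forall r, b < r < z -> solves n q p r).
{ intros r Hr; apply (d_sol _ _ _ _ _ D); lra. }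
assert (HXc : forall r, c < r < z -> continuous (jX n q p) r).
{ intros r Hr. apply (jX_continuous (locally r)); [lra|lra| |].
  - assert (U1 := d_u1 _ _ _ _ _ D r ltac:(lra)); lra.
  - apply (solves_continuous n q), (d_sol _ _ _ _ _ D); lra. }
assert (HXt : forall r, b < r < z -> 0 < jX n q p r /\ 0 < jth p r).
{ apply X_cooperative; trivial; [lra|]. apply filter_and.
  - apply (continuous_along_pos _ _ (jX n q p) b); trivial.
    apply continuous_right, HXc; lra.
  - assert (Hlt : at_right b (fun r => b < r < z)).
    { apply (ex_at_right b _ (z - b)); intros; lra. }
    generalize (filter_and _ _ Hnear Hlt). apply filter_imp.
    intros r [Hv Hr]; apply d_th_pos; trivial; lra. }
repeat split; trivial; try (now apply HXt); try (now apply Hu).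
intros r Hr. destruct (Req_dec b r) as [->|]; [lra|].
apply X_nondecreasing; trivial; try lra.
- intros s Hs'; apply Hs; lra.
- intros s Hs'; apply Hu; lra.
- intros s Hs'; apply HXt; lra.
- apply continuous_right, HXc; lra.
- apply continuous_left, HXc; lra.
Qed.

(** The point [b] is where the argument with [M] and [T_2] hands over to the one with [X] and
    [theta]. The bound [X >= X (b) > 0] is exported because it survives the limit at [z], simple or
    double. *)
Lemma descent_variation tau : first_v_zero q p c z tau ->
  (forall r, tau < r < z -> jv p r < 0 /\ 0 < jJ n q p r) /\
  (forall r, tau <= r < z -> kk q p r <= q / 2 -> 0 < jT n q p r) /\
  exists b, c < b < z /\ 0 < jX n q p b /\
  (forall r, b <= r < z -> jX n q p b <= jX n q p r) /\
  (forall r, b < r < z -> F q (ju p r) < 0).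
Proof.
intros H.
assert (Hb : exists b, tau <= b < z /\ q / 2 <= kk q p b /\ 0 < jX n q p b /\
  at_right b (fun r => jv p r < 0) /\
  (forall r, tau < r <= b -> jv p r < 0 /\ 0 < jJ n q p r) /\
  (forall r, tau <= r <= b -> kk q p r <= q / 2 -> 0 < jT n q p r)).
{ assert (HTt := d_T_pos tau H tau). assert (Hn0 := d_v_neg_right tau H).
  assert (H1 := d_v1_tau tau H).
  (* If [F (u (tau)) > 0], then [b] is the later point where [F (u) = 0] and [X = Q]. Otherwise
     [b = tau], where [v = 0] leaves [X = tau^n u' v' > 0]. *)
  destruct (Rlt_or_le (kk q p tau) (q / 2)) as [Hk|Hk].
  - destruct (d_kk_level D (q / 2) tau) as [s [Hs Es]]; try lra.
    { unfold first_v_zero in H; lra. }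
    destruct (d_outer tau s H Hs ltac:(lra)) as (Hv & HQ & HJ).
    assert (Hts : c < tau) by (unfold first_v_zero in H; lra).
    assert (Hu := d_u_pos D s ltac:(lra)).
    assert (Hu1 := d_u1 _ _ _ _ _ D s ltac:(lra)).
    exists s; repeat split; try lra.
    + rewrite jX_half; trivial; try lra. now apply F_half; [lra|lra|].
    + assert (Hneg : at_right s (fun r => 0 < - jv p r)).
      { apply (continuous_along_pos _ _ (fun r => - jv p r) s).
        - apply continuous_along_opp; [apply _|]; apply (d_continuous_right D); lra.
        - destruct (Hv s ltac:(lra)); lra. }
      revert Hneg; apply filter_imp; intros; lra.
    + now apply Hv.
    + now apply HJ.
    + intros r Hr _. destruct (Req_dec r tau) as [->|]; [apply HTt; lra|apply Hv; lra].
  - destruct H as (Ht & Ev & _ & Hv). exists tau; repeat split; try lra.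
    + unfold jX, jJ, jth; rewrite Ev. assert (Hw := wt_pos n tau ltac:(lra)).
      assert (Hu1 := d_u1 _ _ _ _ _ D tau ltac:(lra)).
      replace (tau * wt n tau * (ju1 p tau * jv1 p tau + f q (ju p tau) * 0
        + (INR n - 1) / tau * (ju1 p tau * 0))
        - 2 * jE q p tau * (wt n tau * (0 / ju1 p tau)))
        with (tau * wt n tau * (- ju1 p tau * - jv1 p tau)) by (field; lra).
      pos.
    + trivial.
    + intros r Hr Hkr; replace r with tau by lra; apply HTt; lra. }
destruct H as (Ht & _).
destruct Hb as (b & Hb & Hk & HX & Hnear & HvJ & HT).
destruct (d_inner b ltac:(lra) Hk HX Hnear) as (HXt & HXm & Hu).
repeat split.
- destruct (Rle_or_lt r b); [apply HvJ; lra|].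
  apply d_v_of_th; [lra|]. apply HXt; lra.
- destruct (Rle_or_lt r b); [apply HvJ; lra|].
  destruct (HXt r ltac:(lra)) as [HXr Htr]. destruct (Hu r ltac:(lra)) as (_ & _ & _ & HE).
  apply J_of_X; lra.
- intros r Hr Hkr. destruct (Rle_or_lt r b) as [|Hbr]; [apply HT; trivial; lra|].
  exfalso. assert (kk q p b < kk q p r) by (apply (d_kk_increasing D); lra). lra.
- exists b; repeat split; try lra; trivial. intros r Hr; now apply Hu.
Qed.

End DescentVariation.

(** * The amplitude [a] with [F (a) = E] *)

Lemma f_pos_of_F q x : 1 < q < 2 -> 0 < x -> 0 <= F q x -> 0 < f q x.
Proof.
intros Hq Hx HF. apply F_nonneg_iff in HF; [|lra|lra].
unfold f. assert (powabs x (q - 2) < 1) by lra. nra.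
Qed.

Lemma F_nonneg_mono q x y : 1 < q < 2 -> 0 < x -> x < y -> 0 <= F q x -> 0 <= F q y.
Proof.
intros Hq Hx Hxy HF. apply F_nonneg_iff in HF; [|lra|lra]. apply F_nonneg_iff; [lra|lra|].
assert (H := powabs_decr q x y ltac:(lra) ltac:(lra)). lra.
Qed.

Lemma F_increasing q x y : 1 < q < 2 -> 0 < x -> x < y -> 0 <= F q x -> F q x < F q y.
Proof.
intros Hq Hx Hxy HF. apply (derive_pos_lt (F q) (f q)); trivial.
- intros; apply is_derive_F; lra.
- intros r Hr. apply f_pos_of_F; [trivial|lra|].
  destruct (Req_dec r x) as [->|]; trivial. apply (F_nonneg_mono q x); trivial; lra.
Qed.

Lemma F_lt_inv q x y : 1 < q < 2 -> 0 < x -> 0 < y -> 0 <= F q x -> F q y < F q x -> y < x.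
Proof.
intros Hq Hx Hy HF H. apply Rnot_le_lt; intros [Hle|E].
- assert (H1 := F_increasing q x y Hq Hx Hle HF); lra.
- rewrite E in H; lra.
Qed.

Lemma F_inj q x y : 1 < q < 2 -> 0 < x -> 0 < y -> 0 <= F q x -> F q x = F q y -> x = y.
Proof.
intros Hq Hx Hy HF E. destruct (Rtotal_order x y) as [H|[H|H]]; trivial.
- assert (H1 := F_increasing q x y Hq Hx H HF); lra.
- assert (H1 := F_increasing q y x Hq Hy H ltac:(lra)); lra.
Qed.

Lemma F_surj q y : 1 < q < 2 -> 0 < y -> exists a, 0 < a /\ F q a = y.
Proof.
intros Hq Hy.
destruct (powabs_level q (q / 2) ltac:(lra) ltac:(lra)) as [l [Hl El]].
destruct (powabs_level q (q / 4) ltac:(lra) ltac:(lra)) as [m [Hm Em]].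
assert (Hlm : l < m).
{ apply Rnot_le_lt; intros [H|H].
  - assert (H1 := powabs_decr q m l ltac:(lra) ltac:(lra)); lra.
  - rewrite H in Em; lra. }
(* Beyond [m] one has [|x|^(q-2) < q / 4], hence [F (x) >= x^2 / 4]; [A] is large enough for
   [A^2 > 4 y]. *)
set (A := m + 4 * (1 + y)).
assert (HA : y < F q A).
{ assert (H1 := powabs_decr q m A ltac:(lra) ltac:(unfold A; lra)).
  rewrite F_eq by (unfold A; lra).
  assert (0 < A ^ 2) by (apply pow_lt; unfold A; lra).
  assert (H3 : powabs A (q - 2) * A ^ 2 / q <= A ^ 2 / 4).
  { apply Rle_div_l; [lra|]. replace (A ^ 2 / 4 * q) with (q / 4 * A ^ 2) by field.
    apply Rmult_le_compat_r; lra. }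
  assert (4 * y < A ^ 2) by (unfold A; nra). lra. }
destruct (IVT_decreasing (fun x => - F q x) l A (- y)) as [a [Ha E]].
- unfold A; lra.
- apply continuous_along_opp; [apply _|]; apply continuous_right, continuous_F; lra.
- apply continuous_along_opp; [apply _|]; apply continuous_left, continuous_F; lra.
- intros r Hr; apply (continuous_along_opp (locally r)); [apply _|]; apply continuous_F; lra.
- rewrite (F_half q l) by lra. lra.
- exists a; split; lra.
Qed.

(** The inverse of [F] above its positive zero; for [y > 0] the choice is unique by [F_inj]. *)
Definition amplitude (q y : R) : R := epsilon (inhabits 0) (fun a => 0 < a /\ F q a = y).

Lemma amplitude_spec q y : 1 < q < 2 -> 0 < y -> 0 < amplitude q y /\ F q (amplitude q y) = y.
Proof. intros Hq Hy. unfold amplitude; apply epsilon_spec. now apply F_surj. Qed.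

Lemma amplitude_F q a : 1 < q < 2 -> 0 < a -> 0 < F q a -> amplitude q (F q a) = a.
Proof.
intros Hq Ha HF. destruct (amplitude_spec q _ Hq HF) as [H1 H2].
apply (F_inj q); trivial; lra.
Qed.

Lemma amplitude_lt q a y : 1 < q < 2 -> 0 < a -> 0 < y -> F q a < y -> a < amplitude q y.
Proof.
intros Hq Ha Hy H. destruct (amplitude_spec q y Hq Hy) as [H1 H2].
apply (F_lt_inv q); trivial; lra.
Qed.

Lemma continuous_amplitude q y : 1 < q < 2 -> 0 < y -> continuous (amplitude q) y.
Proof.
intros Hq Hy P [e He]. destruct (amplitude_spec q y Hq Hy) as [Ha EF].
set (a := amplitude q y) in *.
assert (He1 := Rmin_l e (a / 2)). assert (He2 := Rmin_r e (a / 2)).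
assert (He3 : 0 < Rmin e (a / 2)) by (apply Rmin_pos; [apply cond_pos|lra]).
set (d := Rmin e (a / 2)) in *.
assert (Hup : y < F q (a + d)) by (rewrite <- EF; apply F_increasing; trivial; lra).
assert (Hlow : F q (a - d) < y).
{ rewrite <- EF. destruct (Rle_or_lt 0 (F q (a - d))).
  - apply F_increasing; trivial; lra.
  - lra. }
assert (Hd0 : 0 < Rmin (y / 2) (Rmin (F q (a + d) - y) (y - F q (a - d)))).
{ apply Rmin_pos; [lra|apply Rmin_pos; lra]. }
exists (mkposreal _ Hd0); intros s Hs. apply He.
change (Rabs (s - y) < Rmin (y / 2) (Rmin (F q (a + d) - y) (y - F q (a - d)))) in Hs.
assert (M1 := Rmin_l (y / 2) (Rmin (F q (a + d) - y) (y - F q (a - d)))).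
assert (M2 := Rmin_r (y / 2) (Rmin (F q (a + d) - y) (y - F q (a - d)))).
assert (M3 := Rmin_l (F q (a + d) - y) (y - F q (a - d))).
assert (M4 := Rmin_r (F q (a + d) - y) (y - F q (a - d))).
apply Rabs_def2 in Hs.
destruct (amplitude_spec q s Hq ltac:(lra)) as [Hs1 Hs2].
assert (amplitude q s < a + d) by (apply (F_lt_inv q); trivial; lra).
assert (a - d < amplitude q s) by (apply (F_lt_inv q); trivial; lra).
change (Rabs (amplitude q s - a) < e). apply Rabs_def1; lra.
Qed.

Lemma is_derive_inverse (g h : R -> R) (y l : R) : 0 < l ->
  is_derive g (h y) l -> continuous h y -> locally y (fun s => g (h s) = s) ->
  is_derive h y (/ l).
Proof.
intros Hl Hg Hh Hgh. apply is_derive_Reals. apply is_derive_Reals in Hg.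
intros e He.
(* For the difference quotient [rho] of [g], the bound [l / 2] gives [rho * l > l^2 / 2], and
   [e * l^2 / 2] then makes the error [(l - rho) / (rho * l)] smaller than [e]. *)
assert (He1 : 0 < Rmin (l / 2) (e * l ^ 2 / 2)) by (apply Rmin_pos; pos).
destruct (Hg _ He1) as [d1 Hd1].
assert (M1 := Rmin_l (l / 2) (e * l ^ 2 / 2)). assert (M2 := Rmin_r (l / 2) (e * l ^ 2 / 2)).
set (e1 := Rmin (l / 2) (e * l ^ 2 / 2)) in *.
assert (Hc : locally y (fun s => Rabs (h s - h y) < d1)).
{ apply (Hh (fun x => Rabs (x - h y) < d1)). exists d1; intros x Hx; exact Hx. }
assert (Hy : g (h y) = y) by now apply locally_singleton in Hgh.
destruct (locally_ex _ _ (filter_and _ _ Hgh Hc)) as [d [Hd Hall]].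
exists (mkposreal d Hd); intros t Ht Htd; simpl in Htd.
apply Rabs_def2 in Htd. destruct (Hall (y + t) ltac:(lra)) as [E Hs].
set (k := h (y + t) - h y) in *.
assert (Ek : h y + k = h (y + t)) by (unfold k; ring).
assert (Hk : k <> 0).
{ intros K. apply Ht. rewrite K, Rplus_0_r in Ek. rewrite <- Ek in E. lra. }
specialize (Hd1 k Hk Hs). rewrite Ek, E, Hy in Hd1.
replace (y + t - y) with t in Hd1 by ring.
set (rho := t / k) in *. apply Rabs_def2 in Hd1.
assert (Hrho : l / 2 < rho) by lra.
replace (k / t - / l) with ((l - rho) / (rho * l)) by (unfold rho; field; repeat split; lra).
assert (Hrl : l ^ 2 / 2 < rho * l) by nra.
assert (Hl2 : 0 < l ^ 2 / 2) by pos.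
unfold Rdiv; rewrite Rabs_mult, Rabs_inv, (Rabs_right (rho * l)) by lra.
apply Rlt_div_l; [lra|].
apply Rlt_le_trans with e1; [apply Rabs_def1; lra|].
apply Rle_trans with (e * (l ^ 2 / 2)); [lra|]. apply Rmult_le_compat_l; lra.
Qed.

Lemma is_derive_amplitude q y : 1 < q < 2 -> 0 < y ->
  is_derive (amplitude q) y (/ f q (amplitude q y)).
Proof.
intros Hq Hy. destruct (amplitude_spec q y Hq Hy) as [Ha EF].
apply (is_derive_inverse (F q)).
- apply f_pos_of_F; trivial; lra.
- apply is_derive_F; lra.
- now apply continuous_amplitude.
- exists (mkposreal y Hy); intros s Hs. change (Rabs (s - y) < y) in Hs.
  apply Rabs_def2 in Hs. apply amplitude_spec; trivial; lra.
Qed.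

(** The pointwise algebra of [d_dY_pos]: [k] and [l] stand for [|u|^(q-2)] and [|a|^(q-2)], and [P]
    for [u'^2 = 2 F (a) - 2 F (u)]. The last hypothesis is [power_bernoulli]; it eliminates [a^2],
    after which [u^2] factors out and only [rho = k / l] and [l] remain. *)
Lemma barrier_inequality (q k l u a P : R) : 1 < q < 2 -> 0 < l -> k <= 1 -> 2 * l < q * k ->
  l < q / 2 -> 0 < u -> P = a ^ 2 * (1 - 2 * l / q) - u ^ 2 * (1 - 2 * k / q) ->
  k * u ^ 2 * (1 + q / (2 - q) * (k / l - 1)) <= l * a ^ 2 ->
  (1 - l) * u ^ 2 * (q * k / l - 2) < P * (2 - q).
Proof.
intros Hq Hl Hk Hkl Hlq Hu -> HB.
set (rho := k / l) in *.
assert (Ek : k = rho * l) by (unfold rho; field; lra).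
assert (Hr : 2 < q * rho).
{ unfold rho. replace (q * (k / l)) with ((q * k) / l) by (field; lra).
  apply Rlt_div_r; lra. }
assert (Hrl : rho * l <= 1) by lra. clearbody rho. subst k.
assert (Ha : rho * (2 - q + q * (rho - 1)) * u ^ 2 <= (2 - q) * a ^ 2).
{ apply (Rmult_le_reg_l l); trivial.
  apply (Rmult_le_compat_l (2 - q)) in HB; [|lra].
  replace ((2 - q) * (rho * l * u ^ 2 * (1 + q / (2 - q) * (rho - 1))))
    with (l * (rho * (2 - q + q * (rho - 1)) * u ^ 2)) in HB by (field; lra).
  lra. }
assert (Hx : 0 < 1 - 2 * l / q).
{ assert (2 * l / q < 1); [|lra]. apply Rlt_div_l; lra. }
apply (Rmult_le_compat_r (1 - 2 * l / q)) in Ha; [|lra].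
assert (Hu2 : 0 < u ^ 2) by pos.
replace (q * (rho * l) / l - 2) with (q * rho - 2) by (field; lra).
cut ((1 - l) * (q * rho - 2) <
  rho * (2 - q + q * (rho - 1)) * (1 - 2 * l / q) - (2 - q) * (1 - 2 * (rho * l) / q)).
{ intros H. nra. }
assert (Hrho : 0 < rho) by nra.
(* Affine in [l], hence enough at [l = 0] and [l = / rho]. *)
set (A := q * rho ^ 2 + (2 - 3 * q) * rho + q).
set (B := (rho - 2 / q) * (2 - 3 * q + q * rho + q / rho) + (2 - q) ^ 2 / q).
(* As a quadratic in [rho], [A] has discriminant [(5 q - 2) (q - 2) < 0]. *)
assert (HA : 0 < A) by (unfold A; nra).
assert (HB' : 0 < B).
{ unfold B. assert (Hrq : 0 < rho - 2 / q).
  { assert (2 / q < rho); [|lra]. apply Rlt_div_l; lra. }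
  assert (0 < (2 - q) ^ 2 / q) by pos.
  assert (0 < 2 - 3 * q + q * rho + q / rho); [|nra].
  apply (pos_factor rho); trivial.
  replace (rho * (2 - 3 * q + q * rho + q / rho)) with A by (unfold A; field; lra). trivial. }
set (t := rho * l) in *.
assert (E : rho * (2 - q + q * (rho - 1)) * (1 - 2 * l / q) - (2 - q) * (1 - 2 * t / q)
  - (1 - l) * (q * rho - 2) = (1 - t) * A + t * B).
{ unfold t, A, B. field. lra. }
assert (0 < t) by (unfold t; pos).
assert (0 < (1 - t) * A + t * B) by nra. lra.
Qed.

(** * The energy barrier *)

Section Barrier.
Context {n : nat} {q : R} {p : jet} {c z : R} (D : descent n q p c z).
Context (Hz1 : ju1 p z <> 0).

Let Hn : (2 <= n)%nat := d_n _ _ _ _ _ D.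
Let Hq : 1 < q < 2 := d_q _ _ _ _ _ D.
Let Hc : 0 <= c := d_c _ _ _ _ _ D.
Let Hcz : c < z := d_cz _ _ _ _ _ D.

Definition dL (r : R) : R :=
  - (wt n r / r ^ 2 * (ju p r * ju1 p r) * (INR n - 1 - (2 - q) * r ^ 2 * kk q p r)).

(** On a descent [L'] has the sign of [n - 1 - (2-q) r^2 k], and [r^2 k] increases; so [L] rises and
    then falls, and its values at the two ends bound it from below. At [z] the value is
    [z^(n-1) u'(z)^2], positive for a simple zero. *)
Lemma d_L_pos r : c < r < z -> 0 < jL n q p r.
Proof.
intros Hr.
assert (Hd : forall s, c < s < z -> is_derive (jL n q p) s (dL s)).
{ intros s Hs. apply is_derive_jL; trivial; [|apply (d_sol _ _ _ _ _ D); lra].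
  assert (H := d_u_pos D s ltac:(lra)); lra. }
assert (Hw : forall s, c < s < z -> 0 < wt n s / s ^ 2 * (ju p s * - ju1 p s)).
{ intros s Hs. assert (Hs' := wt_pos n s ltac:(lra)).
  assert (Hu := d_u_pos D s ltac:(lra)). assert (Hu1 := d_u1 _ _ _ _ _ D s ltac:(lra)).
  pos. }
assert (Hmono : forall s t, c < s < t -> t < z ->
  (2 - q) * s ^ 2 * kk q p s < (2 - q) * t ^ 2 * kk q p t).
{ intros s t Hs Ht. assert (Hk := d_kk_increasing D s t ltac:(lra) ltac:(lra) ltac:(lra)).
  assert (Hk0 := d_kk_pos D s ltac:(lra)).
  rewrite !Rmult_assoc; apply Rmult_lt_compat_l; [lra|].
  assert (0 < t ^ 2) by pos. assert (s ^ 2 < t ^ 2) by (simpl; nra).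
  apply Rmult_gt_0_lt_compat; trivial. }
destruct (Rle_or_lt 0 (INR n - 1 - (2 - q) * r ^ 2 * kk q p r)) as [H|H].
- apply Rle_lt_trans with (jL n q p c).
  + unfold jL; rewrite (d_u1c _ _ _ _ _ D).
    assert (Hu := d_u_pos D c ltac:(lra)).
    assert (Hf := f_pos_of_F q _ Hq Hu (Rlt_le _ _ (d_Fc D))).
    assert (0 <= wt n c) by now apply pow_le.
    replace (wt n c * (0 ^ 2 + ju p c * f q (ju p c))
      + (INR n - 1) * c ^ (n - 2) * (ju p c * 0)) with (wt n c * (ju p c * f q (ju p c))) by ring.
    apply Rmult_le_pos; trivial. left; pos.
  + apply (increasing_closed (jL n q p) dL).
    * lra.
    * apply jL_continuous; [lra|]; apply (d_continuous_right D); lra.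
    * apply jL_continuous; [lra|]; apply (d_continuous_u_left D); lra.
    * intros s Hs; apply Hd; lra.
    * intros s Hs. assert (H1 := Hmono s r ltac:(lra) ltac:(lra)).
      assert (H2 := Hw s ltac:(lra)). unfold dL.
      replace (- (wt n s / s ^ 2 * (ju p s * ju1 p s) * (INR n - 1 - (2 - q) * s ^ 2 * kk q p s)))
        with (wt n s / s ^ 2 * (ju p s * - ju1 p s) * (INR n - 1 - (2 - q) * s ^ 2 * kk q p s))
        by ring.
      apply Rmult_lt_0_compat; lra.
- apply Rlt_le_trans with (jL n q p z).
  + unfold jL; rewrite (d_uz _ _ _ _ _ D).
    replace (wt n z * (ju1 p z ^ 2 + 0 * f q 0) + (INR n - 1) * z ^ (n - 2) * (0 * ju1 p z))
      with (wt n z * ju1 p z ^ 2) by ring.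
    assert (0 < wt n z) by (apply wt_pos; lra).
    assert (0 < ju1 p z ^ 2) by now apply pow2_gt_0. pos.
  + cut (- jL n q p r <= - jL n q p z); [lra|].
    apply (nondecreasing_closed (fun s => - jL n q p s) (fun s => - dL s)).
    * lra.
    * apply continuous_along_opp; [apply _|];
        apply jL_continuous; [lra|]; apply (d_continuous_right D); lra.
    * apply continuous_along_opp; [apply _|];
        apply jL_continuous; [lra|]; apply (d_continuous_u_left D); lra.
    * intros s Hs; apply (is_derive_opp (jL n q p)), Hd; lra.
    * intros s Hs. assert (H1 := Hmono r s ltac:(lra) ltac:(lra)).
      assert (H2 := Hw s ltac:(lra)). unfold dL.
      replace (- - (wt n s / s ^ 2 * (ju p s * ju1 p s) * (INR n - 1 - (2 - q) * s ^ 2 * kk q p s)))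
        with (wt n s / s ^ 2 * (ju p s * - ju1 p s) * - (INR n - 1 - (2 - q) * s ^ 2 * kk q p s))
        by ring.
      apply Rmult_le_pos; lra.
Qed.

Definition al (r : R) : R := amplitude q (jE q p r).
Definition kl (r : R) : R := powabs (al r) (q - 2).
(** The level follows the energy. At [c] it is [u (c)], so [Y (c) = T_2 (c) >= 0]; afterwards it
    decreases with the energy and so does [g_2] of it, which is the source of the positive second
    term of [dY]. *)
Definition jY (r : R) : R := jQ n q p r - g2 q (al r) * jM n p r.
Definition dY (r : R) : R :=
  wt n r * ju p r * jv p r * (2 - q * kk q p r / kl r)
  + q * (INR n - 1) * ju1 p r ^ 2 / (kl r * al r ^ 2 * r * (1 - kl r)) * jM n p r.

Lemma d_E_pos r : c <= r < z -> 0 < jE q p r.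
Proof.
intros Hr. destruct (Req_dec r c) as [->|]; [|apply (d_E _ _ _ _ _ D); lra].
unfold jE; rewrite (d_u1c _ _ _ _ _ D). assert (H := d_Fc D). lra.
Qed.

Lemma al_spec r : c <= r < z -> 0 < al r /\ F q (al r) = jE q p r.
Proof. intros Hr; apply amplitude_spec; trivial. now apply d_E_pos. Qed.

Lemma kl_bounds r : c <= r < z -> 0 < kl r < q / 2.
Proof.
intros Hr. destruct (al_spec r Hr) as [Ha EF].
split; [apply powabs_pos; lra|]. apply F_pos_iff; [lra|lra|].
rewrite EF; now apply d_E_pos.
Qed.

Lemma al_c : al c = ju p c.
Proof.
unfold al, jE; rewrite (d_u1c _ _ _ _ _ D).
replace (0 ^ 2 / 2 + F q (ju p c)) with (F q (ju p c)) by field.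
apply amplitude_F; trivial; [|exact (d_Fc D)]. apply (d_u_pos D); lra.
Qed.

Lemma al_gt_u r : c < r < z -> ju p r < al r.
Proof.
intros Hr. apply amplitude_lt; trivial; [now apply (d_u _ _ _ _ _ D)|now apply (d_E _ _ _ _ _ D)|].
unfold jE. assert (H := d_u1 _ _ _ _ _ D r Hr). assert (0 < ju1 p r ^ 2) by nra. lra.
Qed.

Lemma continuous_al G r : c <= r < z -> jet_continuous_u G p r -> continuous_along G al r.
Proof.
intros Hr H. apply (continuous_along_comp G (jc_filter _ _ _ H) (jE q p) (amplitude q)).
- apply jE_continuous; trivial; lra.
- apply continuous_amplitude; trivial. now apply d_E_pos.
Qed.

Lemma jY_continuous G r : c <= r < z -> jet_continuous G p r -> continuous_along G jY r.
Proof.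
intros Hr H. assert (HG := jc_filter _ _ _ (jc_uu _ _ _ H)).
assert (HQ := jQ_continuous G n q p r (proj1 Hq) H).
assert (HM := jM_continuous G n p r H).
assert (Hg : continuous_along G (fun s => g2 q (al s)) r).
{ apply (continuous_along_comp G HG al (g2 q)).
  - apply continuous_al; trivial. apply H.
  - eapply is_derive_continuous, is_derive_g2; [lra|].
    destruct (al_spec r Hr); lra. }
unfold jY. continuous_along_tac.
Qed.

Lemma is_derive_jY r : c < r < z -> is_derive jY r (dY r).
Proof.
intros Hr. assert (Hs := d_sol _ _ _ _ _ D r Hr).
assert (Hu := d_u_pos D r ltac:(lra)).
destruct (al_spec r ltac:(lra)) as [Ha EF].
assert (Hkl := kl_bounds r ltac:(lra)).
assert (DQ := is_derive_jQ n q p r Hn ltac:(lra) Hs).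
assert (DM := is_derive_jM n q p r Hn ltac:(lra) Hs).
assert (DE := is_derive_jE n q p r ltac:(lra) (s_u _ _ _ _ Hs)).
assert (DA := is_derive_amplitude q _ Hq (d_E_pos r ltac:(lra))).
fold (al r) in DA.
assert (DL : is_derive al r ((- (INR n - 1) / r * ju1 p r ^ 2) * (/ f q (al r)))).
{ exact (is_derive_comp (amplitude q) (jE q p) r _ _ DA DE). }
clear DA DE.
assert (Dg := is_derive_g2 q (al r) ltac:(lra) ltac:(lra)).
unfold jY. revert DL Dg.
assert (E : g2 q (al r) = (q / kl r - 2) / (2 - q)) by (apply g2_eq; lra).
intros DL Dg. fold (kl r) in Dg.
set (a := al) in *. derive_by_rules.
rewrite E. unfold dY. fold a.
assert (Hf : f q (a r) = a r * (1 - kl r)) by (unfold f, kl; fold a; ring).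
rewrite Hf. unfold f at 1. fold (kk q p r).
field. repeat split; try lra.
Qed.

(* The only place where log-concavity of [u] is needed: it bounds [jA] from below
   by [(INR n - 1)^-1 r^n (u'^2 + u f)]. *)
Lemma d_dY_pos tau r : first_v_zero q p c z tau -> c < r <= tau -> jY r = 0 -> 0 < dY r.
Proof.
intros H Hr EY.
assert (HM := d_M_pos D tau H r Hr). destruct H as (Ht & Ev & Hkt & Hvpos).
assert (Hr' : c < r < z) by lra.
assert (Hv : 0 <= jv p r).
{ destruct (Req_dec r tau) as [->|]; [lra|]. left; apply Hvpos; lra. }
assert (HN := INR_ge2 n Hn).
assert (Hu := d_u_pos D r ltac:(lra)). assert (Hu1 := d_u1 _ _ _ _ _ D r Hr').
destruct (al_spec r ltac:(lra)) as [Ha EF].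
assert (Hkl := kl_bounds r ltac:(lra)).
assert (Hk1 : kk q p r <= 1).
{ left. apply Rle_lt_trans with (kk q p tau); trivial.
  destruct (Req_dec r tau) as [->|]; [lra|]. left; apply (d_kk_increasing D); lra. }
assert (Hk := d_kk_pos D r ltac:(lra)).
assert (Hw := wt_pos n r ltac:(lra)).
assert (Hau := al_gt_u r Hr').
assert (HL := d_L_pos r Hr').
assert (HB := power_bernoulli q (ju p r) (al r) Hq ltac:(lra)).
fold (kk q p r) (kl r) in HB.
assert (EP : ju1 p r ^ 2 = al r ^ 2 * (1 - 2 * kl r / q) - ju p r ^ 2 * (1 - 2 * kk q p r / q)).
{ unfold jE in EF. rewrite !F_eq in EF by lra. fold (kk q p r) (kl r) in EF.
  replace (al r ^ 2 * (1 - 2 * kl r / q)) with (2 * (al r ^ 2 / 2 - kl r * al r ^ 2 / q))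
    by (field; lra).
  rewrite EF. field; lra. }
assert (HP : 0 < ju1 p r ^ 2) by nra.
set (Cs := q * (INR n - 1) * jM n p r / (kl r * al r ^ 2 * r)).
assert (HC : 0 < Cs) by (unfold Cs; pos).
assert (EdY : dY r = wt n r * ju p r * jv p r * (2 - q * kk q p r / kl r)
  + Cs * ju1 p r ^ 2 / (1 - kl r)).
{ unfold dY, Cs. field. repeat split; lra. }
rewrite EdY.
assert (H2nd : 0 < Cs * ju1 p r ^ 2 / (1 - kl r)) by pos.
assert (Hwuv : 0 <= wt n r * ju p r * jv p r).
{ apply Rmult_le_pos; trivial. left; pos. }
(* In the first case no term of [dY] is negative. In the second the term with [v] is unfavourable,
   and [v] must be bounded from above. *)
destruct (Rle_or_lt (q * kk q p r) (2 * kl r)) as [Hcase|Hcase].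
- assert (0 <= 2 - q * kk q p r / kl r).
  { assert (q * kk q p r / kl r <= 2); [|lra]. apply Rle_div_l; lra. }
  assert (0 <= wt n r * ju p r * jv p r * (2 - q * kk q p r / kl r)) by now apply Rmult_le_pos.
  lra.
- assert (Hbar := barrier_inequality q (kk q p r) (kl r) (ju p r) (al r) (ju1 p r ^ 2)
    Hq ltac:(lra) Hk1 Hcase ltac:(lra) Hu EP HB).
  set (X := q * kk q p r / kl r - 2) in *.
  assert (HX : 0 < X).
  { unfold X. assert (2 < q * kk q p r / kl r); [|lra]. apply Rlt_div_r; lra. }
  set (Lam := (q / kl r - 2) / (2 - q)).
  assert (HLam : 0 < Lam).
  { unfold Lam. apply Rdiv_lt_0_compat; [|lra].
    assert (2 < q / kl r); [|lra]. apply Rlt_div_r; lra. }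
  (* The assumption [Y = 0] ties [Q] to [M]; since [u' < 0], [jA_v] then gives [v A <= u Lam M], the
     required bound on [v] once [A] is bounded from below. *)
  assert (EQ : jQ n q p r = Lam * jM n p r).
  { unfold jY in EY. rewrite g2_eq in EY by lra. fold (kl r) in EY. fold Lam in EY. lra. }
  (* [wt v (2 - q) <= Cs u] *)
  assert (Hwv : wt n r * jv p r * (2 - q) <= Cs * ju p r).
  { assert (EA := jA_v n q p r). rewrite EQ in EA.
    assert (H1 : jv p r * jA n q p r <= ju p r * (Lam * jM n p r)).
    { rewrite EA. assert (0 < r * - ju1 p r * jM n p r) by pos. lra. }
    (* The term in [L] is dropped, and [u'^2 + u f (u) >= u'^2 + 2 F (u) = 2 F (a)]; the left-hand
       factor is [2 F (a)] written with [Lam]. *)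
    assert (HA : r * wt n r * (al r ^ 2 * kl r * (2 - q) * Lam / q) <= (INR n - 1) * jA n q p r).
    { rewrite jA_jL by trivial.
      assert (0 <= (INR n - 2) * (r * jL n q p r)).
      { apply Rmult_le_pos; [lra|]. left; pos. }
      assert (al r ^ 2 * kl r * (2 - q) * Lam / q <= ju1 p r ^ 2 + ju p r * f q (ju p r)).
      { rewrite EP. unfold f; fold (kk q p r). unfold Lam.
        replace (al r ^ 2 * kl r * (2 - q) * ((q / kl r - 2) / (2 - q)) / q)
          with (al r ^ 2 * (1 - 2 * kl r / q)) by (field; repeat split; lra).
        assert (0 <= ju p r ^ 2 * kk q p r * (2 / q - 1)).
        { apply Rmult_le_pos; [left; pos|].
          assert (1 <= 2 / q); [|lra]. apply Rle_div_r; lra. }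
        replace (ju p r * (ju p r - kk q p r * ju p r)) with
          (ju p r ^ 2 * (1 - 2 * kk q p r / q) + ju p r ^ 2 * kk q p r * (2 / q - 1))
          by (field; lra). lra. }
      assert (r * wt n r * (al r ^ 2 * kl r * (2 - q) * Lam / q)
        <= r * wt n r * (ju1 p r ^ 2 + ju p r * f q (ju p r))).
      { apply Rmult_le_compat_l; trivial. left; pos. }
      lra. }
    apply (Rmult_le_compat_l _ _ _ Hv) in HA.
    apply (Rmult_le_compat_l (INR n - 1)) in H1; [|lra].
    set (K := r * al r ^ 2 * kl r * Lam / q).
    assert (HK : 0 < K) by (unfold K; pos).
    apply (Rmult_le_reg_l K); trivial.
    replace (K * (wt n r * jv p r * (2 - q)))
      with (jv p r * (r * wt n r * (al r ^ 2 * kl r * (2 - q) * Lam / q)))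
      by (unfold K; field; lra).
    replace (K * (Cs * ju p r)) with ((INR n - 1) * (ju p r * (Lam * jM n p r)))
      by (unfold K, Cs; field; repeat split; lra).
    lra. }
  replace (2 - q * kk q p r / kl r) with (- X) by (unfold X; ring).
  apply (pos_factor ((2 - q) * (1 - kl r))); [pos|].
  replace ((2 - q) * (1 - kl r) *
    (wt n r * ju p r * jv p r * - X + Cs * ju1 p r ^ 2 / (1 - kl r)))
    with (Cs * (ju1 p r ^ 2 * (2 - q))
          - (wt n r * jv p r * (2 - q)) * (ju p r * X * (1 - kl r))) by (field; lra).
  assert (HuX : 0 < ju p r * X * (1 - kl r)) by pos.
  apply (Rmult_le_compat_r _ _ _ (Rlt_le _ _ HuX)) in Hwv.
  apply (Rmult_lt_compat_l Cs _ _ HC) in Hbar.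
  replace (Cs * ju p r * (ju p r * X * (1 - kl r)))
    with (Cs * ((1 - kl r) * ju p r ^ 2 * X)) in Hwv by ring. lra.
Qed.

(** [Y (c)] may be zero, so positivity has to come from [Y']. Near [c] the level is close to [u],
    whence [q k < 2 l] and both terms of [dY] are positive. *)
Lemma d_Y_near tau : first_v_zero q p c z tau -> at_right c (fun r => 0 < jY r).
Proof.
intros H. assert (HM := d_M_pos D tau H).
destruct H as (Ht & Ev & Hkt & Hvpos).
assert (HJ := d_continuous_right D c ltac:(lra)).
assert (Hnear : at_right c (fun r => 0 < 2 * kl r - q * kk q p r)).
{ apply (continuous_along_pos _ _ (fun r => 2 * kl r - q * kk q p r) c).
  - assert (C1 : continuous_along (at_right c) kl c).
    { apply (continuous_along_comp _ _ al (fun x => powabs x (q - 2))).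
      - apply continuous_al; [lra|apply HJ].
      - eapply is_derive_continuous, is_derive_powabs. destruct (al_spec c ltac:(lra)); lra. }
    assert (C2 : continuous_along (at_right c) (kk q p) c).
    { apply (continuous_along_comp _ _ (ju p) (fun x => powabs x (q - 2))).
      - apply HJ.
      - eapply is_derive_continuous, is_derive_powabs.
        assert (Hu := d_u_pos D c ltac:(lra)); lra. }
    assert (HG : Filter (at_right c)) by apply _.
    continuous_along_tac.
  - unfold kl; rewrite al_c. fold (kk q p c). assert (Hk := d_kk_pos D c ltac:(lra)). nra. }
destruct (at_right_ex _ _ Hnear) as [d [Hd Hr]].
apply (ex_at_right c _ (Rmin d (tau - c))); [apply Rmin_pos; lra|].
intros r Hr'. assert (M1 := Rmin_l d (tau - c)). assert (M2 := Rmin_r d (tau - c)).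
apply Rle_lt_trans with (jY c).
- unfold jY; rewrite al_c. exact (d_Tc _ _ _ _ _ D).
- apply (increasing_closed jY dY); [lra| | | |].
  + apply jY_continuous; trivial; lra.
  + apply jY_continuous; [lra|]. apply (d_continuous_left D); lra.
  + intros s Hs; apply is_derive_jY; lra.
  + intros s Hs. assert (H1 := Hr s ltac:(lra)).
    assert (HMs := HM s ltac:(lra)).
    assert (Hv := Hvpos s ltac:(lra)). assert (HN := INR_ge2 n Hn).
    assert (Hu := d_u_pos D s ltac:(lra)). assert (Hu1 := d_u1 _ _ _ _ _ D s ltac:(lra)).
    assert (Hkl := kl_bounds s ltac:(lra)). destruct (al_spec s ltac:(lra)) as [Ha _].
    assert (Hw := wt_pos n s ltac:(lra)).
    assert (0 < 2 - q * kk q p s / kl s).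
    { assert (q * kk q p s / kl s < 2); [|lra]. apply Rlt_div_l; lra. }
    assert (0 < ju1 p s ^ 2) by nra.
    unfold dY. apply Rplus_lt_0_compat; pos.
Qed.

(** [F (b) < E (tau)] puts [b] below the amplitude at [tau]; as [g_2] is increasing and [M > 0],
    [Y (tau) >= 0] gives the strict inequality for [b]. *)
Lemma d_barrier tau b : first_v_zero q p c z tau -> 0 < b -> F q b < jE q p tau ->
  0 < jQ n q p tau - g2 q b * jM n p tau.
Proof.
intros H Hb HF. assert (HM := d_M_pos D tau H).
assert (Hnear := d_Y_near tau H). assert (HdY := fun r => d_dY_pos tau r H).
destruct H as (Ht & Ev & Hkt & Hvpos).
assert (HY : forall r, c < r < tau -> 0 < jY r).
{ apply (positive_barrier jY dY); trivial.
  - intros r Hr. apply (is_derive_continuous _ _ (dY r)), is_derive_jY; lra.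
  - intros r Hr _ E; split; [apply is_derive_jY; lra|apply HdY; trivial; lra]. }
assert (HYt : 0 <= jY tau).
{ apply (left_limit_ge jY c tau); [lra| |].
  - apply jY_continuous; [lra|]. apply (d_continuous_left D); lra.
  - intros r Hr; left; now apply HY. }
assert (HMt := HM tau ltac:(lra)).
destruct (al_spec tau ltac:(lra)) as [Ha EF].
assert (Hba : b < al tau) by (apply amplitude_lt; trivial; apply d_E_pos; lra).
assert (Hg : g2 q b < g2 q (al tau)).
{ rewrite !g2_eq by lra. assert (Hk := powabs_decr q b (al tau) ltac:(lra) ltac:(lra)).
  assert (Hk0 := powabs_pos (al tau) (q - 2) ltac:(lra)).
  apply Rmult_lt_compat_r; [pos|].
  assert (q / powabs b (q - 2) < q / powabs (al tau) (q - 2)); [|lra].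
  apply Rmult_lt_compat_l; [lra|]. apply Rinv_lt_contravar; trivial. pos. }
unfold jY in HYt. nra.
Qed.

End Barrier.

(** * Transport of [Q - g2 (b) M] across the levels [|u| <= b] *)

Lemma powabs_lt_inv q x y : q < 2 -> 0 < x -> 0 < y ->
  powabs y (q - 2) < powabs x (q - 2) -> x < y.
Proof.
intros Hq Hx Hy H. apply Rnot_le_lt; intros [Hle|E].
- assert (H1 := powabs_decr q y x Hq ltac:(lra)); lra.
- rewrite E in H; lra.
Qed.

(** Antiderivative, vanishing at [0], of [x (2 - q |x|^(q-2) / |b|^(q-2))]. It is written with [F]
    so that it is continuous across the zeros of [u]. *)
Definition weight_int (q b x : R) : R :=
  x ^ 2 - q * (x ^ 2 / 2 - F q x) / powabs b (q - 2).

Lemma weight_int_eq q b x : 0 < q -> b <> 0 -> x <> 0 ->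
  weight_int q b x = x ^ 2 * (1 - powabs x (q - 2) / powabs b (q - 2)).
Proof.
intros Hq Hb Hx; unfold weight_int. rewrite F_eq by lra.
assert (Hk := powabs_pos b (q - 2) Hb). field; lra.
Qed.

Lemma weight_int_0 q b : weight_int q b 0 = 0.
Proof. unfold weight_int; rewrite F_0. unfold Rdiv; ring. Qed.

Lemma weight_int_self q b : 0 < q -> b <> 0 -> weight_int q b b = 0.
Proof.
intros Hq Hb; rewrite weight_int_eq by trivial.
assert (Hk := powabs_pos b (q - 2) Hb). field; lra.
Qed.

(* Subtracting a multiple of [weight_int], which vanishes at [0] and at [b], is
   Chebyshev's integral inequality for the monotone function [wt * jth]. *)
Definition jPhi (n : nat) (q : R) (p : jet) (b m r : R) : R :=
  jQ n q p r - g2 q b * jM n p r - m * weight_int q b (ju p r).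

Lemma is_derive_jPhi n q p b m r : (2 <= n)%nat -> 1 < q < 2 -> b <> 0 ->
  ju p r <> 0 -> ju1 p r <> 0 -> solves n q p r ->
  is_derive (jPhi n q p b m) r
    (ju p r * ju1 p r * ((2 - q * kk q p r / powabs b (q - 2)) * (wt n r * jth p r - m))).
Proof.
intros Hn Hq Hb H0 H1 S. assert (Hu := su_u _ _ _ _ (s_u _ _ _ _ S)).
assert (DQ := is_derive_jQ n q p r Hn H0 S).
assert (DM := is_derive_jM n q p r Hn H0 S).
assert (DF := is_derive_F q (ju p r) ltac:(lra)).
assert (Hk := powabs_pos b (q - 2) Hb).
unfold jPhi, weight_int. rewrite (g2_eq q b Hb).
set (kb := powabs b (q - 2)) in *. clearbody kb.
derive_by_rules.
unfold f; fold (kk q p r). unfold jth. field. repeat split; lra.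
Qed.

Lemma jPhi_continuous G n q p b m c : 1 < q < 2 -> jet_continuous G p c ->
  continuous_along G (jPhi n q p b m) c.
Proof.
intros Hq H. assert (HG := jc_filter _ _ _ (jc_uu _ _ _ H)).
assert (Hu := jc_u _ _ _ (jc_uu _ _ _ H)).
assert (HQ := jQ_continuous G n q p c (proj1 Hq) H).
assert (HM := jM_continuous G n p c H).
assert (HF := continuous_along_F G HG q _ c (proj1 Hq) Hu).
unfold jPhi, weight_int, Rdiv. continuous_along_tac.
Qed.

Lemma wth_nondecreasing n q p s t : (2 <= n)%nat -> s <= t ->
  (forall r, s <= r <= t -> solves n q p r /\ ju1 p r <> 0 /\ 0 <= jJ n q p r /\ 0 <= jth p r) ->
  wt n s * jth p s <= wt n t * jth p t.
Proof.
intros Hn Hst H. assert (HN := INR_ge2 n Hn).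
apply (derive_nonneg_le (fun r => wt n r * jth p r)
  (fun r => (INR n - 1) / r * wt n r * jth p r + wt n r * (jJ n q p r / ju1 p r ^ 2))); trivial.
- intros r Hr. destruct (H r Hr) as (S & H1 & _ & _).
  assert (Hr0 := su_pos _ _ _ _ (s_u _ _ _ _ S)).
  assert (Dt := is_derive_jth n q p r H1 S). assert (Dw := is_derive_wt n r Hn Hr0).
  revert Dt; generalize (jth p); intros th Dt.
  derive_by_rules. ring.
- intros r Hr. destruct (H r Hr) as (S & H1 & HJ & Ht).
  assert (Hr0 := su_pos _ _ _ _ (s_u _ _ _ _ S)). assert (Hw := wt_pos n r Hr0).
  assert (0 < ju1 p r ^ 2) by now apply pow2_gt_0.
  apply Rplus_le_le_0_compat.
  + apply Rmult_le_pos; trivial. left; pos.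
  + apply Rmult_le_pos; [lra|]. now apply Rdiv_le_0_compat.
Qed.

(** The inequality starts at a point [r0] where the weight integral is not positive, and [jPhi] with
    a suitable [m >= 0] does not decrease from there to [z], where the weight integral vanishes. *)
Lemma descent_transport n q p c z tau b : descent n q p c z ->
  ju1 p z <> 0 -> jet_continuous (at_left z) p z -> first_v_zero q p c z tau ->
  0 < b -> 0 < F q b -> (forall r, c < r < z -> F q b < jE q p r) ->
  0 < jQ n q p z - g2 q b * jM n p z.
Proof.
intros D Hz1 Hzc Htau Hb HFb HE.
assert (Hn := d_n _ _ _ _ _ D). assert (Hq := d_q _ _ _ _ _ D).
assert (Hbar := d_barrier D Hz1 tau b Htau Hb).
destruct (descent_variation D tau Htau) as (HvJ & HT & _).
destruct Htau as (Ht & Ev & Hkt & Hvpos).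
assert (Hkb0 := powabs_pos b (q - 2) ltac:(lra)).
assert (Hkb : powabs b (q - 2) < q / 2) by (apply F_pos_iff; lra).
set (kb := powabs b (q - 2)) in *.
assert (Hc0 := d_c _ _ _ _ _ D).
assert (Hth : forall r, tau < r < z -> 0 < jth p r).
{ intros r Hr; apply (d_th_pos D); [lra|now apply HvJ]. }
assert (Hwth : forall s t, tau < s -> s <= t -> t < z ->
  wt n s * jth p s <= wt n t * jth p t).
{ intros s t Hs Hst Htz. apply (wth_nondecreasing n q); trivial.
  intros r Hr. assert (H := d_u1 _ _ _ _ _ D r ltac:(lra)).
  split; [apply (d_sol _ _ _ _ _ D); lra|]. split; [lra|].
  split; left; [apply HvJ|apply Hth]; lra. }
(* If [u (tau) > b], then [r0] is the point where [u = b], and the quantity there is [T_2].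
   Otherwise [r0 = tau], and positivity comes from the energy barrier. *)
assert (Hr0 : exists r0, tau <= r0 < z /\ 0 < jQ n q p r0 - g2 q b * jM n p r0 /\
  weight_int q b (ju p r0) <= 0).
{ destruct (Rlt_or_le b (ju p tau)) as [Hlt|Hle].
  - destruct (IVT_decreasing (ju p) tau z b) as [r0 [Hr0 E]]; try lra.
    + apply (d_continuous_right D); lra.
    + apply (d_continuous_u_left D); lra.
    + intros r Hr; apply (solves_continuous n q), (d_sol _ _ _ _ _ D); lra.
    + rewrite (d_uz _ _ _ _ _ D); lra.
    + exists r0; repeat split; try lra.
      * assert (H := HT r0 ltac:(lra)). unfold jT in H. rewrite E in H. apply H.
        unfold kk; rewrite E; fold kb; lra.
      * rewrite E, weight_int_self; lra.
  - exists tau; repeat split; try lra.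
    + apply Hbar, HE; lra.
    + assert (Hu := d_u_pos D tau ltac:(lra)).
      rewrite weight_int_eq by lra. fold kb (kk q p tau).
      assert (kb <= kk q p tau).
      { destruct Hle as [Hle|E].
        - left; apply powabs_decr; lra.
        - unfold kk; rewrite E; unfold kb; lra. }
      assert (1 <= kk q p tau / kb) by (apply Rle_div_r; lra).
      assert (0 <= ju p tau ^ 2 * (kk q p tau / kb - 1)).
      { apply Rmult_le_pos; [left; pos|lra]. }
      lra. }
destruct Hr0 as (r0 & Hr0 & HH & HW).
(* [m] is the value of [r^(n-1) theta] where [2 - q k / kb] changes sign, or [0] if that factor is
   already nonpositive from [r0] on. *)
assert (Hm : exists m, 0 <= m /\ forall r, r0 < r < z ->
  (2 - q * kk q p r / kb) * (wt n r * jth p r - m) <= 0).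
{ assert (Hw : forall r, r0 < r < z -> 0 < wt n r * jth p r).
  { intros r Hr. assert (H1 := wt_pos n r ltac:(lra)). assert (H2 := Hth r ltac:(lra)). pos. }
  assert (Hle : forall r, q * kk q p r <= 2 * kb -> 0 <= 2 - q * kk q p r / kb).
  { intros r Hr. assert (q * kk q p r / kb <= 2); [|lra]. apply Rle_div_l; lra. }
  assert (Hge : forall r, 2 * kb <= q * kk q p r -> 2 - q * kk q p r / kb <= 0).
  { intros r Hr. assert (2 <= q * kk q p r / kb); [|lra]. apply Rle_div_r; lra. }
  destruct (Rlt_or_le (kk q p r0) (2 * kb / q)) as [Hlt|Hle0].
  - destruct (d_kk_level D (2 * kb / q) r0) as [rs [Hrs Es]]; try lra; [pos|].
    exists (wt n rs * jth p rs). split; [left; apply Hw; lra|].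
    assert (Eq : q * kk q p rs = 2 * kb) by (rewrite Es; field; lra).
    intros r Hr. destruct (Rle_or_lt r rs) as [H|H].
    + assert (wt n r * jth p r <= wt n rs * jth p rs) by (apply Hwth; lra).
      assert (kk q p r <= kk q p rs).
      { destruct (Req_dec r rs) as [->|]; [lra|]. left; apply (d_kk_increasing D); lra. }
      assert (0 <= 2 - q * kk q p r / kb) by (apply Hle; nra). nra.
    + assert (wt n rs * jth p rs <= wt n r * jth p r) by (apply Hwth; lra).
      assert (kk q p rs < kk q p r) by (apply (d_kk_increasing D); lra).
      assert (2 - q * kk q p r / kb <= 0) by (apply Hge; nra). nra.
  - exists 0. split; [lra|]. intros r Hr.
    assert (H := Hw r Hr).
    assert (kk q p r0 < kk q p r) by (apply (d_kk_increasing D); lra).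
    assert (Hq2 : 2 * kb <= q * kk q p r0).
    { apply Rle_div_l in Hle0; lra. }
    assert (2 - q * kk q p r / kb <= 0) by (apply Hge; nra). nra. }
destruct Hm as (m & Hm0 & Hm).
assert (HPhi : jPhi n q p b m r0 <= jPhi n q p b m z).
{ apply (nondecreasing_closed (jPhi n q p b m) (fun r =>
    ju p r * ju1 p r * ((2 - q * kk q p r / kb) * (wt n r * jth p r - m)))).
  - lra.
  - apply jPhi_continuous; trivial. apply (d_continuous_right D); lra.
  - apply jPhi_continuous; trivial.
  - intros r Hr. assert (Hu := d_u_pos D r ltac:(lra)).
    assert (Hu1 := d_u1 _ _ _ _ _ D r ltac:(lra)).
    apply is_derive_jPhi; trivial; try lra. apply (d_sol _ _ _ _ _ D); lra.
  - intros r Hr. assert (Hu := d_u_pos D r ltac:(lra)).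
    assert (Hu1 := d_u1 _ _ _ _ _ D r ltac:(lra)). assert (H := Hm r Hr).
    assert (0 < ju p r * - ju1 p r) by pos. nra. }
unfold jPhi in HPhi. rewrite (d_uz _ _ _ _ _ D), weight_int_0 in HPhi. nra.
Qed.

(** * From a zero to the next critical point *)

Record ascent (n : nat) (q : R) (p : jet) (z d : R) : Prop := {
  a_n : (2 <= n)%nat;
  a_q : 1 < q < 2;
  a_z : 0 < z;
  a_zd : z < d;
  a_sol : forall r, z < r <= d -> solves n q p r;
  a_u : forall r, z < r <= d -> 0 < ju p r;
  a_u1 : forall r, z < r < d -> 0 < ju1 p r;
  a_E : forall r, z < r <= d -> 0 < jE q p r;
  a_right : jet_continuous (at_right z) p z;
  a_uz : ju p z = 0;
  a_u1z : 0 < ju1 p z;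
  a_u1d : ju1 p d = 0;
  a_vz : 0 < jv p z;
  a_X : 0 < jX n q p z;
  a_H : 0 < jQ n q p z - g2 q (ju p d) * jM n p z
}.

Section Ascent.
Context {n : nat} {q : R} {p : jet} {z d : R} (A : ascent n q p z d).

Let Hn : (2 <= n)%nat := a_n _ _ _ _ _ A.
Let Hq : 1 < q < 2 := a_q _ _ _ _ _ A.
Let Hz : 0 < z := a_z _ _ _ _ _ A.
Let Hzd : z < d := a_zd _ _ _ _ _ A.

Lemma a_continuous_right s : z <= s <= d -> jet_continuous (at_right s) p s.
Proof.
intros Hs; destruct (Req_dec s z) as [->|H]; [exact (a_right _ _ _ _ _ A)|].
apply jet_continuous_right, (solves_continuous n q), (a_sol _ _ _ _ _ A); lra.
Qed.

Lemma a_continuous s : z < s <= d -> jet_continuous (locally s) p s.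
Proof. intros Hs; apply (solves_continuous n q), (a_sol _ _ _ _ _ A); lra. Qed.

Lemma a_continuous_left s : z < s <= d -> jet_continuous (at_left s) p s.
Proof. intros Hs; apply jet_continuous_left, a_continuous; lra. Qed.

Lemma a_u_increasing s t : z <= s -> s < t -> t <= d -> ju p s < ju p t.
Proof.
intros Hs Hst Ht. apply (increasing_closed (ju p) (ju1 p)); trivial.
- apply a_continuous_right; lra.
- apply a_continuous_left; lra.
- intros r Hr. apply (s_u _ _ _ _ (a_sol _ _ _ _ _ A r ltac:(lra))).
- intros r Hr; apply (a_u1 _ _ _ _ _ A); lra.
Qed.

Lemma a_level b : 0 < b < ju p d -> exists s, z < s < d /\ ju p s = b.
Proof.
intros Hb. destruct (IVT_decreasing (fun r => - ju p r) z d (- b)) as [s [Hs E]]; try lra.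
- apply continuous_along_opp; [apply _|]; apply a_continuous_right; lra.
- apply continuous_along_opp; [apply _|]; apply a_continuous_left; lra.
- intros r Hr; apply (continuous_along_opp (locally r)); [apply _|].
  apply (a_continuous r ltac:(lra)).
- rewrite (a_uz _ _ _ _ _ A); lra.
- exists s; lra.
Qed.

Lemma a_Fd : 0 < F q (ju p d).
Proof.
assert (H := a_E _ _ _ _ _ A d ltac:(lra)). unfold jE in H.
rewrite (a_u1d _ _ _ _ _ A) in H. lra.
Qed.

Lemma a_th_v r : z < r < d -> jv p r = jth p r * ju1 p r.
Proof. intros Hr; unfold jth. assert (H := a_u1 _ _ _ _ _ A r Hr). field; lra. Qed.

(** Up to the level [F (u) = 0] the pair [X], [theta] is propagated; at that level [X = Q], which
    starts the argument with [Q] beyond it. *)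
Lemma a_inner : exists s, z < s < d /\ F q (ju p s) = 0 /\ 0 < jQ n q p s /\ 0 < jth p s /\
  (forall r, z < r <= s -> 0 < jth p r /\ 0 < jJ n q p r).
Proof.
destruct (powabs_level q (q / 2) ltac:(lra) ltac:(lra)) as [l [Hl El]].
assert (HFl : F q l = 0) by (apply F_half; lra).
assert (Hld : l < ju p d).
{ apply (F_lt_inv q); trivial; [apply (a_u _ _ _ _ _ A); lra|left; exact a_Fd|].
  rewrite HFl; exact a_Fd. }
destruct (a_level l ltac:(lra)) as [s [Hs Es]].
assert (Hu : forall r, z < r < s ->
  ju p r <> 0 /\ ju1 p r <> 0 /\ F q (ju p r) < 0 /\ 0 < jE q p r).
{ intros r Hr. assert (U := a_u _ _ _ _ _ A r ltac:(lra)).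
  assert (U1 := a_u1 _ _ _ _ _ A r ltac:(lra)). repeat split; try lra.
  - apply Rnot_le_lt; intros HF.
    assert (ju p r < ju p s) by (apply a_u_increasing; lra).
    assert (HFF := F_increasing q (ju p r) (ju p s) Hq U ltac:(lra) HF).
    rewrite Es, HFl in HFF; lra.
  - apply (a_E _ _ _ _ _ A); lra. }
assert (Hsol : forall r, z < r < s -> solves n q p r) by (intros; apply (a_sol _ _ _ _ _ A); lra).
assert (HXc : forall r, z < r < d -> continuous (jX n q p) r).
{ intros r Hr. apply (jX_continuous (locally r)); [lra|lra| |apply a_continuous; lra].
  assert (U1 := a_u1 _ _ _ _ _ A r ltac:(lra)); lra. }
assert (HXt : forall r, z < r < s -> 0 < jX n q p r /\ 0 < jth p r).
{ apply X_cooperative; trivial; [lra|].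
  assert (Hr := a_right _ _ _ _ _ A). assert (U1 := a_u1z _ _ _ _ _ A).
  apply filter_and.
  - apply (continuous_along_pos _ _ (jX n q p) z); [|exact (a_X _ _ _ _ _ A)].
    apply jX_continuous; trivial; lra.
  - apply (continuous_along_pos _ _ (jth p) z).
    + apply continuous_along_div; [apply _|apply Hr|apply Hr|lra].
    + unfold jth. assert (V := a_vz _ _ _ _ _ A). pos. }
set (m := (z + s) / 2).
assert (HXs : 0 < jX n q p s).
{ apply Rlt_le_trans with (jX n q p m); [apply HXt; unfold m; lra|].
  apply X_nondecreasing; trivial; unfold m in *; try lra;
    try (intros; first [apply Hsol | apply Hu | apply HXt]; lra).
  - apply continuous_right, HXc; lra.
  - apply continuous_left, HXc; lra. }
assert (Hdt : forall r, z < r < s -> is_derive (jth p) r (jJ n q p r / ju1 p r ^ 2)).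
{ intros r Hr; apply is_derive_jth; [apply Hu; lra|now apply Hsol]. }
assert (HJ : forall r, z < r < s -> 0 < jJ n q p r).
{ intros r Hr. destruct (HXt r Hr). apply J_of_X; try lra. apply Rlt_le, Hu; lra. }
assert (U1s := a_u1 _ _ _ _ _ A s ltac:(lra)).
assert (Hts : 0 < jth p s).
{ apply Rlt_le_trans with (jth p m); [apply HXt; unfold m; lra|].
  apply (nondecreasing_closed (jth p) (fun r => jJ n q p r / ju1 p r ^ 2)); unfold m in *; try lra.
  - apply continuous_right. apply (is_derive_continuous _ _ _ (Hdt ((z + s) / 2) ltac:(lra))).
  - apply continuous_left.
    apply (is_derive_continuous _ _ _ (is_derive_jth n q p s ltac:(lra)
      (a_sol _ _ _ _ _ A s ltac:(lra)))).
  - intros r Hr; apply Hdt; lra.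
  - intros r Hr. assert (H1 := HJ r ltac:(lra)).
    assert (0 < ju1 p r ^ 2) by (apply pow2_gt_0, Hu; lra). left; pos. }
assert (HFs : F q (ju p s) = 0) by now rewrite Es.
exists s; repeat split; trivial; try lra.
- rewrite <- jX_half; trivial; lra.
- destruct (Req_dec r s) as [->|]; [trivial|apply HXt; lra].
- destruct (Req_dec r s) as [->|]; [|apply HJ; lra].
  apply J_of_X; trivial; try lra. left; apply (a_E _ _ _ _ _ A); lra.
Qed.

(** Above the zero of [F] one has [f (u) > 0], so [theta > 0] gives [Q' > 0], while [Q > 0] gives
    [J > 0] and [theta' > 0]. *)
Lemma a_all : (forall r, z < r < d -> 0 < jth p r /\ 0 < jJ n q p r) /\
  0 < jQ n q p d /\ 0 < jv p d.
Proof.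
destruct a_inner as (s & Hs & HFs & HQs & Hts & Hin).
assert (Us := a_u _ _ _ _ _ A s ltac:(lra)).
assert (Hf : forall r, s < r <= d -> 0 < f q (ju p r)).
{ intros r Hr. apply f_pos_of_F; trivial; [apply (a_u _ _ _ _ _ A); lra|].
  left. rewrite <- HFs. apply F_increasing; trivial; [apply a_u_increasing; lra|lra]. }
assert (HQt : forall r, s < r < d -> 0 < jQ n q p r /\ 0 < jth p r).
{ apply (cooperative_pos (jQ n q p) (jth p)
    (fun r => 2 * wt n r * f q (ju p r) * jv p r) (fun r => jJ n q p r / ju1 p r ^ 2)).
  - apply filter_and.
    + apply (continuous_along_pos _ _ (jQ n q p) s); trivial.
      apply jQ_continuous; [lra|]. apply a_continuous_right; lra.
    + apply (continuous_along_pos _ _ (jth p) s); trivial.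
      assert (H := a_continuous_right s ltac:(lra)).
      assert (U1 := a_u1 _ _ _ _ _ A s ltac:(lra)).
      apply continuous_along_div; [apply _|apply H|apply H|lra].
  - intros r Hr; apply is_derive_jQ; trivial; [|apply (a_sol _ _ _ _ _ A); lra].
    assert (U := a_u _ _ _ _ _ A r ltac:(lra)); lra.
  - intros r Hr; apply is_derive_jth; [|apply (a_sol _ _ _ _ _ A); lra].
    assert (U1 := a_u1 _ _ _ _ _ A r ltac:(lra)); lra.
  - intros r Hr HQ Ht. assert (U1 := a_u1 _ _ _ _ _ A r ltac:(lra)).
    assert (HJ : 0 < jJ n q p r).
    { apply J_of_Q; trivial; [lra|]. rewrite (a_th_v r) by lra. left; pos. }
    left; pos.
  - intros r Hr HQ Ht. assert (U1 := a_u1 _ _ _ _ _ A r ltac:(lra)).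
    rewrite (a_th_v r) by lra. assert (Hfr := Hf r ltac:(lra)).
    assert (Hw := wt_pos n r ltac:(lra)). pos. }
assert (Hall : forall r, z < r < d -> 0 < jth p r /\ 0 < jJ n q p r).
{ intros r Hr. destruct (Rle_or_lt r s) as [H|H]; [apply Hin; lra|].
  destruct (HQt r ltac:(lra)) as [HQ Ht]. split; trivial.
  assert (U1 := a_u1 _ _ _ _ _ A r ltac:(lra)).
  apply J_of_Q; trivial; [lra|]. rewrite (a_th_v r) by lra. left; pos. }
assert (HQd : 0 < jQ n q p d).
{ apply Rlt_le_trans with (jQ n q p s); trivial.
  apply (nondecreasing_closed (jQ n q p) (fun r => 2 * wt n r * f q (ju p r) * jv p r)); try lra.
  - apply jQ_continuous; [lra|]. apply a_continuous_right; lra.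
  - apply jQ_continuous; [lra|]. apply a_continuous_left; lra.
  - intros r Hr; apply is_derive_jQ; trivial; [|apply (a_sol _ _ _ _ _ A); lra].
    assert (U := a_u _ _ _ _ _ A r ltac:(lra)); lra.
  - intros r Hr. assert (U1 := a_u1 _ _ _ _ _ A r ltac:(lra)).
    rewrite (a_th_v r) by lra. assert (Hfr := Hf r ltac:(lra)).
    assert (Hw := wt_pos n r ltac:(lra)). destruct (HQt r Hr). left; pos. }
repeat split; trivial; try (now apply Hall).
(* [theta] is not defined at [d], but [u'(d) = 0] reduces [Q (d)] to [d^n f (u) v], whose sign is
   that of [v (d)]. *)
assert (Hfd := Hf d ltac:(lra)). assert (Hw := wt_pos n d ltac:(lra)).
apply (pos_factor (d * wt n d * f q (ju p d))); [pos|].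
unfold jQ in HQd; rewrite (a_u1d _ _ _ _ _ A) in HQd.
replace (d * wt n d * f q (ju p d) * jv p d) with
  (d * wt n d * (0 * jv1 p d + f q (ju p d) * jv p d) + (INR n - 2) * wt n d * 0 * jv p d)
  by ring. trivial.
Qed.

Lemma a_v_pos r : z <= r <= d -> 0 < jv p r.
Proof.
intros Hr. destruct a_all as (Hall & _ & Hd).
destruct (Req_dec r z) as [->|]; [exact (a_vz _ _ _ _ _ A)|].
destruct (Req_dec r d) as [->|]; trivial.
rewrite (a_th_v r) by lra. destruct (Hall r ltac:(lra)).
assert (U1 := a_u1 _ _ _ _ _ A r ltac:(lra)). pos.
Qed.

Lemma a_M_pos : 0 < jM n p d.
Proof.
assert (Hw := wt_pos n z Hz). assert (U1 := a_u1z _ _ _ _ _ A). assert (V := a_vz _ _ _ _ _ A).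
apply Rlt_trans with (jM n p z).
- unfold jM; rewrite (a_uz _ _ _ _ _ A), Rmult_0_l, Rminus_0_r. pos.
- apply (increasing_closed (jM n p) (fun r => (2 - q) * wt n r * kk q p r * ju p r * jv p r));
    trivial.
  + apply jM_continuous, a_continuous_right; lra.
  + apply jM_continuous, a_continuous_left; lra.
  + intros r Hr. apply is_derive_jM; trivial; [|apply (a_sol _ _ _ _ _ A); lra].
    assert (U := a_u _ _ _ _ _ A r ltac:(lra)); lra.
  + intros r Hr. assert (U := a_u _ _ _ _ _ A r ltac:(lra)).
    assert (Hwr := wt_pos n r ltac:(lra)). assert (Vr := a_v_pos r ltac:(lra)).
    assert (0 < kk q p r) by (apply powabs_pos; lra). pos.
Qed.

(** With [b = u (d)] the weight integral vanishes at both ends of the ascent, so [jPhi] carries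
    [a_H] to [T_2 (d)] unchanged. *)
Lemma a_T_pos : 0 < jT n q p d.
Proof.
destruct a_all as (Hall & _ & _).
assert (Ud := a_u _ _ _ _ _ A d ltac:(lra)).
set (b := ju p d) in *. assert (Hkb := powabs_pos b (q - 2) ltac:(lra)).
set (kb := powabs b (q - 2)) in *.
(* [l] is the level where the weight changes sign; it lies below [b] because [2 / q > 1]. *)
destruct (powabs_level q (2 * kb / q) ltac:(lra) ltac:(pos)) as [l [Hl El]].
assert (Hlb : l < b).
{ apply (powabs_lt_inv q); try lra. rewrite El. fold kb. apply Rlt_div_r; nra. }
destruct (a_level l ltac:(fold b; lra)) as [rs [Hrs Es]].
set (m := wt n rs * jth p rs).
assert (Hwth : forall s t, z < s -> s <= t -> t < d ->
  wt n s * jth p s <= wt n t * jth p t).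
{ intros s t Hs Hst Htd. apply (wth_nondecreasing n q); trivial.
  intros r Hr. assert (U1 := a_u1 _ _ _ _ _ A r ltac:(lra)). destruct (Hall r ltac:(lra)).
  split; [apply (a_sol _ _ _ _ _ A); lra|]. repeat split; lra. }
assert (Hk : forall r s, z < r -> r <= s -> s <= d -> kk q p s <= kk q p r).
{ intros r s Hr Hrs' Hs. destruct (Req_dec r s) as [->|]; [lra|]. left; apply powabs_decr; [lra|].
  split; [apply (a_u _ _ _ _ _ A); lra|apply a_u_increasing; lra]. }
assert (Ekk : q * kk q p rs = 2 * kb) by (unfold kk; rewrite Es, El; field; lra).
assert (HPhi : jPhi n q p b m z <= jPhi n q p b m d).
{ apply (nondecreasing_closed (jPhi n q p b m) (fun r =>
    ju p r * ju1 p r * ((2 - q * kk q p r / kb) * (wt n r * jth p r - m)))); trivial.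
  - apply jPhi_continuous; trivial. apply a_continuous_right; lra.
  - apply jPhi_continuous; trivial. apply a_continuous_left; lra.
  - intros r Hr. assert (Hu := a_u _ _ _ _ _ A r ltac:(lra)).
    assert (Hu1 := a_u1 _ _ _ _ _ A r ltac:(lra)).
    apply is_derive_jPhi; trivial; try lra. apply (a_sol _ _ _ _ _ A); lra.
  - intros r Hr. assert (Hu := a_u _ _ _ _ _ A r ltac:(lra)).
    assert (Hu1 := a_u1 _ _ _ _ _ A r ltac:(lra)).
    assert (0 < ju p r * ju1 p r) by pos.
    apply Rmult_le_pos; [lra|]. unfold m.
    destruct (Rle_or_lt r rs) as [H1|H1].
    + assert (wt n r * jth p r <= wt n rs * jth p rs) by (apply Hwth; lra).
      assert (H2 := Hk r rs ltac:(lra) ltac:(lra) ltac:(lra)).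
      assert (2 <= q * kk q p r / kb) by (apply Rle_div_r; [lra|nra]). nra.
    + assert (wt n rs * jth p rs <= wt n r * jth p r) by (apply Hwth; lra).
      assert (H2 := Hk rs r ltac:(lra) ltac:(lra) ltac:(lra)).
      assert (q * kk q p r / kb <= 2) by (apply Rle_div_l; [lra|nra]). nra. }
assert (HH := a_H _ _ _ _ _ A). fold b in HH.
unfold jPhi in HPhi. rewrite (a_uz _ _ _ _ _ A), weight_int_0 in HPhi. fold b in HPhi.
rewrite weight_int_self in HPhi by lra. unfold jT; fold b. lra.
Qed.

End Ascent.

Lemma descent_end n q p c z tau : descent n q p c z -> first_v_zero q p c z tau ->
  ju1 p z <> 0 -> jet_continuous (at_left z) p z ->
  jv p z * ju1 p z > 0 /\ 0 < jX n q p z.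
Proof.
intros D Htau Hz1 Hzc.
assert (Hq := d_q _ _ _ _ _ D). assert (Hc := d_c _ _ _ _ _ D).
destruct (descent_variation D tau Htau) as (HvJ & _ & b & Hb & HXb & HXm & _).
destruct Htau as (Ht & _).
split.
- assert (Hd : forall r, tau < r < z -> is_derive (jth p) r (jJ n q p r / ju1 p r ^ 2)).
  { intros r Hr. apply is_derive_jth; [|apply (d_sol _ _ _ _ _ D); lra].
    assert (H := d_u1 _ _ _ _ _ D r ltac:(lra)); lra. }
  assert (Hth : 0 < jth p z).
  { set (m := (tau + z) / 2). apply Rlt_le_trans with (jth p m).
    - apply (d_th_pos D); [unfold m; lra|apply HvJ; unfold m; lra].
    - apply (nondecreasing_closed (jth p) (fun r => jJ n q p r / ju1 p r ^ 2));
        unfold m in *; try lra.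
      + apply continuous_right, (is_derive_continuous _ _ _ (Hd ((tau + z) / 2) ltac:(lra))).
      + apply continuous_along_div; [apply _|apply Hzc|apply Hzc|trivial].
      + intros r Hr; apply Hd; lra.
      + intros r Hr. destruct (HvJ r ltac:(lra)) as [_ HJ].
        assert (H := d_u1 _ _ _ _ _ D r ltac:(lra)).
        assert (0 < ju1 p r ^ 2) by nra. left; pos. }
  assert (0 < ju1 p z ^ 2) by now apply pow2_gt_0.
  replace (jv p z * ju1 p z) with (jth p z * ju1 p z ^ 2) by (unfold jth; field; trivial).
  apply Rlt_gt; pos.
- apply Rlt_le_trans with (jX n q p b); trivial.
  apply (left_limit_ge (jX n q p) b z); [lra| |].
  + apply jX_continuous; trivial; lra.
  + intros r Hr; apply HXm; lra.
Qed.

(** * Behaviour at a double zero *)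

(** [(r^(n-1) v')' = - r^(n-1) f' (u) v], which is negative near [z] since [f' (u)] and [v] are both
    negative there. So [r^(n-1) v'] decreases, and [v'] changes sign at most once. *)
Lemma eventually_monotone_at_zero n q p c z tau : descent n q p c z ->
  first_v_zero q p c z tau -> eventually_monotone_left (jv p) z.
Proof.
intros D Htau.
assert (Hn := d_n _ _ _ _ _ D). assert (Hq := d_q _ _ _ _ _ D). assert (Hc := d_c _ _ _ _ _ D).
destruct (descent_variation D tau Htau) as (HvJ & _). destruct Htau as (Ht & _).
assert (Hkt := d_kk_pos D tau ltac:(lra)).
assert (Hi : 0 < / (q - 1)) by pos.
(* A level beyond the zero of [f'], increased by [kk] at [tau] so that it is reached only after
   [tau]. *)
destruct (d_kk_level D (/ (q - 1) + kk q p tau) tau) as [s [Hs Es]]; try lra.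
assert (Hd : forall r, s < r < z ->
  is_derive (fun x => wt n x * jv1 p x) r (- (wt n r * (1 - (q - 1) * kk q p r) * jv p r))
  /\ 0 < wt n r * (1 - (q - 1) * kk q p r) * jv p r).
{ intros r Hr. assert (Hu := d_u_pos D r ltac:(lra)).
  destruct (d_sol _ _ _ _ _ D r ltac:(lra)) as [[Hr0 _ _] _ _ Hv1].
  specialize (Hv1 ltac:(lra)). assert (Hw := wt_pos n r Hr0).
  assert (Dw := is_derive_wt n r Hn Hr0).
  split.
  - derive_by_rules. unfold kk; field; lra.
  - assert (kk q p s < kk q p r) by (apply (d_kk_increasing D); lra).
    destruct (HvJ r ltac:(lra)) as [Hv _].
    assert (1 < (q - 1) * kk q p r).
    { apply Rlt_le_trans with ((q - 1) * (/ (q - 1) + kk q p tau)).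
      - rewrite Rmult_plus_distr_l, Rinv_r by lra. assert (0 < (q - 1) * kk q p tau) by pos. lra.
      - apply Rmult_le_compat_l; lra. }
    replace (wt n r * (1 - (q - 1) * kk q p r) * jv p r)
      with (wt n r * ((q - 1) * kk q p r - 1) * - jv p r) by ring. pos. }
assert (Hdec : forall x y, s < x -> x < y -> y < z -> wt n y * jv1 p y < wt n x * jv1 p x).
{ intros x y Hx Hxy Hy. cut (- (wt n x * jv1 p x) < - (wt n y * jv1 p y)); [lra|].
  apply (derive_pos_lt (fun r => - (wt n r * jv1 p r))
    (fun r => - - (wt n r * (1 - (q - 1) * kk q p r) * jv p r))); trivial.
  - intros r Hr. apply (is_derive_opp (fun x => wt n x * jv1 p x)), Hd; lra.
  - intros r Hr. destruct (Hd r ltac:(lra)); lra. }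
assert (Hv : forall r, s < r < z -> is_derive (jv p) r (jv1 p r)).
{ intros r Hr; apply (d_sol _ _ _ _ _ D); lra. }
destruct (classic (exists x, s < x < z /\ jv1 p x <= 0)) as [[x [Hx Hv1]]|Hno].
- exists x; split; [lra|right]. intros a b Ha Hab Hb.
  cut (- jv p a <= - jv p b); [lra|].
  apply (derive_nonneg_le (fun r => - jv p r) (fun r => - jv1 p r)); trivial.
  + intros r Hr; apply (is_derive_opp (jv p)), Hv; lra.
  + intros r Hr. assert (H := Hdec x r ltac:(lra) ltac:(lra) ltac:(lra)).
    assert (H1 := wt_pos n x ltac:(lra)). assert (H2 := wt_pos n r ltac:(lra)).
    assert (wt n x * jv1 p x <= 0) by nra.
    left; apply (pos_factor (wt n r)); lra.
- exists s; split; [lra|left]. intros a b Ha Hab Hb.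
  apply (derive_nonneg_le (jv p) (jv1 p)); trivial.
  + intros r Hr; apply Hv; lra.
  + intros r Hr. apply Rnot_lt_le; intros Hlt. apply Hno; exists r; split; lra.
Qed.

Lemma blow_up_at_double_zero n q p c z tau : descent n q p c z ->
  first_v_zero q p c z tau -> ju1 p z = 0 ->
  forall K, at_left z (fun r => K < Rabs (jv p r)).
Proof.
intros D Htau Hz1.
assert (Hn := d_n _ _ _ _ _ D). assert (Hq := d_q _ _ _ _ _ D). assert (Hc := d_c _ _ _ _ _ D).
destruct (descent_variation D tau Htau) as (HvJ & _ & b & Hb & HXb & HXm & _).
destruct Htau as (Ht & _).
set (a := Rmax b tau). assert (Ma1 := Rmax_l b tau). assert (Ma2 := Rmax_r b tau).
assert (Haz : a < z) by (apply Rmax_lub_lt; lra). fold a in Ma1, Ma2.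
(* [r^n J >= X >= X (b)], and [r^n <= z^n]. *)
set (j := jX n q p b / (z * wt n z)).
assert (Hwz := wt_pos n z ltac:(lra)).
assert (Hj : 0 < j) by (unfold j; pos).
assert (HJ : forall r, a < r < z -> j <= jJ n q p r).
{ intros r Hr. destruct (HvJ r ltac:(lra)) as [Hv HJr].
  assert (Hth := d_th_pos D r ltac:(lra) Hv). assert (HE := d_E _ _ _ _ _ D r ltac:(lra)).
  assert (Hw := wt_pos n r ltac:(lra)). assert (HX := HXm r ltac:(lra)).
  assert (HXJ : jX n q p b <= r * wt n r * jJ n q p r).
  { unfold jX in HX at 2. assert (0 < 2 * jE q p r * (wt n r * jth p r)) by pos. lra. }
  assert (Hww : wt n r <= wt n z) by (apply pow_incr; lra).
  unfold j. apply Rle_div_l; [apply Rlt_gt; pos|].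
  apply Rle_trans with (r * wt n r * jJ n q p r); trivial.
  rewrite Rmult_comm. apply Rmult_le_compat_l; [lra|].
  apply Rmult_le_compat; lra. }
intros K0. set (K := Rabs K0 + 2). assert (HK0 := Rabs_pos K0).
assert (HK : 0 < K) by (unfold K; lra).
assert (Hleft := d_left _ _ _ _ _ D).
(* [u''] tends to [0] at the double zero *)
assert (Hu2 : at_left z (fun r => 0 < j - K * (- (INR n - 1) / r * ju1 p r - f q (ju p r)))).
{ apply (continuous_along_pos _ _
    (fun r => j - K * (- (INR n - 1) * / r * ju1 p r - f q (ju p r))) z).
  - assert (HG : Filter (at_left z)) by apply _.
    assert (Hri : continuous_along (at_left z) (fun r => / r) z).
    { apply continuous_along_inv; [trivial|apply Hleft|lra]. }
    assert (Hf := continuous_along_f _ HG q (ju p) z ltac:(lra) (jc_u _ _ _ Hleft)).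
    assert (H1 := jc_u1 _ _ _ Hleft).
    continuous_along_tac.
  - rewrite Hz1, (d_uz _ _ _ _ _ D), f_0. lra. }
destruct (at_left_ex _ _ Hu2) as [d [Hd Hu2']].
set (a2 := Rmax a (z - d)). assert (Mb1 := Rmax_l a (z - d)). assert (Mb2 := Rmax_r a (z - d)).
assert (Ha2z : a2 < z) by (apply Rmax_lub_lt; lra). fold a2 in Mb1, Mb2.
set (m := (a2 + z) / 2). assert (Hm : a2 < m < z) by (unfold m; lra).
(* [G' = (J - K u'') / u'^2 >= 0], so [G] is bounded below near [z]; as [u'] is negative and tends
   to [0], [v + K <= G (m) u' < 1] near [z]. The surplus [2] in [K] absorbs this [1]. *)
set (G := fun r => (jv p r + K) / ju1 p r).
assert (HG : forall r, m < r < z -> G m <= G r).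
{ intros r Hr. apply (derive_nonneg_le G (fun s =>
    (jJ n q p s - K * (- (INR n - 1) / s * ju1 p s - f q (ju p s))) / ju1 p s ^ 2)); [lra| |].
  - intros s Hs. assert (H1 := d_u1 _ _ _ _ _ D s ltac:(lra)).
    destruct (d_sol _ _ _ _ _ D s ltac:(lra)) as [[Hs0 Hu Hu1] Hv _ _].
    unfold G, jJ. derive_by_rules; [lra|]. field; lra.
  - intros s Hs. assert (H1 := d_u1 _ _ _ _ _ D s ltac:(lra)).
    assert (0 < ju1 p s ^ 2) by nra.
    assert (H2 := HJ s ltac:(lra)). assert (H3 := Hu2' s ltac:(lra)).
    apply Rdiv_le_0_compat; trivial. lra. }
assert (Hsmall : at_left z (fun r => 0 < 1 - G m * ju1 p r)).
{ apply (continuous_along_pos _ _ (fun r => 1 - G m * ju1 p r) z).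
  - assert (HF : Filter (at_left z)) by apply _.
    assert (H1 := jc_u1 _ _ _ Hleft).
    apply continuous_along_minus; [trivial|now apply continuous_along_const|].
    apply continuous_along_mult; [trivial|now apply continuous_along_const|trivial].
  - rewrite Hz1; lra. }
assert (Hmz : at_left z (fun r => m < r < z)).
{ apply (ex_at_left z _ (z - m)); intros; lra. }
generalize (filter_and _ _ Hsmall Hmz). apply filter_imp. intros r [Hs Hr].
assert (H1 := d_u1 _ _ _ _ _ D r ltac:(lra)). assert (HGr := HG r Hr).
assert (Hvr : jv p r + K <= G m * ju1 p r).
{ replace (jv p r + K) with (G r * ju1 p r) by (unfold G; field; lra). nra. }
assert (Hv : jv p r < - Rabs K0 - 1) by (unfold K in *; lra).
rewrite Rabs_left by lra. assert (HKK := Rle_abs K0). lra.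
Qed.

(** * Nodal structure *)

Lemma nonzero_pos (g : R -> R) a b x : (forall r, a < r < b -> continuous g r) ->
  (forall r, a < r < b -> g r <> 0) -> a < x < b -> 0 < g x ->
  forall y, a < y < b -> 0 < g y.
Proof.
intros Hc Hn Hx Hgx y Hy. apply Rnot_le_lt; intros [Hgy|Hgy]; [|now apply (Hn y)].
destruct (Rtotal_order x y) as [H|[H|H]].
- destruct (IVT_decreasing g x y 0) as [t [Ht E]]; try lra.
  + apply continuous_right, Hc; lra.
  + apply continuous_left, Hc; lra.
  + intros; apply Hc; lra.
  + apply (Hn t); trivial; lra.
- subst y; lra.
- destruct (IVT_decreasing (fun r => - g r) y x 0) as [t [Ht E]]; try lra.
  + apply continuous_along_opp; [apply _|]; apply continuous_right, Hc; lra.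
  + apply continuous_along_opp; [apply _|]; apply continuous_left, Hc; lra.
  + intros; apply (continuous_along_opp (locally r)); [apply _|]; apply Hc; lra.
  + apply (Hn t); lra.
Qed.

(** With [u' = 0] the energy is [F (u)], so [F (u) > 0], then [f (u) > 0] and [u'' < 0]. This is why
    [u'] can only pass from positive to negative between two zeros of [u]. *)
Lemma critical_f_pos n q p r : 1 < q < 2 -> solves_u n q p r -> 0 < ju p r -> 0 < jE q p r ->
  ju1 p r = 0 -> is_derive (fun s => - ju1 p s) r (f q (ju p r)) /\ 0 < f q (ju p r).
Proof.
intros Hq [Hr _ Hu1] Hu HE E. unfold jE in HE. rewrite E in *. split.
- replace (f q (ju p r)) with (opp (- (INR n - 1) / r * 0 - f q (ju p r)))
    by (unfold opp; simpl; ring).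
  now apply (is_derive_opp (ju1 p)).
- apply f_pos_of_F; trivial. lra.
Qed.

Lemma descending n q p a b : 1 < q < 2 ->
  (forall r, a < r < b -> solves_u n q p r /\ 0 < ju p r /\ 0 < jE q p r) ->
  at_right a (fun r => ju1 p r < 0) ->
  forall r, a < r < b -> ju1 p r < 0.
Proof.
intros Hq H H0 r Hr. cut (0 < - ju1 p r); [lra|]. revert r Hr.
apply (positive_barrier (fun r => - ju1 p r) (fun r => f q (ju p r))).
- revert H0; apply filter_imp; intros; lra.
- intros r Hr; apply (continuous_along_opp (locally r)); [apply _|].
  apply (solves_u_continuous n q), H; lra.
- intros r Hr _ E. destruct (H r Hr) as (S & U & HE).
  apply (critical_f_pos n); trivial; lra.
Qed.

Lemma descending_after n q p a b x : 1 < q < 2 ->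
  (forall r, a < r < b -> solves_u n q p r /\ 0 < ju p r /\ 0 < jE q p r) ->
  a < x < b -> ju1 p x <= 0 -> forall r, x < r < b -> ju1 p r < 0.
Proof.
intros Hq H Hx Hle. apply (descending n q); trivial.
{ intros r Hr; apply H; lra. }
destruct (H x Hx) as (S & U & HE).
cut (at_right x (fun r => 0 < - ju1 p r)).
{ apply filter_imp; intros; lra. }
destruct Hle as [Hlt|E].
- apply (continuous_along_pos _ _ (fun r => - ju1 p r) x); [|lra].
  apply continuous_along_opp; [apply _|].
  apply jet_continuous_u_right. now apply (solves_u_continuous n q).
- destruct (critical_f_pos n q p x Hq S U HE E) as [Hd Hf].
  apply (derive_pos_right_pos _ _ _ Hd Hf). lra.
Qed.

(** [z (k + 1)] is a simple zero or the double zero [z_u]. To cover both, the equation of [v] and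
    the simplicity of the zeros are recorded only before it. *)
Record nodal (n : nat) (q : R) (p : jet) (k : nat) (z c rr : nat -> R) : Prop := {
  nd_n : (2 <= n)%nat;
  nd_q : 1 < q < 2;
  nd_solu : forall r, 0 < r -> solves_u n q p r;
  nd_sol : forall r, 0 < r < z (k + 1)%nat -> solves n q p r;
  nd_right : jet_continuous (at_right 0) p 0;
  nd_u1_0 : ju1 p 0 = 0;
  nd_v0 : jv p 0 = 1;
  nd_u0 : 0 < ju p 0;
  nd_zpos : forall i, (1 <= i <= k + 1)%nat -> 0 < z i <= z (k + 1)%nat;
  nd_zlt : forall i, (1 <= i <= k)%nat -> z i < z (i + 1)%nat;
  nd_zero : forall i, (1 <= i <= k + 1)%nat -> ju p (z i) = 0;
  nd_simple : forall i, (1 <= i <= k)%nat -> ju1 p (z i) <> 0;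
  nd_nz1 : forall r, 0 < r < z 1%nat -> ju p r <> 0;
  nd_nz : forall i r, (1 <= i <= k)%nat -> z i < r < z (i + 1)%nat -> ju p r <> 0;
  nd_E : forall r, 0 < r < z (k + 1)%nat -> 0 < jE q p r;
  nd_c0 : c 0%nat = 0;
  nd_c : forall i, (1 <= i <= k)%nat -> z i < c i < z (i + 1)%nat /\ ju1 p (c i) = 0;
  nd_r : forall i, (1 <= i <= k + 1)%nat ->
    c (i - 1)%nat < rr i < z i /\ Rabs (ju p (rr i)) = 1
}.

Definition QMT_start (n : nat) (q : R) (p : jet) (r : R) : Prop :=
  0 < jQ n q p r /\ 0 < jM n p r /\ 0 < jT n q p r.

Lemma QMT_start_opp n q p r : QMT_start n q (jopp p) r <-> QMT_start n q p r.
Proof. unfold QMT_start; rewrite jQ_opp, jM_opp, jT_opp; tauto. Qed.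

Lemma QMT_start_pos n q u v r : (2 <= n)%nat -> 0 < r ->
  forall u1 v1, u1 r = Derive u r -> v1 r = Derive v r ->
  QMT_start n q (Jet u u1 v v1) r <-> QMT_pos n q u v r.
Proof.
intros Hn Hr u1 v1 E1 E2. unfold QMT_start, QMT_pos, jT, T2.
assert (EQ : jQ n q (Jet u u1 v v1) r = Qf n q u v r).
{ unfold jQ, Qf, wt; simpl. rewrite E1, E2, (pow_wt n r Hn). unfold wt. ring. }
assert (EM : jM n (Jet u u1 v v1) r = Mf n u v r).
{ unfold jM, Mf, wt; simpl. now rewrite E1, E2. }
rewrite EQ, EM; simpl. tauto.
Qed.

Definition same_up_to_sign (p' p : jet) : Prop := p' = p \/ p' = jopp p.

Section Nodal.
Context {n : nat} {q : R} {p : jet} {k : nat} {z c rr : nat -> R}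
  (N : nodal n q p k z c rr).

Let Hn : (2 <= n)%nat := nd_n _ _ _ _ _ _ _ N.
Let Hq : 1 < q < 2 := nd_q _ _ _ _ _ _ _ N.

Lemma sign_solu p' r : same_up_to_sign p' p -> 0 < r -> solves_u n q p' r.
Proof.
intros [->| ->] Hr; [|apply solves_u_opp]; now apply (nd_solu _ _ _ _ _ _ _ N).
Qed.

Lemma sign_sol p' r : same_up_to_sign p' p -> 0 < r < z (k + 1)%nat -> solves n q p' r.
Proof.
intros [->| ->] Hr; [|apply solves_opp]; now apply (nd_sol _ _ _ _ _ _ _ N).
Qed.

Lemma sign_E p' r : same_up_to_sign p' p -> 0 < r < z (k + 1)%nat -> 0 < jE q p' r.
Proof.
intros [->| ->] Hr; [|rewrite jE_opp]; now apply (nd_E _ _ _ _ _ _ _ N).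
Qed.

Lemma sign_nz p' r : same_up_to_sign p' p -> ju p r <> 0 -> ju p' r <> 0.
Proof. intros [->| ->] Hr; simpl; lra. Qed.

Lemma sign_zero p' r : same_up_to_sign p' p -> ju p r = 0 -> ju p' r = 0.
Proof. intros [->| ->] Hr; simpl; lra. Qed.

Lemma sign_u1 p' r : same_up_to_sign p' p -> ju1 p r = 0 <-> ju1 p' r = 0.
Proof. intros [->| ->]; simpl; lra. Qed.

Lemma sign_v p' r : same_up_to_sign p' p -> jv p r = 0 <-> jv p' r = 0.
Proof. intros [->| ->]; simpl; lra. Qed.

Lemma sign_opp p' : same_up_to_sign p' p -> same_up_to_sign (jopp p') p.
Proof.
intros [->| ->]; [now right|left]. unfold jopp; destruct p as [u u1 v v1]; simpl.
assert (E : forall g : R -> R, (fun r => - - g r) = g).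
{ intros g; apply functional_extensionality; intros; ring. }
now rewrite !E.
Qed.

Lemma sign_QMT p' r : same_up_to_sign p' p -> QMT_start n q p' r <-> QMT_start n q p r.
Proof. intros [->| ->]; [tauto|apply QMT_start_opp]. Qed.

Lemma z_le_next i : (1 <= i <= k)%nat -> z i < z (k + 1)%nat.
Proof.
intros Hi. apply Rlt_le_trans with (z (i + 1)%nat); [now apply (nd_zlt _ _ _ _ _ _ _ N)|].
apply (nd_zpos _ _ _ _ _ _ _ N); lia.
Qed.

Lemma c_bounds i : (1 <= i <= k)%nat -> 0 < c i < z (k + 1)%nat.
Proof.
intros Hi. destruct (nd_c _ _ _ _ _ _ _ N i Hi) as [Hc _].
assert (H1 := nd_zpos _ _ _ _ _ _ _ N i ltac:(lia)).
assert (H2 := nd_zpos _ _ _ _ _ _ _ N (i + 1)%nat ltac:(lia)). lra.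
Qed.

(** The sign is chosen so that [u] is positive at the critical point. For [i = 1] it has to be that
    of [p] itself, in agreement with [v (0) = 1]. *)
Lemma nodal_descending i : (1 <= i <= k + 1)%nat -> exists p', same_up_to_sign p' p /\
  0 <= c (i - 1)%nat < z i /\
  (forall r, c (i - 1)%nat < r < z i -> 0 < ju p' r /\ ju1 p' r < 0) /\
  0 < ju p' (c (i - 1)%nat) /\ (i = 1%nat -> p' = p).
Proof.
intros Hi. assert (Hzi := nd_zpos _ _ _ _ _ _ _ N i Hi).
destruct (Nat.eq_dec i 1) as [->|Hi1].
- exists p. simpl. rewrite (nd_c0 _ _ _ _ _ _ _ N).
  assert (Hu0 := nd_u0 _ _ _ _ _ _ _ N). assert (Hr0 := nd_right _ _ _ _ _ _ _ N).
  assert (Hpos : forall r, 0 < r < z 1%nat -> 0 < ju p r).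
  { destruct (at_right_ex _ _ (continuous_along_pos _ _ (ju p) 0 (jc_u _ _ _ (jc_uu _ _ _ Hr0)) Hu0))
      as [d [Hd Hnear]].
    assert (M1 := Rmin_l d (z 1%nat)). assert (M2 := Rmin_r d (z 1%nat)).
    assert (M3 : 0 < Rmin d (z 1%nat)) by (apply Rmin_pos; lra).
    apply (nonzero_pos (ju p) 0 (z 1%nat) (Rmin d (z 1%nat) / 2)).
    - intros r Hr. apply (solves_u_continuous n q), (nd_solu _ _ _ _ _ _ _ N); lra.
    - apply (nd_nz1 _ _ _ _ _ _ _ N).
    - lra.
    - apply Hnear; lra. }
  assert (HE : forall r, 0 < r < z 1%nat -> 0 < jE q p r).
  { intros r Hr; apply (nd_E _ _ _ _ _ _ _ N); lra. }
  assert (HF0 : 0 < F q (ju p 0)).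
  { set (m := z 1%nat / 2). apply Rlt_le_trans with (jE q p m); [apply HE; unfold m; lra|].
    cut (- jE q p 0 <= - jE q p m).
    { unfold jE at 1. rewrite (nd_u1_0 _ _ _ _ _ _ _ N). lra. }
    apply (nondecreasing_closed (fun r => - jE q p r)
      (fun r => - (- (INR n - 1) / r * ju1 p r ^ 2))); [unfold m; lra| | | |].
    - apply continuous_along_opp; [apply _|]. apply jE_continuous; [lra|apply Hr0].
    - apply continuous_along_opp; [apply _|]. apply jE_continuous; [lra|].
      apply jet_continuous_u_left, (solves_u_continuous n q), (nd_solu _ _ _ _ _ _ _ N).
      unfold m; lra.
    - intros r Hr. apply (is_derive_opp (jE q p)), is_derive_jE; [lra|].
      apply (nd_solu _ _ _ _ _ _ _ N); lra.
    - intros r Hr. assert (HN := INR_ge2 n Hn).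
      replace (- (- (INR n - 1) / r * ju1 p r ^ 2)) with ((INR n - 1) / r * ju1 p r ^ 2)
        by (field; lra).
      apply Rmult_le_pos; [left; pos|apply pow2_ge_0]. }
  assert (Hf0 := f_pos_of_F q _ Hq Hu0 (Rlt_le _ _ HF0)).
  (* [(r^(n-1) u')' = - r^(n-1) f (u) < 0] near [0] *)
  assert (Hnear : at_right 0 (fun r => ju1 p r < 0)).
  { assert (Hf : at_right 0 (fun r => 0 < f q (ju p r))).
    { apply (continuous_along_pos _ _ (fun r => f q (ju p r)) 0); trivial.
      apply continuous_along_f; [apply _|lra|apply Hr0]. }
    destruct (at_right_ex _ _ Hf) as [d [Hd Hfd]].
    apply (ex_at_right 0 _ d Hd). intros r Hr.
    assert (Hw := wt_pos n r ltac:(lra)).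
    cut (0 < - ju1 p r); [lra|]. apply (pos_factor (wt n r)); trivial.
    apply Rle_lt_trans with (wt n 0 * - ju1 p 0).
    - rewrite (nd_u1_0 _ _ _ _ _ _ _ N); lra.
    - apply (increasing_closed (fun s => wt n s * - ju1 p s)
        (fun s => wt n s * f q (ju p s))); [lra| | | |].
      + apply continuous_along_mult; [apply _| |].
        * apply (wt_continuous _ n p), Hr0.
        * apply continuous_along_opp; [apply _|apply Hr0].
      + assert (Hrl := jet_continuous_u_left _ _ (solves_u_continuous n q p r
          (nd_solu _ _ _ _ _ _ _ N r ltac:(lra)))).
        apply continuous_along_mult; [apply _| |].
        * now apply (wt_continuous _ n p).
        * apply continuous_along_opp; [apply _|apply Hrl].
      + intros s Hs. destruct (nd_solu _ _ _ _ _ _ _ N s ltac:(lra)) as [Hs0 Hu Hu1].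
        assert (Hws := is_derive_wt n s Hn Hs0).
        derive_by_rules. field; lra.
      + intros s Hs. assert (Hws := wt_pos n s ltac:(lra)).
        assert (H := Hfd s ltac:(lra)). pos. }
  assert (Hdesc : forall r, 0 < r < z 1%nat -> ju1 p r < 0).
  { apply (descending n q); trivial. intros r Hr.
    split; [apply (nd_solu _ _ _ _ _ _ _ N); lra|split; [now apply Hpos|now apply HE]]. }
  repeat split; trivial; try lra; [now left|now apply Hpos|now apply Hdesc].
- set (j := (i - 1)%nat). assert (Hj : (1 <= j <= k)%nat) by (unfold j; lia).
  assert (Ei : i = (j + 1)%nat) by (unfold j; lia).
  destruct (nd_c _ _ _ _ _ _ _ N j Hj) as [Hc Hc1].
  assert (Hnz := nd_nz _ _ _ _ _ _ _ N j). rewrite <- Ei in Hc, Hnz.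
  assert (Hzj := nd_zpos _ _ _ _ _ _ _ N j ltac:(lia)).
  assert (Hp : exists p', same_up_to_sign p' p /\ 0 < ju p' (c j)).
  { destruct (Rlt_or_le 0 (ju p (c j))); [exists p; split; [now left|lra]|].
    exists (jopp p); split; [now right|]. simpl.
    assert (H1 := Hnz (c j) Hj Hc). lra. }
  destruct Hp as (p' & Hs & Hpc). exists p'.
  assert (Hpos : forall r, z j < r < z i -> 0 < ju p' r).
  { apply (nonzero_pos (ju p') (z j) (z i) (c j)); trivial.
    - intros r Hr. apply (solves_u_continuous n q), sign_solu; trivial; lra.
    - intros r Hr. apply sign_nz; trivial. now apply Hnz. }
  assert (Hdesc : forall r, c j < r < z i -> ju1 p' r < 0).
  { apply (descending_after n q p' (z j) (z i)); trivial.
    - intros r Hr. split; [apply sign_solu; trivial; lra|].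
      split; [now apply Hpos|apply sign_E; trivial; lra].
    - apply (sign_u1 p' (c j)) in Hc1; trivial. lra. }
  repeat split; trivial; try lra; try lia; intros; [apply Hpos|apply Hdesc]; lra.
Qed.

Lemma nodal_ascending i p' : (1 <= i <= k)%nat -> same_up_to_sign p' p ->
  ju1 p' (z i) < 0 ->
  (forall r, z i < r <= c i -> ju p' r < 0) /\ (forall r, z i < r < c i -> ju1 p' r < 0).
Proof.
intros Hi Hs Hz1. set (p2 := jopp p'). assert (Hs2 : same_up_to_sign p2 p) by now apply sign_opp.
destruct (nd_c _ _ _ _ _ _ _ N i Hi) as [Hc Hc1].
assert (Hzi := nd_zpos _ _ _ _ _ _ _ N i ltac:(lia)).
assert (Hzi1 := nd_zpos _ _ _ _ _ _ _ N (i + 1)%nat ltac:(lia)).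
assert (Hd := su_u _ _ _ _ (sign_solu p2 (z i) Hs2 ltac:(lra))).
assert (E : ju p2 (z i) = 0).
{ apply sign_zero; trivial. apply (nd_zero _ _ _ _ _ _ _ N); lia. }
destruct (at_right_ex _ _ (derive_pos_right_pos _ _ _ Hd ltac:(simpl; lra) E)) as [d [Hd0 Hnear]].
assert (M1 := Rmin_l d (z (i + 1)%nat - z i)). assert (M2 := Rmin_r d (z (i + 1)%nat - z i)).
assert (M3 : 0 < Rmin d (z (i + 1)%nat - z i)) by (apply Rmin_pos; lra).
assert (Hpos : forall r, z i < r < z (i + 1)%nat -> 0 < ju p2 r).
{ apply (nonzero_pos (ju p2) (z i) (z (i + 1)%nat) (z i + Rmin d (z (i + 1)%nat - z i) / 2)).
  - intros r Hr. apply (solves_u_continuous n q), sign_solu; trivial; lra.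
  - intros r Hr. apply sign_nz; trivial. now apply (nd_nz _ _ _ _ _ _ _ N i).
  - lra.
  - apply Hnear; lra. }
split.
- intros r Hr. assert (H := Hpos r ltac:(lra)). simpl in H; lra.
- intros r Hr. apply Rnot_le_lt; intros Hle.
  assert (H : ju1 p2 (c i) < 0).
  { apply (descending_after n q p2 (z i) (z (i + 1)%nat) r); trivial; try lra.
    - intros s Hs'. split; [apply sign_solu; trivial; lra|].
      split; [now apply Hpos|apply sign_E; trivial; lra].
    - simpl; lra. }
  apply (sign_u1 p2 (c i)) in Hc1; trivial. lra.
Qed.

Lemma nodal_descent i : (1 <= i <= k + 1)%nat ->
  (i = 1%nat \/ QMT_start n q p (c (i - 1)%nat)) ->
  exists p', same_up_to_sign p' p /\ descent n q p' (c (i - 1)%nat) (z i).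
Proof.
intros Hi Hstart. destruct (nodal_descending i Hi) as (p' & Hs & Hc & Hu & Huc & H1).
exists p'; split; trivial.
assert (Hzi := nd_zpos _ _ _ _ _ _ _ N i Hi).
assert (Hend : jet_continuous_u (at_left (z i)) p' (z i)).
{ apply jet_continuous_u_left, (solves_u_continuous n q), sign_solu; trivial; lra. }
assert (Hz : ju p' (z i) = 0).
{ apply sign_zero; trivial. now apply (nd_zero _ _ _ _ _ _ _ N). }
destruct (Nat.eq_dec i 1) as [Ei|Hi1].
- specialize (H1 Ei); subst p' i. simpl in *. rewrite (nd_c0 _ _ _ _ _ _ _ N) in *.
  (* Since [n >= 2], the weight vanishes at the origin, and with it [Q], [M] and [T_2]: the first
     descent needs no assumption at its start. *)
  assert (Ew : wt n 0 = 0) by (unfold wt; apply pow_i; lia).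
  assert (EM : jM n p 0 = 0) by (unfold jM; rewrite Ew; ring).
  assert (EQ : jQ n q p 0 = 0) by (unfold jQ; rewrite Ew; ring).
  constructor; trivial; try lra; try (intros; apply Hu; lra).
  + intros r Hr; apply (nd_sol _ _ _ _ _ _ _ N); lra.
  + intros r Hr; apply (nd_E _ _ _ _ _ _ _ N); lra.
  + exact (nd_right _ _ _ _ _ _ _ N).
  + exact (nd_u1_0 _ _ _ _ _ _ _ N).
  + rewrite (nd_v0 _ _ _ _ _ _ _ N); lra.
  + unfold jT; rewrite EM, EQ; lra.
- destruct Hstart as [|Hstart]; [easy|].
  set (j := (i - 1)%nat) in *. assert (Hj : (1 <= j <= k)%nat) by (unfold j; lia).
  assert (Hcj := c_bounds j Hj).
  destruct (nd_c _ _ _ _ _ _ _ N j Hj) as [_ Hc1].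
  apply (sign_u1 p' _ Hs) in Hc1. apply (sign_QMT p' _ Hs) in Hstart.
  destruct Hstart as (HQ & HM & HT).
  assert (Hsc := sign_sol p' (c j) Hs Hcj).
  assert (HE := sign_E p' (c j) Hs Hcj).
  constructor; trivial; try lra; try (intros; apply Hu; lra).
  + intros r Hr; apply sign_sol; trivial; lra.
  + intros r Hr; apply sign_E; trivial; lra.
  + apply jet_continuous_right, (solves_continuous n q); trivial.
  (* At the critical point [Q = c^n f (u) v] with [f (u) > 0], so [Q > 0] means [v > 0] for this
     choice of sign. *)
  + unfold jE in HE; rewrite Hc1 in HE.
    assert (Hf := f_pos_of_F q _ Hq Huc ltac:(lra)).
    assert (Hw := wt_pos n (c j) ltac:(lra)).
    apply (pos_factor (c j * wt n (c j) * f q (ju p' (c j)))); [pos|].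
    unfold jQ in HQ; rewrite Hc1 in HQ. lra.
Qed.

Lemma nodal_first_zero i p' : (1 <= i <= k + 1)%nat -> same_up_to_sign p' p ->
  descent n q p' (c (i - 1)%nat) (z i) ->
  exists tau, first_v_zero q p' (c (i - 1)%nat) (z i) tau /\ c (i - 1)%nat < tau < rr i.
Proof.
intros Hi Hs D. destruct (nd_r _ _ _ _ _ _ _ N i Hi) as [Hr Er].
assert (Hu := d_u_pos D (rr i) ltac:(lra)).
assert (Eu : ju p' (rr i) = 1).
{ rewrite <- (Rabs_right (ju p' (rr i))) by lra. rewrite <- Er.
  destruct Hs as [->| ->]; simpl; trivial. apply Rabs_Ropp. }
destruct (d_tau D (rr i) Hr Eu) as (tau & Ht & Ev & Hpos).
exists tau; split; trivial. split; [lra|]. split; trivial. split; trivial.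
assert (H := d_kk_increasing D tau (rr i) ltac:(lra) ltac:(lra) ltac:(lra)).
unfold kk in H at 2. rewrite Eu, powabs_1 in H. trivial.
Qed.

Lemma nodal_v_end i p' tau : (1 <= i <= k + 1)%nat -> same_up_to_sign p' p ->
  descent n q p' (c (i - 1)%nat) (z i) ->
  first_v_zero q p' (c (i - 1)%nat) (z i) tau ->
  ju1 p (z i) <> 0 -> solves n q p' (z i) ->
  jv p' (z i) < 0 /\ ju1 p' (z i) < 0 /\ 0 < jX n q p' (z i).
Proof.
intros Hi Hs D Ht Hz1 Hsol.
assert (Hz1' : ju1 p' (z i) <> 0) by (intros E; apply Hz1; now apply (sign_u1 p' _ Hs)).
assert (Hcz := d_cz _ _ _ _ _ D).
assert (Hleft := jet_continuous_left _ _ (solves_continuous _ _ _ _ Hsol)).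
destruct (descent_end n q p' _ _ tau D Ht Hz1' Hleft) as [Hv HX].
assert (Hu1 : ju1 p' (z i) <= 0).
{ apply (left_limit_le (ju1 p') (c (i - 1)%nat) (z i)); trivial; [apply Hleft|].
  intros r Hr. left. now apply (d_u1 _ _ _ _ _ D). }
repeat split; trivial; nra.
Qed.

Lemma nodal_ascent i p' tau : (1 <= i <= k)%nat -> same_up_to_sign p' p ->
  descent n q p' (c (i - 1)%nat) (z i) ->
  first_v_zero q p' (c (i - 1)%nat) (z i) tau ->
  ascent n q (jopp p') (z i) (c i).
Proof.
intros Hi Hs D Ht.
assert (Hzi := nd_zpos _ _ _ _ _ _ _ N i ltac:(lia)). assert (Hzk := z_le_next i Hi).
assert (Hz1 := nd_simple _ _ _ _ _ _ _ N i Hi).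
assert (Hsol := sign_sol p' (z i) Hs ltac:(lra)).
destruct (nodal_v_end i p' tau ltac:(lia) Hs D Ht Hz1 Hsol) as (Hv & Hu1 & HX).
destruct (nodal_ascending i p' Hi Hs Hu1) as [Hu Hu1'].
destruct (nd_c _ _ _ _ _ _ _ N i Hi) as [Hc Hc1]. assert (Hcb := c_bounds i Hi).
assert (Hso := sign_opp p' Hs).
assert (EF : jE q (jopp p') (c i) = F q (ju (jopp p') (c i))).
{ unfold jE. apply (sign_u1 _ _ Hso) in Hc1. rewrite Hc1. field. }
constructor; trivial; try lra.
- intros r Hr; apply sign_sol; trivial; lra.
- intros r Hr; simpl; assert (H := Hu r Hr); lra.
- intros r Hr; simpl; assert (H := Hu1' r Hr); lra.
- intros r Hr; apply sign_E; trivial; lra.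
- apply jet_continuous_right, jet_continuous_opp, (solves_continuous n q); trivial.
- apply sign_zero; trivial. apply (nd_zero _ _ _ _ _ _ _ N); lia.
- simpl; lra.
- now apply (sign_u1 _ _ Hso).
- simpl; lra.
- now rewrite jX_opp.
- rewrite jQ_opp, jM_opp.
  apply (descent_transport n q p' (c (i - 1)%nat) (z i) tau); trivial.
  + lra.
  + apply jet_continuous_left, (solves_continuous n q); trivial.
  + simpl. assert (H := Hu (c i) ltac:(lra)). lra.
  + rewrite <- EF. apply sign_E; trivial.
  (* [F (u (c_i)) = E (c_i) <= E (z_i) < E (r)] by dissipation of energy. *)
  + intros r Hr. rewrite <- EF, jE_opp.
    apply Rle_lt_trans with (jE q p' (z i)).
    * apply (energy_nonincreasing n); trivial; try lra.
      intros; apply sign_solu; trivial; lra.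
    * apply (d_E_decreasing D); lra.
Qed.

Lemma unique_zero p' a tau : same_up_to_sign p' p -> a < tau ->
  jv p' tau = 0 -> (forall r, a <= r < tau -> 0 < jv p' r) ->
  forall P : R -> Prop, (forall r, P r -> a <= r) -> P tau ->
  (forall r, tau < r -> P r -> jv p' r < 0) ->
  unique (fun r => P r /\ jv p r = 0) tau.
Proof.
intros Hs Hat Ev Hpos P Ha Pt Hneg. split.
- split; trivial. now apply (sign_v p' _ Hs).
- intros r [Pr Er]. apply (sign_v p' _ Hs) in Er.
  destruct (Rtotal_order tau r) as [H|[H|H]]; trivial.
  + assert (H1 := Hneg r H Pr); lra.
  + assert (H1 := Hpos r (conj (Ha r Pr) H)); lra.
Qed.

Lemma nodal_inner i : (1 <= i <= k)%nat ->
  (i = 1%nat \/ QMT_start n q p (c (i - 1)%nat)) ->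
  (exists tau, unique (fun t => c (i - 1)%nat <= t <= c i /\ jv p t = 0) tau /\
     c (i - 1)%nat < tau < rr i) /\
  QMT_start n q p (c i).
Proof.
intros Hi Hstart.
destruct (nodal_descent i ltac:(lia) Hstart) as (p' & Hs & D).
destruct (nodal_first_zero i p' ltac:(lia) Hs D) as (tau & Ht & Htr).
assert (A := nodal_ascent i p' tau Hi Hs D Ht).
destruct (descent_variation D tau Ht) as (HvJ & _).
destruct (nd_c _ _ _ _ _ _ _ N i Hi) as [Hc _].
split.
- exists tau; split; trivial. destruct Ht as (Ht & Ev & _ & Hpos).
  apply (unique_zero p' (c (i - 1)%nat) tau Hs ltac:(lra) Ev Hpos
    (fun t => c (i - 1)%nat <= t <= c i)); trivial.
  + intros r Hr; lra.
  + lra.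
  + intros r Hr Pr. destruct (Rlt_or_le r (z i)) as [H|H]; [apply HvJ; lra|].
    assert (H1 := a_v_pos A r ltac:(lra)). simpl in H1; lra.
- destruct (a_all A) as (_ & HQ & _).
  assert (H : QMT_start n q (jopp p') (c i)).
  { split; [exact HQ|split; [exact (a_M_pos A)|exact (a_T_pos A)]]. }
  exact (proj1 (sign_QMT p' (c i) Hs) (proj1 (QMT_start_opp n q p' (c i)) H)).
Qed.

Lemma nodal_last_simple : (1 <= k)%nat -> ju1 p (z (k + 1)%nat) <> 0 ->
  solves n q p (z (k + 1)%nat) -> QMT_start n q p (c k) ->
  exists tau, unique (fun t => c k <= t <= z (k + 1)%nat /\ jv p t = 0) tau /\
    c k < tau < rr (k + 1)%nat.
Proof.
intros Hk Hz1 Hsol Hstart.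
assert (Ek : (k + 1 - 1)%nat = k) by lia.
destruct (nodal_descent (k + 1) ltac:(lia)) as (p' & Hs & D).
{ right; now rewrite Ek. }
destruct (nodal_first_zero (k + 1) p' ltac:(lia) Hs D) as (tau & Ht & Htr).
assert (Hsol' : solves n q p' (z (k + 1)%nat)).
{ destruct Hs as [->| ->]; [trivial|now apply solves_opp]. }
destruct (nodal_v_end (k + 1) p' tau ltac:(lia) Hs D Ht Hz1 Hsol') as (Hvz & _ & _).
destruct (descent_variation D tau Ht) as (HvJ & _).
rewrite Ek in *. exists tau; split; trivial. destruct Ht as (Ht & Ev & _ & Hpos).
apply (unique_zero p' (c k) tau Hs ltac:(lra) Ev Hpos
  (fun t => c k <= t <= z (k + 1)%nat)); trivial.
- intros r Hr; lra.
- lra.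
- intros r Hr Pr. destruct (Req_dec r (z (k + 1)%nat)) as [->|]; [trivial|apply HvJ; lra].
Qed.

Lemma nodal_last_double : (1 <= k)%nat -> ju1 p (z (k + 1)%nat) = 0 ->
  QMT_start n q p (c k) ->
  (exists tau, unique (fun t => (c k <= t /\ t < z (k + 1)%nat) /\ jv p t = 0) tau /\
     c k < tau < rr (k + 1)%nat) /\
  eventually_monotone_left (jv p) (z (k + 1)%nat) /\
  filterlim (fun r => Rabs (jv p r)) (at_left (z (k + 1)%nat)) (Rbar_locally p_infty).
Proof.
intros Hk Hz1 Hstart.
assert (Ek : (k + 1 - 1)%nat = k) by lia.
destruct (nodal_descent (k + 1) ltac:(lia)) as (p' & Hs & D).
{ right; now rewrite Ek. }
destruct (nodal_first_zero (k + 1) p' ltac:(lia) Hs D) as (tau & Ht & Htr).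
destruct (descent_variation D tau Ht) as (HvJ & _).
assert (Hm := eventually_monotone_at_zero _ _ _ _ _ _ D Ht).
assert (Hz1' : ju1 p' (z (k + 1)%nat) = 0) by now apply (sign_u1 p' _ Hs).
assert (Hb := blow_up_at_double_zero _ _ _ _ _ _ D Ht Hz1').
rewrite Ek in *. split; [|split].
- exists tau; split; trivial. destruct Ht as (Ht & Ev & _ & Hpos).
  apply (unique_zero p' (c k) tau Hs ltac:(lra) Ev Hpos
    (fun t => c k <= t /\ t < z (k + 1)%nat)); trivial.
  + intros r Hr; lra.
  + lra.
  + intros r Hr Pr. apply HvJ; lra.
- destruct Hs as [->| ->]; trivial. destruct Hm as (a & Ha & Hm). exists a; split; trivial.
  simpl in Hm. destruct Hm as [Hm|Hm]; [right|left]; intros s t H1 H2 H3;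
    specialize (Hm s t H1 H2 H3); lra.
- intros P [K HP]. unfold filtermap.
  apply (filter_imp (fun r => K < Rabs (jv p' r))); [|exact (Hb K)].
  intros r Hr. apply HP.
  destruct Hs as [->| ->]; trivial. simpl in Hr. now rewrite Rabs_Ropp in Hr.
Qed.

End Nodal.

(** * From the hypotheses to jets *)

(* [Derive w 0] is meaningless, so the derivatives are set to their right limit
   [0] at the origin. *)
Definition derivative0 (w : R -> R) (r : R) : R := if Req_EM_T r 0 then 0 else Derive w r.

Definition jet_of (u v : R -> R) : jet := Jet u (derivative0 u) v (derivative0 v).

Lemma derivative0_eq w r : r <> 0 -> derivative0 w r = Derive w r.
Proof. intros H; unfold derivative0; now destruct (Req_EM_T r 0). Qed.

Lemma derivative0_near w r : 0 < r -> locally r (fun s => Derive w s = derivative0 w s).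
Proof.
intros Hr; exists (mkposreal r Hr); intros s Hs.
change (Rabs (s - r) < r) in Hs; apply Rabs_def2 in Hs. rewrite derivative0_eq; lra.
Qed.

Lemma is_derive_derivative0 w r : 0 < r -> ex_derive w r -> is_derive w r (derivative0 w r).
Proof. intros Hr H; rewrite derivative0_eq by lra. now apply Derive_correct. Qed.

Lemma is_derive2_derivative0 w r : 0 < r -> ex_derive (Derive w) r ->
  is_derive (derivative0 w) r (Derive (Derive w) r).
Proof.
intros Hr H. apply (is_derive_ext_loc (Derive w)); [now apply derivative0_near|].
now apply Derive_correct.
Qed.

Lemma C1_init_right w b w0 : C1_init w b w0 0 ->
  continuous_along (at_right 0) w 0 /\ continuous_along (at_right 0) (derivative0 w) 0.
Proof.
intros H; split.
- assert (HG : Filter (at_right 0)) by apply _.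
  unfold continuous_along.
  (* Right continuity at the origin is extracted from the limit of the slopes. *)
  apply (filterlim_ext_loc (fun r => w 0 + r * ((w r - w 0) / r))).
  { apply (ex_at_right 0 _ 1); [lra|]. intros r Hr; field; lra. }
  assert (L1 := C1_slope _ _ _ _ H).
  assert (L2 : filterlim (fun r => r * ((w r - w 0) / r)) (at_right 0) (locally (0 * 0))).
  { apply (filterlim_comp_2 (G := locally 0) (H := locally 0)
      (fun r => r) (fun r => (w r - w 0) / r) Rmult).
    - apply continuous_along_id_right.
    - exact L1.
    - apply (filterlim_mult (K := R_AbsRing) 0 0). }
  cut (filterlim (fun r => w 0 + r * ((w r - w 0) / r)) (at_right 0) (locally (w 0 + 0 * 0))).
  { now rewrite Rmult_0_r, Rplus_0_r. }
  apply (filterlim_comp_2 (G := locally (w 0)) (H := locally (0 * 0))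
    (fun r => w 0) (fun r => r * ((w r - w 0) / r)) Rplus).
  + apply filterlim_const.
  + exact L2.
  + apply (filterlim_plus (V := R_NormedModule) (w 0) (0 * 0)).
- unfold continuous_along. unfold derivative0 at 2. destruct (Req_EM_T 0 0); [|easy].
  apply (filterlim_ext_loc (Derive w)); [|exact (C1_cont0 _ _ _ _ H)].
  apply (ex_at_right 0 _ 1); [lra|]. intros r Hr; rewrite derivative0_eq; lra.
Qed.

Lemma solution_solves_u n q a u v r : solution n q a u -> 0 < r ->
  solves_u n q (jet_of u v) r.
Proof.
intros S Hr; split; simpl; trivial.
- apply is_derive_derivative0; trivial. now apply (C1_deriv _ _ _ _ (sol_C1 _ _ _ _ S)).
- assert (Hode := sol_ode _ _ _ _ S r Hr).
  replace (- (INR n - 1) / r * derivative0 u r - f q (u r)) with (Derive (Derive u) r).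
  + apply is_derive2_derivative0; trivial. now apply (sol_C2 _ _ _ _ S).
  + rewrite derivative0_eq by lra. unfold Rdiv in *. lra.
Qed.

Lemma variation_solves n q a U zu v r : solution n q a (U a) -> variation n q a U zu v ->
  0 < r -> Rbar_lt r zu -> solves n q (jet_of (U a) v) r.
Proof.
intros S V Hr Hz. assert (C := var_C1 _ _ _ _ _ _ V).
split; simpl.
- now apply (solution_solves_u n q a).
- apply is_derive_derivative0; trivial. now apply (C1_deriv _ _ _ _ C).
- apply (continuous_ext_loc _ (Derive v)).
  + generalize (derivative0_near v r Hr). apply filter_imp; intros s Hs; now rewrite Hs.
  + now apply (C1_cont _ _ _ _ C).
- intros H0. assert (Hode := var_ode _ _ _ _ _ _ V r Hr Hz H0).
  rewrite Derive_f in Hode by trivial.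
  replace (- (INR n - 1) / r * derivative0 v r
    - (1 - (q - 1) * powabs (U a r) (q - 2)) * v r) with (Derive (Derive v) r).
  + apply is_derive2_derivative0; trivial. now apply (var_C2 _ _ _ _ _ _ V).
  + rewrite derivative0_eq by lra. unfold Rdiv in *. lra.
Qed.

(* If the energy vanished before the zero [Z], the solution would be constant,
   hence zero, from there to [Z]. *)
Lemma energy_pos n q p Z : (2 <= n)%nat -> 1 < q ->
  (forall r, 0 < r -> solves_u n q p r) -> ju p Z = 0 ->
  (forall r, 0 < r < Z -> ~ (ju p r = 0 /\ ju1 p r = 0)) ->
  forall r, 0 < r < Z -> 0 < jE q p r.
Proof.
intros Hn Hq S HZ Hno r Hr. assert (HN := INR_ge2 n Hn).
assert (HEZ : 0 <= jE q p Z).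
{ unfold jE; rewrite HZ, F_0. assert (H := pow2_ge_0 (ju1 p Z)). lra. }
apply Rnot_le_lt; intros HE.
assert (Hconst : forall s, r <= s <= Z -> jE q p s = 0).
{ intros s Hs.
  assert (H1 := energy_nonincreasing n q p r s Hn Hq ltac:(lra) ltac:(intros; apply S; lra)).
  assert (H2 := energy_nonincreasing n q p s Z Hn Hq ltac:(lra) ltac:(intros; apply S; lra)). lra. }
assert (Hu1 : forall s, r < s < Z -> ju1 p s = 0).
{ intros s Hs.
  assert (D1 := is_derive_jE n q p s Hq (S s ltac:(lra))).
  assert (D0 : is_derive (jE q p) s 0).
  { apply (is_derive_ext_loc (fun _ : R => 0)).
    - assert (Hd : 0 < Rmin (s - r) (Z - s)) by (apply Rmin_pos; lra).
      exists (mkposreal _ Hd); intros t Ht. change (Rabs (t - s) < Rmin (s - r) (Z - s)) in Ht.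
      assert (M1 := Rmin_l (s - r) (Z - s)). assert (M2 := Rmin_r (s - r) (Z - s)).
      apply Rabs_def2 in Ht. symmetry; apply Hconst; lra.
    - exact (is_derive_const (K := R_AbsRing) (V := R_NormedModule) 0 s). }
  apply is_derive_unique in D1. apply is_derive_unique in D0. rewrite D0 in D1.
  assert (Hp : 0 < (INR n - 1) / s) by pos.
  assert (E : (INR n - 1) / s * ju1 p s ^ 2 = 0).
  { replace ((INR n - 1) / s * ju1 p s ^ 2) with (- (- (INR n - 1) / s * ju1 p s ^ 2))
      by (field; lra). lra. }
  apply Rmult_integral in E. destruct E as [E|E]; [lra|].
  apply Rsqr_0_uniq. unfold Rsqr. lra. }
set (m := (r + Z) / 2). assert (Hm : r < m < Z) by (unfold m; lra).
apply (Hno m); [lra|]. split; [|now apply Hu1].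
assert (Hc : forall s, 0 < s -> jet_continuous_u (locally s) p s).
{ intros s Hs. now apply (solves_u_continuous n q), S. }
rewrite <- HZ. apply Rle_antisym.
- apply (nondecreasing_closed (ju p) (ju1 p)); [lra| | | |].
  + apply continuous_right, Hc; lra.
  + apply continuous_left, Hc; lra.
  + intros s Hs; apply S; lra.
  + intros s Hs; rewrite Hu1; lra.
- cut (- ju p m <= - ju p Z); [lra|].
  apply (nondecreasing_closed (fun s => - ju p s) (fun s => - ju1 p s)); [lra| | | |].
  + apply continuous_along_opp; [apply _|]. apply continuous_right, Hc; lra.
  + apply continuous_along_opp; [apply _|]. apply continuous_left, Hc; lra.
  + intros s Hs; apply (is_derive_opp (ju p)), S; lra.
  + intros s Hs; rewrite Hu1; lra.
Qed.

(** The common core of the two cases: [z (k + 1)] is [zu] itself for a bound state and a listed zero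
    otherwise, so the zeros strictly before it are [z 1, ..., z k] in both. *)
Lemma nodal_of_hypotheses (n : nat) (q alpha : R) (U : R -> R -> R) (zu : Rbar)
    (v : R -> R) (k : nat) (z c rr : nat -> R) :
  (2 <= n)%nat -> 1 < q < 2 -> 0 < alpha ->
  solution n q alpha (U alpha) -> variation n q alpha U zu v ->
  labels (U alpha) k z c rr ->
  (forall i j, (1 <= i)%nat -> (i < j)%nat -> (j <= k + 1)%nat -> z i < z j) ->
  (forall r, 0 < r < z (k + 1)%nat -> Rbar_lt r zu) ->
  (forall r, (0 < r < z (k + 1)%nat /\ U alpha r = 0) <->
     exists i, (1 <= i <= k)%nat /\ r = z i) ->
  0 < z (k + 1)%nat -> U alpha (z (k + 1)%nat) = 0 ->
  (forall r, 0 < r < z (k + 1)%nat -> ~ double_zero (U alpha) r) ->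
  nodal n q (jet_of (U alpha) v) k z c rr.
Proof.
intros Hn Hq Ha S V L Hinc Hlt Hz HZ0 HZ Hdz.
assert (Hsu : forall r, 0 < r -> solves_u n q (jet_of (U alpha) v) r).
{ intros r Hr; now apply (solution_solves_u n q alpha). }
destruct (C1_init_right _ _ _ (sol_C1 _ _ _ _ S)) as [Cu Cu1].
destruct (C1_init_right _ _ _ (var_C1 _ _ _ _ _ _ V)) as [Cv Cv1].
assert (Hi : forall i, (1 <= i <= k)%nat ->
  0 < z i < z (k + 1)%nat /\ U alpha (z i) = 0).
{ intros i Hi. apply Hz. now exists i. }
assert (Hzp : forall i, (1 <= i <= k + 1)%nat -> 0 < z i <= z (k + 1)%nat).
{ intros i H. destruct (Nat.eq_dec i (k + 1)) as [->|]; [lra|].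
  destruct (Hi i ltac:(lia)); lra. }
assert (Hnd : forall r, 0 < r < z (k + 1)%nat ->
  ~ (U alpha r = 0 /\ derivative0 (U alpha) r = 0)).
{ intros r Hr [E1 E2]. rewrite derivative0_eq in E2 by lra.
  apply (Hdz r Hr). now repeat split. }
(* The index [i = 0] stands for the interval from the origin to [z 1], which has no zero of [u] at
   its left end. *)
assert (Hnz : forall i r, (i <= k)%nat -> 0 < r -> ((1 <= i)%nat -> z i < r) ->
  r < z (i + 1)%nat -> U alpha r <> 0).
{ intros i r Hik Hr0 Hir Hri E.
  assert (Hrk : r < z (k + 1)%nat).
  { apply Rlt_le_trans with (z (i + 1)%nat); trivial. apply Hzp; lia. }
  destruct (proj1 (Hz r) ltac:(now split)) as [j [Hj ->]].
  destruct (Nat.lt_trichotomy j i) as [H|[H|H]].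
  - assert (H1 := Hinc j i ltac:(lia) H ltac:(lia)). specialize (Hir ltac:(lia)). lra.
  - subst j. specialize (Hir ltac:(lia)). lra.
  - destruct (Nat.eq_dec j (i + 1)) as [->|]; [lra|].
    assert (H1 := Hinc (i + 1)%nat j ltac:(lia) ltac:(lia) ltac:(lia)). lra. }
constructor; trivial.
- intros r Hr. apply (variation_solves n q alpha U zu); trivial; [lra|now apply Hlt].
- split; [split; [apply _|apply continuous_along_id_right| |]| |]; trivial.
- unfold jet_of, derivative0; simpl. now destruct (Req_EM_T 0 0).
- exact (C1_value _ _ _ _ (var_C1 _ _ _ _ _ _ V)).
- simpl. rewrite (C1_value _ _ _ _ (sol_C1 _ _ _ _ S)); trivial.
- intros i H. apply Hinc; lia.
- intros i H. destruct (Nat.eq_dec i (k + 1)) as [->|]; [trivial|]. apply Hi; lia.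
- intros i H E. destruct (Hi i H) as [H1 H2]. now apply (Hnd (z i) H1).
- intros r Hr. apply (Hnz 0%nat); simpl; try lra; try lia.
- intros i r H Hr. destruct (Hi i H). apply (Hnz i); try lia; try lra.
- apply (energy_pos n q _ (z (k + 1)%nat)); trivial; lra.
- exact (lab_c0 _ _ _ _ _ L).
- intros i H. destruct (lab_c _ _ _ _ _ L i H) as [H1 H2]. split; trivial.
  simpl. destruct (Hi i H). rewrite derivative0_eq; lra.
- exact (lab_r _ _ _ _ _ L).
Qed.

Theorem lemma4p1 (n : nat) (q alpha : R) (U : R -> R -> R) (zu : Rbar)
    (v : R -> R) (k : nat) (z c rr : nat -> R)
    (u := U alpha)
    (hn : (2 <= n)%nat) (hq : 1 < q < 2) (halpha : 0 < alpha)
    (hU : forall a, 0 < a -> solution n q a (U a))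
    (hzu : first_double_zero u zu)
    (hnodal : changes_sign u zu)
    (hv : variation n q alpha U zu v)
    (hk : (1 <= k)%nat)
    (hbound : bound_state u ->
       zeros_before u zu k z /\ zu = Finite (z (k + 1)%nat))
    (hnbound : ~ bound_state u ->
       zeros_before u zu (k + 1) z /\ zu = p_infty)
    (hlab : labels u k z c rr) :
  QMT_pos n q u v (c 1%nat) /\
  (forall i, (2 <= i <= k)%nat -> QMT_pos n q u v (c (i - 1)%nat) ->
     (exists tau,
        unique (fun t => c (i - 1)%nat <= t <= c i /\ v t = 0) tau /\
        c (i - 1)%nat < tau < rr i) /\
     QMT_pos n q u v (c i)) /\
  (~ bound_state u -> QMT_pos n q u v (c k) ->
     exists tau,
       unique (fun t => c k <= t <= z (k + 1)%nat /\ v t = 0) tau /\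
       c k < tau < rr (k + 1)%nat) /\
  (bound_state u -> QMT_pos n q u v (c k) ->
     (exists tau,
        unique (fun t => (c k <= t /\ Rbar_lt t zu) /\ v t = 0) tau /\
        c k < tau < rr (k + 1)%nat) /\
     eventually_monotone_left v zu /\
     filterlim (fun r => Rabs (v r)) (at_left zu) (Rbar_locally p_infty)).
Proof.
assert (S := hU alpha halpha). fold u in S.
set (p := jet_of u v).
assert (N : nodal n q p k z c rr).
{ unfold p, u in *. destruct (classic (bound_state (U alpha))) as [Hb|Hb].
  - destruct (hbound Hb) as [[Hinc Hz] ->]. simpl in Hz. destruct hzu as [[H1 [H2 _]] H3].
    assert (Hz' : forall r, (0 < r < z (k + 1)%nat /\ U alpha r = 0) <->
      exists i, (1 <= i <= k)%nat /\ r = z i).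
    { intros r. rewrite <- Hz. tauto. }
    apply (nodal_of_hypotheses n q alpha U (z (k + 1)%nat)); trivial.
    (* For a bound state [z (k + 1)] is not in the list of zeros; it exceeds them because they lie
       in [(0, zu)]. *)
    + intros i j Hi Hij Hj. destruct (Nat.eq_dec j (k + 1)) as [->|]; [|apply Hinc; lia].
      apply Hz'. exists i; split; [lia|trivial].
    + intros r Hr; simpl; lra.
    + intros r Hr; apply H3; lra.
  - destruct (hnbound Hb) as [[Hinc Hz] ->]. simpl in hzu, Hz.
    assert (Hlast : 0 < z (k + 1)%nat /\ U alpha (z (k + 1)%nat) = 0).
    { destruct (proj2 (Hz (z (k + 1)%nat))) as (A & _ & B); [|now split].
      exists (k + 1)%nat; split; [lia|trivial]. }
    apply (nodal_of_hypotheses n q alpha U p_infty); trivial; try apply Hlast.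
    + now intros r _.
    + intros r. split.
      * intros [Hr E]. destruct (proj1 (Hz r)) as [i [Hi Ei]]; [now repeat split|].
        exists i; split; trivial. destruct (Nat.eq_dec i (k + 1)) as [->|]; [|lia]. lra.
      * intros [i [Hi ->]]. destruct (proj2 (Hz (z i))) as (A & _ & B).
        { exists i; split; [lia|trivial]. }
        split; trivial. split; trivial. apply Hinc; lia. }
assert (HQ : forall i, (1 <= i <= k)%nat ->
  QMT_start n q p (c i) <-> QMT_pos n q u v (c i)).
{ intros i Hi. assert (Hc := c_bounds N i Hi).
  apply QMT_start_pos; trivial; [lra| |]; apply derivative0_eq; lra. }
split; [|split; [|split]].
(* The assertion at [c_1] is the inductive step started at [c_0 = 0]. *)
- apply HQ; [lia|]. apply (nodal_inner N 1); [lia|now left].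
- intros i Hi Hs. apply HQ in Hs; [|lia].
  destruct (nodal_inner N i ltac:(lia) (or_intror Hs)) as [Hu Hs'].
  split; trivial. apply HQ; [lia|trivial].
- intros Hb Hs. apply HQ in Hs; [|lia].
  destruct (hnbound Hb) as [[_ Hz] ->].
  assert (Hzk := nd_zpos _ _ _ _ _ _ _ N (k + 1)%nat ltac:(lia)).
  apply (nodal_last_simple N hk); trivial.
  (* Without a double zero, [z (k + 1)] is simple. *)
  + intros E. apply (hzu (z (k + 1)%nat)). simpl in E. rewrite derivative0_eq in E by lra.
    repeat split; trivial; [lra|]. apply (nd_zero _ _ _ _ _ _ _ N); lia.
  + apply (variation_solves n q alpha U p_infty); trivial; simpl; trivial; lra.
- intros Hb Hs. apply HQ in Hs; [|lia].
  destruct (hbound Hb) as [_ ->]. destruct hzu as [(H1 & H2 & H3) _].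
  apply (nodal_last_double N hk); trivial.
  simpl. rewrite derivative0_eq; lra.
Qed.
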